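(* Let $k\in(0,1)$ and $T=4K(k)$. Let $k_c$ be the unique $k\in(0,1)$ such that $K(k)=2E(k)$ ($k_c\approx0.908$). Spectral stability in $P_T$ holds for: - $u=\mathrm{sn}(\cdot,k)$, for every $k\in(0,1)$; - $u=\mathrm{cn}(\cdot,k)$, for every $k\in(0,k_c)$. That is, the spectrum of the linearized operator $J\mathcal L$ about $u$, acting on $(P_T)^2$ with domain $(H^2_{\mathrm{loc}}\cap P_T)^2$, is contained in $i\mathbb R$.
   Context: $P_T=\{f\in L^2_{\mathrm{loc}}(\mathbb R;\mathbb C): f(x+T)=f(x)\}$, a complex Hilbert space with $(f,g)=\int_0^T f\bar g\,dx$. A real-valued periodic solution $u$ of $u_{xx}+au+bu^3=0$ ($a,b\in\mathbb R$) gives a standing wave $e^{-iat}u(x)$ of the nonlinear Schrödinger equation $i\psi_t+\psi_{xx}+b|\psi|^2\psi=0$. Its linearized operator is $$J\mathcal L=\begin{pmatrix}0&L_-\\-L_+&0\end{pmatrix},\quad L_+=-\partial_{xx}-a-3bu^2,\quad L_-=-\partial_{xx}-a-bu^2.$$ For $u=\mathrm{sn}(\cdot,k)$: $a=1+k^2$, $b=-2k^2$. For $u=\mathrm{cn}(\cdot,k)$: $a=1-2k^2$, $b=2k^2$. Jacobi elliptic functions with modulus $k\in(0,1)$: with $x=F(\phi,k)=\int_0^\phi\frac{d\theta}{\sqrt{1-k^2\sin^2\theta}}$, $\mathrm{sn}(x,k)=\sin\phi$, $\mathrm{cn}(x,k)=\cos\phi$. Complete elliptic integrals: $K(k)=F(\pi/2,k)$,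 $E(k)=\int_0^{\pi/2}\sqrt{1-k^2\sin^2\theta}\,d\theta$. *)

(* Defs.v *)
From HB Require Import structures.
From mathcomp Require Import all_boot all_order all_algebra.
From mathcomp Require Import all_classical all_reals all_analysis.
From mathcomp Require Export complex.

Set Implicit Arguments.
Unset Strict Implicit.
Unset Printing Implicit Defensive.

Import Order.TTheory GRing.Theory Num.Theory.
Import numFieldNormedType.Exports.

Local Open Scope classical_set_scope.
Local Open Scope ring_scope.

Section JacobiElliptic.
Context {R : realType}.
Implicit Types (k x phi theta : R).

(* The integral from 0 to phi is oriented, so that F is odd in phi. *)
Definition ellipF phi k : R :=
  let g theta := (Num.sqrt (1 - k ^+ 2 * sin theta ^+ 2))^-1 in
  if 0 <= phi then \int[lebesgue_measure]_(theta in `[0, phi]) g theta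
  else - \int[lebesgue_measure]_(theta in `[phi, 0]) g theta.

Definition ellipK k : R := ellipF (pi / 2) k.

Definition ellipE k : R :=
  \int[lebesgue_measure]_(theta in `[0, pi / 2])
    Num.sqrt (1 - k ^+ 2 * sin theta ^+ 2).

(* For 0 < k < 1, [ellipF ^~ k] is a bijection of the real line, so this is
   the unique phi with F(phi, k) = x. *)
Definition jacobi_am k x : R := xget 0 [set phi | ellipF phi k = x].
Definition jacobi_sn k x : R := sin (jacobi_am k x).
Definition jacobi_cn k x : R := cos (jacobi_am k x).

End JacobiElliptic.

(* Elements of function spaces are represented by Borel functions, equality
   being almost everywhere equality; every Lebesgue measurable function is
   almost everywhere equal to a Borel one. *)
Section PeriodicSpaces.
Context {R : realType}.
Implicit Types (f g : R -> R[i]) (T : R).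

Definition ae_eqC f g : Prop := {ae lebesgue_measure, forall x : R, f x = g x}.

Definition cmeasurable f : Prop :=
  measurable_fun setT (fun x : R => complex.Re (f x)) /\
  measurable_fun setT (fun x : R => complex.Im (f x)).

Definition cintegral (A : set R) f : R[i] :=
  Complex (\int[lebesgue_measure]_(x in A) complex.Re (f x))
          (\int[lebesgue_measure]_(x in A) complex.Im (f x)).

Definition L2loc f : Prop :=
  cmeasurable f /\
  forall c d : R,
    (\int[lebesgue_measure]_(x in `[c, d]) (complex.Re `|f x| ^+ 2)%:E < +oo)%E.

Definition PT T f : Prop := L2loc f /\ ae_eqC (fun x => f (x + T)) f.

Definition inner T f g : R[i] :=
  cintegral `[0, T] (fun x => f x * conjc (g x)).

Definition test_function (phi : R -> R) : Prop :=
  (forall n x, derivable (derive1n n phi) x 1) /\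
  exists M : R, forall x, M < `|x| -> phi x = 0.

Definition is_weak_derivative f g : Prop :=
  L2loc g /\
  forall phi, test_function phi ->
    cintegral setT (fun x => f x * (derive1 phi x)%:C%C) =
    - cintegral setT (fun x => g x * (phi x)%:C%C).

(* A representative of the weak derivative, which is unique up to almost
   everywhere equality. *)
Definition weak_derive f : R -> R[i] :=
  xget (fun=> 0) [set g | is_weak_derivative f g].

Definition H2loc f : Prop :=
  [/\ L2loc f, exists g, is_weak_derivative f g
    & exists h, is_weak_derivative (weak_derive f) h].

End PeriodicSpaces.

(* An operator A with domain D in a normed space which is the quotient of
   X by eqv: lambda is in the resolvent set when A - lambda is a bijection from
   D onto X (both modulo eqv) with bounded inverse. *)
Section Spectrum.
Context {R : realType} {V : lmodType R[i]}.
Variables (X D : set V) (eqv : V -> V -> Prop) (nrm : V -> R) (A : V -> V).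

Definition resolvent_set : set R[i] := [set lambda |
  [/\ forall g, X g -> exists2 f, D f & eqv (A f - lambda *: f) g,
      forall f1 f2, D f1 -> D f2 ->
        eqv (A f1 - lambda *: f1) (A f2 - lambda *: f2) -> eqv f1 f2
    & exists C : R, forall f, D f -> nrm f <= C * nrm (A f - lambda *: f)]].

Definition spectrum : set R[i] := ~` resolvent_set.

End Spectrum.

Section LinearizedNLS.
Context {R : realType}.
Local Notation V := (R -> R[i]).
Implicit Types (f : V) (F G : V * V).

Definition Lplus (a b : R) (u : R -> R) f : V := fun x =>
  - weak_derive (weak_derive f) x - a%:C%C * f x
    - (3 * b * u x ^+ 2)%:C%C * f x.

Definition Lminus (a b : R) (u : R -> R) f : V := fun x =>
  - weak_derive (weak_derive f) x - a%:C%C * f x - (b * u x ^+ 2)%:C%C * f x.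

Definition JL (a b : R) (u : R -> R) F : V * V :=
  (Lminus a b u F.2, - Lplus a b u F.1).

Definition PT2 (T : R) : set (V * V) := [set F | PT T F.1 /\ PT T F.2].

Definition domJL (T : R) : set (V * V) :=
  [set F | (H2loc F.1 /\ PT T F.1) /\ (H2loc F.2 /\ PT T F.2)].

Definition ae_eqC2 F G : Prop := ae_eqC F.1 G.1 /\ ae_eqC F.2 G.2.

Definition normPT2 (T : R) F : R :=
  Num.sqrt (complex.Re (inner T F.1 F.1 + inner T F.2 F.2)).

Definition spectrally_stable (T a b : R) (u : R -> R) : Prop :=
  spectrum (PT2 T) (domJL T) ae_eqC2 (normPT2 T) (JL a b u)
    `<=` [set lambda | complex.Re lambda = 0].

End LinearizedNLS.

(* Main.v *)
(* Let q solve q'' + a q + b q^3 = 0, p = q', and suppose mu = Re lambda <> 0.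
   Written as a first-order real system for (u, v, u', v'), the equation
   (J L - lambda) (u, v) = g has T-periodic coefficients. Weak solutions are mild
   solutions of that system, so by the Fredholm alternative for its monodromy
   matrix lambda lies in the resolvent set once
     v'' = - (a + b q^2) v - lambda u,   u'' = - (a + 3 b q^2) u + lambda v
   has no nonzero T-periodic solution. This is shown with fluxes: quadratic
   expressions in (u, v, u', v') whose derivative is mu times a sum of squares.
   For sn there are two fluxes, one for each root of be^2 = k^2, which are smooth
   and periodic; hence both sums of squares vanish, which forces u = v = 0.
   For cn one splits (u, v) according to its parities about 0 and the quarter
   period K. Each class has its own flux on ]0, K[, built from quotients by q, p
   or sn; these blow up at most at an endpoint, where the parity conditions still
   make the flux tend to 0, so that it vanishes together with its derivative.
   The critical modulus is unique because the integrand
   1 / s - 2 s, s = sqrt (1 - k^2 sin^2), of K - 2 E increases with k. *)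
Require Import Defs.
From HB Require Import structures.
From mathcomp Require Import all_boot all_order all_algebra.
From mathcomp Require Import all_classical all_reals all_analysis.
From mathcomp Require Import measurable_realfun.
From mathcomp Require Import ring lra.
Import Order.TTheory GRing.Theory Num.Theory.
Import numFieldNormedType.Exports.
Set Implicit Arguments.
Unset Strict Implicit.
Unset Printing Implicit Defensive.
Local Open Scope classical_set_scope.
Local Open Scope ring_scope.

(** * Derivatives and limits *)

(** With [L- v = lambda u] and [L+ u = - lambda v], the plain energy identity gives mu (<L+ u, u> +
    <L- v, v>) = 0. It does not decide stability by itself: [q] and [p] are null functions of [L-]
    and [L+], and both change sign on the period, so both forms have negative directions. The fluxes
    replace it by identities with a definite right-hand side. Their origin is the pair of Wronskians
    w = p u' - p' u and z = q v' - p v, for which w' = lambda p v and z' = - lambda q u; combining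
    them with [lambda v] and [lambda u], and using the energy relation for p^2, produces the
    squares. The analytic half exists because lying in the resolvent set means a bijection with
    bounded inverse, not just the absence of eigenfunctions, and because elements of the domain are
    known only almost everywhere, with [weak_derive] an arbitrary representative. A du Bois-Reymond
    lemma supplies C^1 representatives to which uniqueness for ordinary differential equations
    applies. Real and imaginary parts are separated throughout, so the system has eight real
    unknowns. *)

Section DerivativeRules.
Context {R : realType}.
Implicit Types (f g : R -> R) (x : R).

Lemma der_cst (c x : R) : is_derive x 1 (fun=> c) 0.
Proof. exact: is_derive_cst. Qed.

Lemma der_id x : is_derive x 1 (fun t : R => t) 1.
Proof. exact: is_derive_id. Qed.

Lemma der_add f g x df dg : is_derive x 1 f df -> is_derive x 1 g dg ->
  is_derive x 1 (fun t => f t + g t) (df + dg).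
Proof. exact: is_deriveD. Qed.

Lemma der_opp f x df : is_derive x 1 f df ->
  is_derive x 1 (fun t => - f t) (- df).
Proof. exact: is_deriveN. Qed.

Lemma der_mul f g x df dg : is_derive x 1 f df -> is_derive x 1 g dg ->
  is_derive x 1 (fun t => f t * g t) (df * g x + f x * dg).
Proof.
move=> hf hg; apply: (is_derive_eq (is_deriveM hf hg)).
by rewrite /GRing.scale /= addrC; congr (_ + _); rewrite mulrC.
Qed.

Lemma der_inv f x df : f x != 0 -> is_derive x 1 f df ->
  is_derive x 1 (fun t => (f t)^-1) (- (f x)^-1 ^+ 2 * df).
Proof.
move=> fx0 hf; apply: (is_derive_eq (is_deriveV fx0 hf)).
by rewrite /GRing.scale /= exprVn.
Qed.

Lemma der_exp f n x df : is_derive x 1 f df ->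
  is_derive x 1 (fun t => f t ^+ n) (n%:R * f x ^+ n.-1 * df).
Proof.
move=> hf; have -> : (fun t => f t ^+ n) = f ^+ n by rewrite exprfctE.
exact: is_deriveX.
Qed.

Lemma der_comp f g x df dg : is_derive x 1 g dg -> is_derive (g x) 1 f df ->
  is_derive x 1 (fun t => f (g t)) (df * dg).
Proof. by move=> hg hf; exact: (is_derive1_comp hf hg). Qed.

End DerivativeRules.

(* Proves [is_derive x 1 (fun t => E t) d], leaving [d = E'] and the
   nonvanishing of denominators. *)
Ltac der_step :=
  match goal with
  | |- is_derive _ _ (fun t => ?c) _ => eapply der_cst
  | |- is_derive _ _ (fun t => _ + _) _ => eapply der_add
  | |- is_derive _ _ (fun t => - _) _ => eapply der_opp
  | |- is_derive _ _ (fun t => _ * _) _ => eapply der_mul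
  | |- is_derive _ _ (fun t => _ ^+ _) _ => eapply der_exp
  | |- is_derive _ _ (fun t => _ ^-1) _ => eapply der_inv
  | |- is_derive _ _ (fun t => t) _ => eapply der_id
  | H : _ |- is_derive _ _ _ _ => solve [eapply H; eassumption | eapply H]
  end.
Ltac der := eapply is_derive_eq; [repeat der_step|cbv beta].

Section Monotone.
Context {R : realType}.
Implicit Types (f : R -> R) (x y : R).

Lemma der_continuous f x (df : R) : is_derive x 1 f df -> {for x, continuous f}.
Proof. by move=> [d _]; exact/differentiable_continuous/derivable1_diffP. Qed.

Lemma der_le f (df : R -> R) x y : x <= y ->
  (forall z, x <= z <= y -> is_derive z 1 f (df z)) ->
  (forall z, x <= z <= y -> 0 <= df z) -> f x <= f y.
Proof.
move=> xy hf hd.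
have cf : {within `[x, y], continuous f}.
  apply: continuous_in_subspaceT => z; rewrite inE /= in_itv /= => zI.
  exact: der_continuous (hf _ zI).
have df' z : z \in `]x, y[%R -> is_derive z 1 f (df z).
  by rewrite in_itv /= => /andP[/ltW xz /ltW zy]; apply: hf; rewrite xz.
have [z zI e] := MVT_segment xy df' cf.
by rewrite -subr_ge0 e mulr_ge0 ?subr_ge0// hd // -in_itv.
Qed.

End Monotone.

Section Limits.
Context {R : realType}.
Implicit Types (f g : R -> R) (l m : R).

(* Wrapping convergence keeps its definition from being unfolded when the rules
   below are applied. *)
Variant tends (F : set_system R) (f : R -> R) (l : R) : Prop :=
  Tends of f @ F --> l.

Lemma tendsP (F : set_system R) f l : tends F f l -> f @ F --> l.
Proof. by case. Qed.

Context (F : set_system R) {FF : ProperFilter F}.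

Lemma tends_eq f l m : tends F f l -> l = m -> tends F f m.
Proof. by move=> + <-. Qed.

Lemma tends_cst l : tends F (fun=> l) l.
Proof. by split; exact: cvg_cst. Qed.

Lemma tends_add f g l m : tends F f l -> tends F g m ->
  tends F (fun x => f x + g x) (l + m).
Proof. by move=> [?] [?]; split; exact: cvgD. Qed.

Lemma tends_opp f l : tends F f l -> tends F (fun x => - f x) (- l).
Proof. by move=> [?]; split; exact: cvgN. Qed.

Lemma tends_mul f g l m : tends F f l -> tends F g m ->
  tends F (fun x => f x * g x) (l * m).
Proof. by move=> [?] [?]; split; exact: cvgM. Qed.

Lemma tends_exp f l n : tends F f l -> tends F (fun x => f x ^+ n) (l ^+ n).
Proof.
move=> h; elim: n => [|n ih]; first by rewrite expr0; exact: tends_cst.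
by under [X in tends _ X]funext do rewrite exprS; rewrite exprS; exact: tends_mul.
Qed.

End Limits.

(** * One-sided limits of quotients, and functions squeezed between two zero limits *)

Section OneSided.
Context {R : realType}.
Implicit Types (f g df dg : R -> R) (x : R).

Lemma tends_right f x (df : R) : is_derive x 1 f df -> tends x^'+ f (f x).
Proof. by move=> h; split; apply: cvg_at_right_filter; exact: der_continuous h. Qed.

Lemma tends_left f x (df : R) : is_derive x 1 f df -> tends x^'- f (f x).
Proof. by move=> h; split; apply: cvg_at_left_filter; exact: der_continuous h. Qed.

(** L'Hopital's rule through Caratheodory slopes: [f] and [g] are continuous slopes times [t - x],
    and this factor cancels off [x]. *)
Lemma quot_lim f g x (a b : R) : is_derive x 1 f a -> is_derive x 1 g b ->
    f x = 0 -> g x = 0 -> b != 0 ->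
  tends x^'+ (fun t => f t / g t) (a / b) /\
  tends x^'- (fun t => f t / g t) (a / b).
Proof.
move=> /is_derive1_caratheodory[F [Ff cF Fx]].
move=> /is_derive1_caratheodory[G [Gg cG Gx]] f0 g0 b0.
have c : F t / G t @[t --> x] --> a / b.
  by rewrite -Fx -Gx; apply: cvgM => //; apply: cvgV => //; rewrite Gx.
have e t : t != x -> F t / G t = f t / g t.
  move=> tx; move: (Ff t) (Gg t); rewrite f0 g0 !subr0 => -> ->.
  by rewrite -mulf_div divff ?mulr1// subr_eq0.
split; split.
- have := cvg_at_right_filter c; apply: cvg_trans; apply: near_eq_cvg.
  by near=> t; apply: e; near: t; exact: nbhs_right_neq.
- have := cvg_at_left_filter c; apply: cvg_trans; apply: near_eq_cvg.
  by near=> t; apply: e; near: t; exact: nbhs_left_neq.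
Unshelve. all: by end_near. Qed.

Lemma quot_right f g x (a b : R) : is_derive x 1 f a -> is_derive x 1 g b ->
    f x = 0 -> g x = 0 -> b != 0 ->
  tends x^'+ (fun t => f t / g t) (a / b).
Proof. by move=> *; apply: (quot_lim _ _ _ _ _).1. Qed.

Lemma quot_left f g x (a b : R) : is_derive x 1 f a -> is_derive x 1 g b ->
    f x = 0 -> g x = 0 -> b != 0 ->
  tends x^'- (fun t => f t / g t) (a / b).
Proof. by move=> *; apply: (quot_lim _ _ _ _ _).2. Qed.

Lemma tends_quot_right f g x (a b : R) : is_derive x 1 f a -> is_derive x 1 g b ->
    g x != 0 -> tends x^'+ (fun t => f t / g t) (f x / g x).
Proof.
move=> hf hg g0; split; apply: cvg_at_right_filter; apply: cvgM.
  exact: der_continuous hf.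
by apply: cvgV => //; exact: der_continuous hg.
Qed.

Lemma tends_quot_left f g x (a b : R) : is_derive x 1 f a -> is_derive x 1 g b ->
    g x != 0 -> tends x^'- (fun t => f t / g t) (f x / g x).
Proof.
move=> hf hg g0; split; apply: cvg_at_left_filter; apply: cvgM.
  exact: der_continuous hf.
by apply: cvgV => //; exact: der_continuous hg.
Qed.

(** Dividing by [m] makes [Phi] nondecreasing whatever the sign of [m]; limit 0 at both ends then
    forces it to vanish in between. Only one-sided limits enter, because the fluxes contain
    quotients that are singular at an endpoint. *)
Lemma flux_pinch (Phi d : R -> R) (m A B : R) : m != 0 ->
  (forall x, A < x < B -> is_derive x 1 Phi (m * d x)) ->
  (forall x, A < x < B -> 0 <= d x) ->
  tends A^'+ Phi 0 -> tends B^'- Phi 0 ->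
  forall x, A < x < B -> d x = 0.
Proof.
move=> m0 hP hd LA LB.
pose P x := m^-1 * Phi x.
have dP x : A < x < B -> is_derive x 1 P (d x).
  move=> xI; have h := hP _ xI; rewrite /P; der.
  by rewrite mul0r add0r mulKf.
have mon x y : A < x -> x <= y -> y < B -> P x <= P y.
  move=> Ax xy yB; apply: (der_le (df := d) xy) => z /andP[xz zy].
  - by apply: dP; lra.
  - by apply: hd; lra.
have PA : tends A^'+ P 0.
  by rewrite -(mulr0 m^-1); apply: tends_mul => //; exact: tends_cst.
have PB : tends B^'- P 0.
  by rewrite -(mulr0 m^-1); apply: tends_mul => //; exact: tends_cst.
have P0 x : A < x < B -> P x = 0.
  move=> /andP[Ax xB]; apply/eqP; rewrite eq_le; apply/andP; split.
  - apply: (cvgr_to_ge (tendsP PB)); near=> y.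
    by apply: mon => //; near: y; exact: nbhs_left_ge.
  - apply: (cvgr_to_le (tendsP PA)); near=> y.
    by apply: mon => //; near: y; exact: nbhs_right_le.
move=> x /andP[Ax xB]; have h : is_derive x 1 P (d x) by apply: dP; lra.
rewrite -(@derive_val _ _ _ _ _ _ _ h) -[RHS](derive_cst (0 : R) x (1 : R)).
apply: near_eq_derive.
near=> y; apply: P0; apply/andP; split; near: y.
- exact: lt_nbhsr.
- exact: lt_nbhsl.
Unshelve. all: by end_near. Qed.

End OneSided.

(* Proves [tends F (fun t => E t) 0], leaving the equation between the limit
   computed termwise and [0]. *)
Ltac lim_step :=
  lazymatch goal with
  | |- tends _ (fun t => _ + _) _ => eapply tends_add
  | |- tends _ (fun t => - _) _ => eapply tends_opp
  | |- tends _ (fun t => ?f t / ?g t) _ =>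
    match goal with H : tends _ (fun t => f t / g t) _ |- _ => exact H end
  | |- tends _ (fun t => _ * _) _ => eapply tends_mul
  | |- tends _ (fun t => _ ^+ _) _ => eapply tends_exp
  | |- tends _ ?f _ =>
    first [match goal with H : tends _ f _ |- _ => exact H end
          |eapply tends_cst]
  | |- ProperFilter _ => exact _
  end.
Ltac lims := eapply tends_eq; [repeat lim_step|].

Section ZeroSet.
Context {R : realType}.
Implicit Types (f : R -> R) (x : R).

Lemma der_zero f (A B x d : R) : (forall y, A < y < B -> f y = 0) ->
  A < x < B -> is_derive x 1 f d -> d = 0.
Proof.
move=> f0 /andP[Ax xB] h.
rewrite -(@derive_val _ _ _ _ _ _ _ h) -[RHS](derive_cst (0 : R) x (1 : R)).
apply: near_eq_derive; near=> y; apply: f0; apply/andP; split; near: y.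
- exact: lt_nbhsr.
- exact: lt_nbhsl.
Unshelve. all: by end_near. Qed.

(** Real form of cancelling a nonzero complex factor in (x + i y) (v + i w) = 0. *)
Lemma cmul_eq0 (x y v w : R) : x * v - y * w = 0 -> y * v + x * w = 0 ->
  x ^+ 2 + y ^+ 2 != 0 -> v = 0 /\ w = 0.
Proof.
move=> e1 e2 n; have ev : (x ^+ 2 + y ^+ 2) * v = 0.
  by rewrite -(mulr0 x) -{1}e1 -[RHS]addr0 -(mulr0 y) -{1}e2; ring.
have ew : (x ^+ 2 + y ^+ 2) * w = 0.
  by rewrite -(mulr0 x) -{1}e2 -[RHS]subr0 -(mulr0 y) -{1}e1; ring.
by split; [move/eqP: ev|move/eqP: ew]; rewrite mulf_eq0 (negbTE n) => /eqP.
Qed.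

Lemma sqrD_eq0 (x y : R) : x ^+ 2 + y ^+ 2 = 0 -> x = 0 /\ y = 0.
Proof.
move=> /eqP; rewrite paddr_eq0 ?sqr_ge0// !sqrf_eq0.
by move=> /andP[/eqP -> /eqP ->].
Qed.

End ZeroSet.

(** * Flux identities *)

Section Flux.
Context {R : realType}.
Implicit Types (x : R).
Variables (a b mu nu : R) (q p u1 u2 v1 v2 U1 U2 V1 V2 : R -> R).
Hypothesis Hq : forall x, is_derive x 1 q (p x).
Hypothesis Hp : forall x, is_derive x 1 p (- a * q x - b * q x ^+ 3).
Hypothesis Hu1 : forall x, is_derive x 1 u1 (U1 x).
Hypothesis Hu2 : forall x, is_derive x 1 u2 (U2 x).
Hypothesis Hv1 : forall x, is_derive x 1 v1 (V1 x).
Hypothesis Hv2 : forall x, is_derive x 1 v2 (V2 x).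
Hypothesis HU1 : forall x, is_derive x 1 U1
  (- (a + 3 * b * q x ^+ 2) * u1 x + (mu * v1 x - nu * v2 x)).
Hypothesis HU2 : forall x, is_derive x 1 U2
  (- (a + 3 * b * q x ^+ 2) * u2 x + (nu * v1 x + mu * v2 x)).
Hypothesis HV1 : forall x, is_derive x 1 V1
  (- (a + b * q x ^+ 2) * v1 x - (mu * u1 x - nu * u2 x)).
Hypothesis HV2 : forall x, is_derive x 1 V2
  (- (a + b * q x ^+ 2) * v2 x - (nu * u1 x + mu * u2 x)).

(* In complex notation, with lambda = mu + i nu, w = p u' - p' u and
   z = q v' - p v, the flux is
     Re ((lambda v' - 2 be p w / (1 + be q^2)) conj g
         - f conj (2 be p' z / (1 - be q^2) - lambda u')),
   where f = lambda v - 2 be q w / (1 + be q^2) and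
   g = - lambda u + 2 be p z / (1 - be q^2). *)
Section Defocusing.
Variables (be : R).
Hypothesis Hpp : forall x, p x ^+ 2 = 1 - a * q x ^+ 2 - b / 2 * q x ^+ 4.
Hypothesis Hb : b = - 2 * be ^+ 2.

Let f1 x := mu * v1 x - nu * v2 x - 2 * be * q x / (1 + be * q x ^+ 2) *
  (p x * U1 x - (- a * q x - b * q x ^+ 3) * u1 x).
Let f2 x := nu * v1 x + mu * v2 x - 2 * be * q x / (1 + be * q x ^+ 2) *
  (p x * U2 x - (- a * q x - b * q x ^+ 3) * u2 x).
Let g1 x := - (mu * u1 x - nu * u2 x) + 2 * be * p x / (1 - be * q x ^+ 2) *
  (q x * V1 x - p x * v1 x).
Let g2 x := - (nu * u1 x + mu * u2 x) + 2 * be * p x / (1 - be * q x ^+ 2) *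
  (q x * V2 x - p x * v2 x).
Let A1 x := mu * V1 x - nu * V2 x - 2 * be * p x / (1 + be * q x ^+ 2) *
  (p x * U1 x - (- a * q x - b * q x ^+ 3) * u1 x).
Let A2 x := nu * V1 x + mu * V2 x - 2 * be * p x / (1 + be * q x ^+ 2) *
  (p x * U2 x - (- a * q x - b * q x ^+ 3) * u2 x).
Let B1 x := - (mu * U1 x - nu * U2 x)
  + 2 * be * (- a * q x - b * q x ^+ 3) / (1 - be * q x ^+ 2) *
  (q x * V1 x - p x * v1 x).
Let B2 x := - (nu * U1 x + mu * U2 x)
  + 2 * be * (- a * q x - b * q x ^+ 3) / (1 - be * q x ^+ 2) *
  (q x * V2 x - p x * v2 x).

Definition defocusing_flux x := A1 x * g1 x + A2 x * g2 x - f1 x * B1 x - f2 x * B2 x.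

(** From w' = lambda p v and z' = - lambda q u one finds [A] = ((1 + be q^2) f)' / (1 + be q^2) and
    [B] = ((1 - be q^2) g)' / (1 - be q^2). The energy relation for p^2 reduces what remains of the
    derivative to the squares. *)
Lemma defocusing_fluxP x : 1 + be * q x ^+ 2 != 0 -> 1 - be * q x ^+ 2 != 0 ->
  is_derive x 1 defocusing_flux
    (mu * (f1 x ^+ 2 + f2 x ^+ 2 + g1 x ^+ 2 + g2 x ^+ 2)).
Proof.
move=> Y0 X0; rewrite /defocusing_flux /A1 /A2 /B1 /B2 /f1 /f2 /g1 /g2.
der => //.
have hp' : p x * p x = 1 - a * q x ^+ 2 + be ^+ 2 * q x ^+ 4.
  by rewrite -expr2 Hpp Hb; field.
by rewrite Hb; field: hp'; rewrite X0.
Qed.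

End Defocusing.

Section Focusing.
Variables (h ka : R) (s s' : R -> R).
Hypothesis Hpp : forall x,
  p x ^+ 2 = h - a * q x ^+ 2 - b / 2 * q x ^+ 4.
Hypothesis Hs : forall x, is_derive x 1 s (s' x).
Hypothesis Hs' : forall x,
  is_derive x 1 s' (- (a + b * q x ^+ 2 + ka) * s x).

Let pp : forall x, p x * p x = h - a * q x ^+ 2 - b / 2 * q x ^+ 4.
Proof. by move=> x; rewrite -expr2 Hpp. Qed.

(* The flux is Re (conj (lambda u) f + lambda v conj e), with
   f = u' - (p' / p) u and e = v' - (s' / s) v. *)
Section Odd.
Let f1 x := U1 x - (- a * q x - b * q x ^+ 3) * (u1 x / p x).
Let f2 x := U2 x - (- a * q x - b * q x ^+ 3) * (u2 x / p x).
Let e1 x := V1 x - s' x * (v1 x / s x).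
Let e2 x := V2 x - s' x * (v2 x / s x).

Definition odd_flux x :=
  mu * (u1 x * f1 x + u2 x * f2 x) + nu * (u1 x * f2 x - u2 x * f1 x)
  + mu * (v1 x * e1 x + v2 x * e2 x) - nu * (v2 x * e1 x - v1 x * e2 x).

(** Local form of the energy identity: [p] is a null function of [L+] and [s] an eigenfunction of
    [L-] for the eigenvalue [ka]. Factoring [L+] and [L- - ka] through them turns the two quadratic
    forms into |f|^2 and |e|^2 + ka |v|^2. *)
Lemma odd_fluxP x : p x != 0 -> s x != 0 -> is_derive x 1 odd_flux
  (mu * (f1 x ^+ 2 + f2 x ^+ 2 + e1 x ^+ 2 + e2 x ^+ 2
         + ka * (v1 x ^+ 2 + v2 x ^+ 2))).
Proof.
move=> p0 s0; rewrite /odd_flux /f1 /f2 /e1 /e2; der => //.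
by have hp := pp x; field: hp; rewrite ?s0 ?p0.
Qed.

End Odd.

(* The flux is Re (lambda v' conj g - f conj (2 b q z - lambda u')), with
   f = lambda v - w / q and g = - lambda u - p' z / (p q); the quotients p' / q
   are written as - (a + b q^2). *)
Section EvenEven.
Let f1 x := mu * v1 x - nu * v2 x - p x * (U1 x / q x)
  - (a + b * q x ^+ 2) * u1 x.
Let f2 x := nu * v1 x + mu * v2 x - p x * (U2 x / q x)
  - (a + b * q x ^+ 2) * u2 x.
Let g1 x := - (mu * u1 x - nu * u2 x)
  + (a + b * q x ^+ 2) * (q x * (V1 x / p x) - v1 x).
Let g2 x := - (nu * u1 x + mu * u2 x)
  + (a + b * q x ^+ 2) * (q x * (V2 x / p x) - v2 x).
Let B1 x := 2 * b * q x * (q x * V1 x - p x * v1 x)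
  - (mu * U1 x - nu * U2 x).
Let B2 x := 2 * b * q x * (q x * V2 x - p x * v2 x)
  - (nu * U1 x + mu * U2 x).

Definition even_even_flux x :=
  (mu * V1 x - nu * V2 x) * g1 x + (nu * V1 x + mu * V2 x) * g2 x
  - f1 x * B1 x - f2 x * B2 x.

(** Here q f = lambda q v - w, whence lambda v' = (q f)' / q; likewise [B] = (p g)' / p. This is why
    these two factors of the flux carry no quotient. *)
Lemma even_even_fluxP x : p x != 0 -> q x != 0 -> is_derive x 1 even_even_flux
  (mu * (f1 x ^+ 2 + f2 x ^+ 2 + g1 x ^+ 2 + g2 x ^+ 2)).
Proof.
move=> p0 q0; rewrite /even_even_flux /B1 /B2 /f1 /f2 /g1 /g2; der => //.
by have hp := pp x; field: hp; rewrite ?p0 ?q0.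
Qed.

End EvenEven.

(* With zeta = z / q and eta = lambda (u' - (p / q) u) - b q z, this is the
   Wronskian Re (conj lambda (eta' conj zeta - eta conj zeta')); since
   zeta' = - lambda u - (p / q) zeta, it only involves eta' + (p / q) eta, in which
   the quotients cancel. *)
Section EvenOdd.
Let z1 x := q x * V1 x - p x * v1 x.
Let z2 x := q x * V2 x - p x * v2 x.
Let ze1 x := V1 x - p x * (v1 x / q x).
Let ze2 x := V2 x - p x * (v2 x / q x).
Let y1 x := U1 x - p x * (u1 x / q x).
Let y2 x := U2 x - p x * (u2 x / q x).
Let et1 x := mu * y1 x - nu * y2 x - b * q x * z1 x.
Let et2 x := nu * y1 x + mu * y2 x - b * q x * z2 x.
Let c1 x := mu * v1 x - nu * v2 x - b * q x ^+ 2 * u1 x.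
Let c2 x := nu * v1 x + mu * v2 x - b * q x ^+ 2 * u2 x.
Let C1 x := mu * c1 x - nu * c2 x - 2 * b * p x * z1 x.
Let C2 x := nu * c1 x + mu * c2 x - 2 * b * p x * z2 x.
Let D1 x := mu * u1 x - nu * u2 x.
Let D2 x := nu * u1 x + mu * u2 x.

Definition even_odd_flux x :=
  mu * (C1 x * ze1 x + C2 x * ze2 x + D1 x * et1 x + D2 x * et2 x) +
  nu * (C2 x * ze1 x - C1 x * ze2 x + D1 x * et2 x - D2 x * et1 x).

Lemma even_odd_fluxP x : q x != 0 -> is_derive x 1 even_odd_flux
  (mu * ((mu ^+ 2 + nu ^+ 2 + 2 * b * h) * (ze1 x ^+ 2 + ze2 x ^+ 2)
         + (et1 x ^+ 2 + et2 x ^+ 2))).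
Proof.
move=> q0; rewrite /even_odd_flux /C1 /C2 /D1 /D2 /et1 /et2 /c1 /c2
  /ze1 /ze2 /y1 /y2 /z1 /z2; der => //.
have -> : h = p x * p x + a * q x ^+ 2 + b / 2 * q x ^+ 4 by rewrite pp; field.
by field.
Qed.

End EvenOdd.

Section Sectors.
Variable (K : R).
Hypothesis K0 : 0 < K.
Hypothesis mu0 : mu != 0.
Hypothesis q_neq0 : forall x, 0 < x < K -> q x != 0.
Hypothesis p_neq0 : forall x, 0 < x < K -> p x != 0.
Hypothesis p00 : p 0 = 0.
Hypothesis r0 : - a * q 0 - b * q 0 ^+ 3 != 0.
Hypothesis qK : q K = 0.
Hypothesis pK : p K != 0.

Let vanish := forall x, 0 < x < K -> [/\ u1 x = 0, u2 x = 0, v1 x = 0 & v2 x = 0].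

Let q00 : q 0 != 0.
Proof.
by apply/eqP => e0; move: r0; rewrite e0 expr0n /= !mulr0 subrr eqxx.
Qed.

(** Once f = g = 0 the system degenerates: v' = 0, then lambda u = - (a + b q^2) v, and finally
    (lambda^2 + a^2 + 2 b h) v = 0. Under the normalization this reads (lambda^2 + 1) v = 0, and
    lambda = i or - i is excluded by [mu0]. *)
Lemma even_even_vanish : a ^+ 2 + 2 * b * h = 1 ->
  [/\ U1 0 = 0, U2 0 = 0, V1 0 = 0 & V2 0 = 0] ->
  [/\ U1 K = 0, U2 K = 0, V1 K = 0 & V2 K = 0] -> vanish.
Proof.
move=> hab [hU10 hU20 hV10 hV20] [hU1K hU2K hV1K hV2K].
have L0 : tends 0^'+ even_even_flux 0.
  have t1 := tends_right (Hq 0).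
  have t2 := tends_right (Hp 0).
  have t3 := tends_right (Hu1 0).
  have t4 := tends_right (Hu2 0).
  have t5 := tends_right (Hv1 0).
  have t6 := tends_right (Hv2 0).
  have t7 := tends_right (HU1 0).
  have t8 := tends_right (HU2 0).
  have t9 := tends_right (HV1 0).
  have t10 := tends_right (HV2 0).
  (* At 0 only the quotients v' / p are indeterminate. Their limits need only be finite, since every
     term of the flux also has a factor tending to 0; at [K] the same happens with u' / q. *)
  have t11 := quot_right (HV1 0) (Hp 0) hV10 p00 r0.
  have t12 := quot_right (HV2 0) (Hp 0) hV20 p00 r0.
  have t13 := tends_quot_right (HU1 0) (Hq 0) q00.
  have t14 := tends_quot_right (HU2 0) (Hq 0) q00.
  rewrite /even_even_flux; lims.
  by rewrite hU10 hU20 hV10 hV20 p00; ring.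
have LK : tends K^'- even_even_flux 0.
  have t1 := tends_left (Hq K).
  have t2 := tends_left (Hp K).
  have t3 := tends_left (Hu1 K).
  have t4 := tends_left (Hu2 K).
  have t5 := tends_left (Hv1 K).
  have t6 := tends_left (Hv2 K).
  have t7 := tends_left (HU1 K).
  have t8 := tends_left (HU2 K).
  have t9 := tends_left (HV1 K).
  have t10 := tends_left (HV2 K).
  have t11 := quot_left (HU1 K) (Hq K) hU1K qK pK.
  have t12 := quot_left (HU2 K) (Hq K) hU2K qK pK.
  have t13 := tends_quot_left (HV1 K) (Hp K) pK.
  have t14 := tends_quot_left (HV2 K) (Hp K) pK.
  rewrite /even_even_flux; lims.
  by rewrite hU1K hU2K hV1K hV2K qK; ring.
have := flux_pinch mu0 (fun x xI => even_even_fluxP (p_neq0 xI) (q_neq0 xI)) _ L0 LK.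
have sq0 (x y z t : R) : 0 <= x ^+ 2 + y ^+ 2 + z ^+ 2 + t ^+ 2.
  by rewrite !addr_ge0 ?sqr_ge0.
move=> /(_ (fun x _ => sq0 _ _ _ _)) /= fl.
have {}fl x (xI : 0 < x < K) :
  [/\ mu * v1 x - nu * v2 x - p x * (U1 x / q x) - (a + b * q x ^+ 2) * u1 x = 0,
      nu * v1 x + mu * v2 x - p x * (U2 x / q x) - (a + b * q x ^+ 2) * u2 x = 0,
      - (mu * u1 x - nu * u2 x)
        + (a + b * q x ^+ 2) * (q x * (V1 x / p x) - v1 x) = 0 &
      - (nu * u1 x + mu * u2 x)
        + (a + b * q x ^+ 2) * (q x * (V2 x / p x) - v2 x) = 0].
  have /eqP := fl x xI.
  rewrite paddr_eq0 ?addr_ge0 ?sqr_ge0// => /andP[+ /eqP h4].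
  rewrite paddr_eq0 ?addr_ge0 ?sqr_ge0// => /andP[/eqP h12 /eqP h3].
  have [h1 h2] := sqrD_eq0 h12.
  by split => //; apply/eqP; rewrite -sqrf_eq0; apply/eqP.
have mn0 : mu ^+ 2 + nu ^+ 2 != 0.
  by apply/eqP => /sqrD_eq0[e0 _]; move: mu0; rewrite e0 eqxx.
(* q f = lambda q v - w, and w' = lambda p v, so (q f)' = lambda q v'. *)
have V0 x (xI : 0 < x < K) : V1 x = 0 /\ V2 x = 0.
  have q0 := q_neq0 xI.
  pose F1 y := q y * (mu * v1 y - nu * v2 y - p y * (U1 y / q y)
    - (a + b * q y ^+ 2) * u1 y).
  pose F2 y := q y * (nu * v1 y + mu * v2 y - p y * (U2 y / q y)
    - (a + b * q y ^+ 2) * u2 y).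
  have dF1 : is_derive x 1 F1 (q x * (mu * V1 x - nu * V2 x)).
    by rewrite /F1; der => //; field.
  have dF2 : is_derive x 1 F2 (q x * (nu * V1 x + mu * V2 x)).
    by rewrite /F2; der => //; field.
  apply: (cmul_eq0 _ _ mn0); apply: (mulfI q0); rewrite mulr0.
  - by apply: (der_zero (f := F1) _ xI dF1) => y /fl[e _ _ _]; rewrite /F1 e mulr0.
  - by apply: (der_zero (f := F2) _ xI dF2) => y /fl[_ e _ _]; rewrite /F2 e mulr0.
have lu x (xI : 0 < x < K) :
    mu * u1 x - nu * u2 x + (a + b * q x ^+ 2) * v1 x = 0 /\
    nu * u1 x + mu * u2 x + (a + b * q x ^+ 2) * v2 x = 0.
  have [_ _ e1 e2] := fl x xI; have [v10 v20] := V0 x xI.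
  move: e1 e2; rewrite v10 v20 !mul0r !mulr0 !sub0r => e1 e2.
  by split; apply/eqP; rewrite -oppr_eq0; apply/eqP; [rewrite -e1|rewrite -e2]; ring.
have lU x (xI : 0 < x < K) :
    mu * U1 x - nu * U2 x + 2 * b * q x * p x * v1 x = 0 /\
    nu * U1 x + mu * U2 x + 2 * b * q x * p x * v2 x = 0.
  have [v10 v20] := V0 x xI.
  pose F1 y := mu * u1 y - nu * u2 y + (a + b * q y ^+ 2) * v1 y.
  pose F2 y := nu * u1 y + mu * u2 y + (a + b * q y ^+ 2) * v2 y.
  split.
  - apply: (der_zero (f := F1) _ xI); first by move=> y /lu[].
    by rewrite /F1; der; rewrite v10; ring.
  - apply: (der_zero (f := F2) _ xI); first by move=> y /lu[].
    by rewrite /F2; der; rewrite v20; ring.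
move=> x xI; have q0 := q_neq0 xI.
have [f10 f20 _ _] := fl x xI.
have [l1 l2] := lu x xI; have [L1 L2] := lU x xI.
(* m + i n = lambda^2 + 1. Multiplying f = 0 by lambda and eliminating lambda u and lambda u' leaves
   this factor times v, because 2 b p^2 + (a + b q^2)^2 = a^2 + 2 b h. *)
pose m := mu ^+ 2 - nu ^+ 2 + 1; pose n := 2 * mu * nu.
have hh : h = p x * p x + a * q x ^+ 2 + b / 2 * q x ^+ 4 by rewrite pp; field.
have hm : m = mu ^+ 2 - nu ^+ 2 + (a ^+ 2 + 2 * b * h) by rewrite hab.
have e1 : m * v1 x - n * v2 x = 0.
  transitivity (mu * (mu * v1 x - nu * v2 x - p x * (U1 x / q x)
      - (a + b * q x ^+ 2) * u1 x)
    - nu * (nu * v1 x + mu * v2 x - p x * (U2 x / q x)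
      - (a + b * q x ^+ 2) * u2 x)
    + p x / q x * (mu * U1 x - nu * U2 x + 2 * b * q x * p x * v1 x)
    + (a + b * q x ^+ 2) * (mu * u1 x - nu * u2 x + (a + b * q x ^+ 2) * v1 x)).
    by rewrite hm /n hh; field.
  by rewrite f10 f20 l1 L1; ring.
have e2 : n * v1 x + m * v2 x = 0.
  transitivity (nu * (mu * v1 x - nu * v2 x - p x * (U1 x / q x)
      - (a + b * q x ^+ 2) * u1 x)
    + mu * (nu * v1 x + mu * v2 x - p x * (U2 x / q x)
      - (a + b * q x ^+ 2) * u2 x)
    + p x / q x * (nu * U1 x + mu * U2 x + 2 * b * q x * p x * v2 x)
    + (a + b * q x ^+ 2) * (nu * u1 x + mu * u2 x + (a + b * q x ^+ 2) * v2 x)).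
    by rewrite hm /n hh; field.
  by rewrite f10 f20 l2 L2; ring.
have mn1 : m ^+ 2 + n ^+ 2 != 0.
  rewrite gt_eqF // lt_neqAle addr_ge0 ?sqr_ge0// andbT eq_sym.
  apply/eqP => /sqrD_eq0[m0 /eqP]; rewrite /n !mulf_eq0 (negbTE mu0) orbF.
  rewrite pnatr_eq0 /= => /eqP nu0; move: m0; rewrite /m nu0 expr0n subr0.
  by apply/eqP; rewrite gt_eqF// ltr_wpDl// sqr_ge0.
have [v10 v20] := cmul_eq0 e1 e2 mn1.
move: l1 l2; rewrite v10 v20 !mulr0 !addr0 => l1 l2.
by have [-> ->] := cmul_eq0 l1 l2 mn0.
Qed.

Let sq0 (x y : R) : 0 <= x ^+ 2 + y ^+ 2. Proof. by rewrite addr_ge0 ?sqr_ge0. Qed.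

Let mn0 : mu ^+ 2 + nu ^+ 2 != 0.
Proof. by apply/eqP => /sqrD_eq0[e0 _]; move: mu0; rewrite e0 eqxx. Qed.

(** The sign of [b * h] keeps the weight |lambda|^2 + 2 b h positive, so z = 0. Then z' = - lambda q
    u gives u = 0, and the equation for u'' gives v = 0. *)
Lemma even_odd_vanish : 0 <= b * h ->
  [/\ U1 0 = 0, U2 0 = 0, V1 0 = 0 & V2 0 = 0] ->
  [/\ u1 K = 0, u2 K = 0, v1 K = 0 & v2 K = 0] -> vanish.
Proof.
move=> bh0 [hU10 hU20 hV10 hV20] [hu1K hu2K hv1K hv2K].
have L0 : tends 0^'+ even_odd_flux 0.
  have t1 := tends_right (Hq 0).
  have t2 := tends_right (Hp 0).
  have t3 := tends_right (Hu1 0).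
  have t4 := tends_right (Hu2 0).
  have t5 := tends_right (Hv1 0).
  have t6 := tends_right (Hv2 0).
  have t7 := tends_right (HU1 0).
  have t8 := tends_right (HU2 0).
  have t9 := tends_right (HV1 0).
  have t10 := tends_right (HV2 0).
  have t11 := tends_quot_right (Hu1 0) (Hq 0) q00.
  have t12 := tends_quot_right (Hu2 0) (Hq 0) q00.
  have t13 := tends_quot_right (Hv1 0) (Hq 0) q00.
  have t14 := tends_quot_right (Hv2 0) (Hq 0) q00.
  rewrite /even_odd_flux; lims.
  by rewrite hU10 hU20 hV10 hV20 p00; ring.
have LK : tends K^'- even_odd_flux 0.
  have t1 := tends_left (Hq K).
  have t2 := tends_left (Hp K).
  have t3 := tends_left (Hu1 K).
  have t4 := tends_left (Hu2 K).
  have t5 := tends_left (Hv1 K).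
  have t6 := tends_left (Hv2 K).
  have t7 := tends_left (HU1 K).
  have t8 := tends_left (HU2 K).
  have t9 := tends_left (HV1 K).
  have t10 := tends_left (HV2 K).
  have t11 := quot_left (Hu1 K) (Hq K) hu1K qK pK.
  have t12 := quot_left (Hu2 K) (Hq K) hu2K qK pK.
  have t13 := quot_left (Hv1 K) (Hq K) hv1K qK pK.
  have t14 := quot_left (Hv2 K) (Hq K) hv2K qK pK.
  rewrite /even_odd_flux; lims.
  by rewrite hu1K hu2K hv1K hv2K qK; field.
have c0 : 0 < mu ^+ 2 + nu ^+ 2 + 2 * b * h.
  by rewrite ltr_pwDl// ?lt_neqAle ?sq0 1?eq_sym ?mn0// -mulrA mulr_ge0.
have := flux_pinch mu0 (fun x xI => even_odd_fluxP (q_neq0 xI)) _ L0 LK.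
have d0 (x y z t : R) : 0 <= (mu ^+ 2 + nu ^+ 2 + 2 * b * h) * (x ^+ 2 + y ^+ 2)
    + (z ^+ 2 + t ^+ 2).
  by rewrite addr_ge0// mulr_ge0// ltW.
move=> /(_ (fun x _ => d0 _ _ _ _)) /= fl.
have z0 x (xI : 0 < x < K) : q x * V1 x - p x * v1 x = 0 /\
    q x * V2 x - p x * v2 x = 0.
  have /eqP := fl x xI; rewrite paddr_eq0 ?mulr_ge0 ?(ltW c0)// => /andP[+ _].
  rewrite mulf_eq0 gt_eqF//= => /eqP/sqrD_eq0[e1 e2].
  have n0 := q_neq0 xI.
  by split; [rewrite -[RHS](mulr0 (q x)) -e1|rewrite -[RHS](mulr0 (q x)) -e2];
    field.
have u0 x (xI : 0 < x < K) : u1 x = 0 /\ u2 x = 0.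
  pose F1 y := q y * V1 y - p y * v1 y.
  pose F2 y := q y * V2 y - p y * v2 y.
  have dF1 : is_derive x 1 F1 (- q x * (mu * u1 x - nu * u2 x)).
    by rewrite /F1; der => //; ring.
  have dF2 : is_derive x 1 F2 (- q x * (nu * u1 x + mu * u2 x)).
    by rewrite /F2; der => //; ring.
  have n0 : - q x != 0 by rewrite oppr_eq0 q_neq0.
  apply: (cmul_eq0 _ _ mn0); apply: (mulfI n0); rewrite mulr0.
  - by apply: (der_zero (f := F1) _ xI dF1) => y /z0[].
  - by apply: (der_zero (f := F2) _ xI dF2) => y /z0[].
have U0 x (xI : 0 < x < K) : U1 x = 0 /\ U2 x = 0.
  by split; [apply: (der_zero (f := u1) _ xI (Hu1 x)) => y /u0[]
            |apply: (der_zero (f := u2) _ xI (Hu2 x)) => y /u0[]].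
move=> x xI; have [u10 u20] := u0 x xI.
have := der_zero (f := U1) (fun y yI => (U0 y yI).1) xI (HU1 x).
have := der_zero (f := U2) (fun y yI => (U0 y yI).2) xI (HU2 x).
rewrite u10 u20 !mulr0 !add0r => e2 e1.
by have [-> ->] := cmul_eq0 e1 e2 mn0.
Qed.

Hypothesis ka0 : 0 < ka.
Hypothesis s_neq0 : forall x, 0 < x < K -> s x != 0.
Hypothesis s00 : s 0 = 0.
Hypothesis s'0 : s' 0 != 0.
Hypothesis sK : s K != 0.
Hypothesis s'K : s' K = 0.

(** The term in [ka] gives v = 0 at once, and then the equation for v'' gives u = 0. Either parity
    about [K] works: there p' and [s'] vanish, which removes the quotients, and each remaining term
    of the flux is a product of a function and a derivative. *)
Lemma odd_vanish : [/\ u1 0 = 0, u2 0 = 0, v1 0 = 0 & v2 0 = 0] ->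
  [/\ u1 K = 0, u2 K = 0, v1 K = 0 & v2 K = 0] \/
  [/\ U1 K = 0, U2 K = 0, V1 K = 0 & V2 K = 0] -> vanish.
Proof.
move=> [hu10 hu20 hv10 hv20] hK.
have L0 : tends 0^'+ odd_flux 0.
  have t1 := tends_right (Hq 0).
  have t2 := tends_right (Hs' 0).
  have t3 := tends_right (Hu1 0).
  have t4 := tends_right (Hu2 0).
  have t5 := tends_right (Hv1 0).
  have t6 := tends_right (Hv2 0).
  have t7 := tends_right (HU1 0).
  have t8 := tends_right (HU2 0).
  have t9 := tends_right (HV1 0).
  have t10 := tends_right (HV2 0).
  have t11 := quot_right (Hu1 0) (Hp 0) hu10 p00 r0.
  have t12 := quot_right (Hu2 0) (Hp 0) hu20 p00 r0.
  have t13 := quot_right (Hv1 0) (Hs 0) hv10 s00 s'0.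
  have t14 := quot_right (Hv2 0) (Hs 0) hv20 s00 s'0.
  rewrite /odd_flux; lims.
  by rewrite hu10 hu20 hv10 hv20; ring.
have LK : tends K^'- odd_flux 0.
  have t1 := tends_left (Hq K).
  have t2 := tends_left (Hs' K).
  have t3 := tends_left (Hu1 K).
  have t4 := tends_left (Hu2 K).
  have t5 := tends_left (Hv1 K).
  have t6 := tends_left (Hv2 K).
  have t7 := tends_left (HU1 K).
  have t8 := tends_left (HU2 K).
  have t9 := tends_left (HV1 K).
  have t10 := tends_left (HV2 K).
  have t11 := tends_quot_left (Hu1 K) (Hp K) pK.
  have t12 := tends_quot_left (Hu2 K) (Hp K) pK.
  have t13 := tends_quot_left (Hv1 K) (Hs K) sK.
  have t14 := tends_quot_left (Hv2 K) (Hs K) sK.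
  rewrite /odd_flux; lims.
  by case: hK => -[e1 e2 e3 e4]; rewrite e1 e2 e3 e4 qK s'K; ring.
have := flux_pinch mu0 (fun x xI => odd_fluxP (p_neq0 xI) (s_neq0 xI)) _ L0 LK.
have d0 (x y z t v w : R) : 0 <= x ^+ 2 + y ^+ 2 + z ^+ 2 + t ^+ 2
    + ka * (v ^+ 2 + w ^+ 2).
  by rewrite !addr_ge0 ?sqr_ge0// mulr_ge0// ltW.
move=> /(_ (fun x _ => d0 _ _ _ _ _ _)) /= fl.
have v0 x (xI : 0 < x < K) : v1 x = 0 /\ v2 x = 0.
  have /eqP := fl x xI.
  rewrite paddr_eq0 ?mulr_ge0 ?(ltW ka0) ?addr_ge0 ?sqr_ge0// => /andP[_].
  by rewrite mulf_eq0 gt_eqF//= => /eqP/sqrD_eq0.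
have V0 x (xI : 0 < x < K) : V1 x = 0 /\ V2 x = 0.
  by split; [apply: (der_zero (f := v1) _ xI (Hv1 x)) => y /v0[]
            |apply: (der_zero (f := v2) _ xI (Hv2 x)) => y /v0[]].
move=> x xI; have [v10 v20] := v0 x xI.
have := der_zero (f := V1) (fun y yI => (V0 y yI).1) xI (HV1 x).
have := der_zero (f := V2) (fun y yI => (V0 y yI).2) xI (HV2 x).
rewrite v10 v20 !mulr0 !sub0r => /eqP; rewrite oppr_eq0 => /eqP e2.
move=> /eqP; rewrite oppr_eq0 => /eqP e1.
by have [-> ->] := cmul_eq0 e1 e2 mn0.
Qed.

End Sectors.

End Focusing.
End Flux.

(** * Oriented integrals *)

Section OrientedIntegral.
Context {R : realType}.
Notation mu := (@lebesgue_measure R).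
Implicit Types (f g : R -> R) (a b x y : R).

(* Arranged so that [ellipF x k] is convertible to [oint _ x]. *)
Definition oint f x : R :=
  if 0 <= x then \int[mu]_(t in `[0, x]) f t else - \int[mu]_(t in `[x, 0]) f t.

Definition locint f := forall a b, mu.-integrable `[a, b] (EFin \o f).

Lemma Rintegral_cat f a b c : mu.-integrable `[a, c] (EFin \o f) ->
  a <= b -> b <= c ->
  \int[mu]_(t in `[a, c]) f t =
  \int[mu]_(t in `[a, b]) f t + \int[mu]_(t in `[b, c]) f t.
Proof.
move=> fi ab bc; rewrite -(@Rintegral_itv_obnd_cbnd _ b); last first.
  by apply: integrableS fi => //; apply: subset_itvScc; rewrite bnd_simp.
rewrite -(@Rintegral_itvB _ f (BLeft a) (BRight c) b) ?bnd_simp//.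
by rewrite addrC subrK.
Qed.

Lemma oint_sub f a b : locint f -> a <= b ->
  oint f b - oint f a = \int[mu]_(t in `[a, b]) f t.
Proof.
move=> fi ab; rewrite /oint; case: (leP 0 a) => a0.
  rewrite (le_trans a0 ab) (Rintegral_cat (fi 0 b) a0 ab).
  by rewrite addrAC subrr add0r.
rewrite opprK; case: (leP 0 b) => b0.
  by rewrite addrC -Rintegral_cat// ltW.
by rewrite (Rintegral_cat (fi a 0) ab (ltW b0)) addrC addrK.
Qed.

Lemma oint0 f : oint f 0 = 0.
Proof. by rewrite /oint lexx set_itv1 Rintegral_set1. Qed.

Lemma continuous_locint f : continuous f -> locint f.
Proof.
move=> cf a b; apply: continuous_compact_integrable; first exact: segment_compact.
exact: continuous_subspaceT.
Qed.

Lemma oint_linear (al be : R) f g x : locint f -> locint g ->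
  oint (fun t => al * f t + be * g t) x = al * oint f x + be * oint g x.
Proof.
move=> fi gi; have sc c h u v : locint h -> mu.-integrable `[u, v] (EFin \o (fun t => c * h t)).
  by move=> hi; apply: (integrableZl _ _ (hi u v)).
rewrite /oint; case: ifP => _; rewrite RintegralD ?sc// !RintegralZl//; ring.
Qed.

Lemma locint_linear (al be : R) f g : locint f -> locint g ->
  locint (fun t => al * f t + be * g t).
Proof.
move=> fi gi a b.
have h1 : mu.-integrable `[a, b] (fun t => al%:E * (f t)%:E)%E.
  exact: integrableZl (fi a b).
have h2 : mu.-integrable `[a, b] (fun t => be%:E * (g t)%:E)%E.
  exact: integrableZl (gi a b).
exact: integrableD h1 h2.
Qed.

Lemma der_oint f x : locint f -> {for x, continuous f} ->
  is_derive x 1 (oint f) (f x).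
Proof.
(* A base point to the left of [x] makes [x] interior and avoids the case distinction of [oint] at
   0. *)
move=> fi cf; pose a := x - 1; pose F y := \int[mu]_(t in `[a, y]) f t.
have xb : x < x + 1 by rewrite ltrDl.
have ax : a < x by rewrite gtrBl.
have [d e] := continuous_FTC1_closed xb (fi a _) ax cf.
have dF : is_derive x 1 F (f x) by split; [exact: d|rewrite -derive1E; exact: e].
apply: (@near_eq_is_derive _ _ _ (fun y => oint f a + F y)); last first.
  by der; rewrite add0r.
near=> y; rewrite /F -oint_sub//; first by rewrite addrC subrK.
by apply: ltW; near: y; apply: lt_nbhsr; rewrite gtrBl.
Unshelve. all: by end_near. Qed.

Lemma oint_continuous f : locint f -> continuous (oint f).
Proof.
move=> fi x; pose a := x - 1; pose b := x + 1.
have ab : a < b by rewrite /a /b; lra.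
have := @parameterized_integral_continuous _ a b f (ltW ab) (fi _ _).
move=> /(continuous_within_itvP _ ab)[c _ _].
have {}c : {for x, continuous (fun y => oint f a + parameterized_integral mu a y f)}.
  apply: cvgD; first exact: cvg_cst.
  by apply: c; rewrite in_itv /= /a /b; lra.
have e y : a <= y -> oint f a + parameterized_integral mu a y f = oint f y.
  by move=> ay; rewrite /parameterized_integral -oint_sub// addrC subrK.
have ax : a < x by rewrite gtrBl.
move: c; rewrite /prop_for /continuous_at e ?(ltW ax)// => c.
apply: cvg_trans c; apply: near_eq_cvg; near=> y; rewrite e//.
by apply: ltW; near: y; exact: lt_nbhsr.
Unshelve. all: by end_near. Qed.

Lemma ae_imp (P Q : R -> Prop) : (forall x, P x -> Q x) ->
  {ae mu, forall x, P x} -> {ae mu, forall x, Q x}.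
Proof.
by move=> PQ; apply: filterS; first exact: (ae_filter_ringOfSetsType mu).
Qed.

Lemma oint_eq f g x : locint f -> locint g -> {ae mu, forall t, f t = g t} ->
  oint f x = oint g x.
Proof.
move=> fi gi fg; rewrite /oint; have E a b : \int[mu]_(t in `[a, b]) f t =
    \int[mu]_(t in `[a, b]) g t.
  congr fine; apply: ae_eq_integral => //.
  - by apply/measurable_EFinP; case/integrableP: (fi a b) => /measurable_EFinP.
  - by apply/measurable_EFinP; case/integrableP: (gi a b) => /measurable_EFinP.
  - by apply: ae_imp fg => t ->.
by rewrite !E.
Qed.

Lemma oint_norm_le f x : locint f -> 0 <= x ->
  `|oint f x| <= \int[mu]_(t in `[0, x]) `|f t|.
Proof. by move=> fi x0; rewrite /oint x0; exact: le_normr_Rintegral. Qed.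

Lemma prim_unique (F G f : R -> R) : (forall x, is_derive x 1 F (f x)) ->
  (forall x, is_derive x 1 G (f x)) -> F 0 = G 0 -> forall x, F x = G x.
Proof.
move=> hF hG e x; have h y : is_derive y 1 (fun t => F t - G t) 0.
  by der; rewrite subrr.
have /= := is_derive_0_is_cst x 0 h; rewrite e subrr => /eqP.
by rewrite subr_eq0 => /eqP.
Qed.

Lemma continuous_prim (F f : R -> R) : (forall x, is_derive x 1 F (f x)) ->
  continuous f -> forall x, F x = F 0 + oint f x.
Proof.
move=> hF cf; apply: (prim_unique hF); last by rewrite oint0 addr0.
by move=> x; have h := der_oint (continuous_locint cf) (cf x); der; rewrite add0r.
Qed.

End OrientedIntegral.

(** * Translation invariance of Lebesgue measure and of integrals *)

Section Translation.
Context {R : realType}.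
Notation mu := (@lebesgue_measure R).
Implicit Types (f : R -> R) (a b T x : R).

Lemma measurable_shift T : measurable_fun setT (fun x : R => x + T : R).
Proof. exact: measurable_funD. Qed.

(** The pushforward of Lebesgue measure under the translation agrees with it on half-open intervals,
    and these determine it. *)
Lemma lebesgue_measure_shift T (A : set R) : measurable A ->
  mu A = mu ((fun x => x + T) @^-1` A).
Proof.
move=> mA.
pose phi : measurableTypeR R -> measurableTypeR R := fun x => x + T.
have mphi : measurable_fun setT phi by exact: measurable_shift.
pose m := measure_function_pushforward__canonical__measure_function_Measure mu mphi.
apply: (@lebesgue_measure_unique R m _ A mA) => _ [[u v] _ <-] /=.
rewrite /pushforward (_ : _ @^-1` _ = `]u - T, v - T]%classic); last first.
  by apply/seteqP; split=> x; rewrite /= !in_itv /= ltrBlDr lerBrDr.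
by rewrite !lebesgue_measure_itv/= !lte_fin ltrD2r -!EFinB opprB addrA subrK.
Qed.

Lemma ae_shift T (P : R -> Prop) : {ae mu, forall x, P x} ->
  {ae mu, forall x, P (x + T)}.
Proof.
move=> [N [mN N0 sN]]; exists ((fun x => x + T) @^-1` N); split.
- by rewrite -[X in measurable X]setTI; exact: measurable_shift.
- by rewrite -lebesgue_measure_shift.
- by move=> x /= Px; apply: sN.
Qed.

Let preimage_shift a b T :
  (fun x => x + T) @^-1` `[a + T, b + T] = `[a, b]%classic.
Proof. by apply/seteqP; split=> x; rewrite /= !in_itv /= !lerD2r. Qed.

Lemma locint_shift f T : measurable_fun setT f -> locint f ->
  locint (fun x => f (x + T)).
Proof.
move=> mf fi a b; apply/integrableP; split.
  apply/measurable_EFinP; apply: measurable_funTS.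
  by apply: measurableT_comp => //; exact: measurable_shift.
have /integrableP[_] := fi (a + T) (b + T).
pose phi : measurableTypeR R -> measurableTypeR R := fun x => x + T.
have mphi : measurable_fun setT phi by exact: measurable_shift.
pose m := measure_function_pushforward__canonical__measure_function_Measure mu mphi.
rewrite (@eq_measure_integral _ _ _ _ m); last first.
  by move=> A mA _; rewrite /m /= /pushforward; exact: lebesgue_measure_shift.
rewrite ge0_integral_pushforward//=.
- by rewrite preimage_shift.
- by apply/measurable_EFinP/measurableT_comp => //; exact: measurable_funTS.
Qed.

Lemma Rintegral_shift f a b T : measurable_fun setT f -> locint f ->
  \int[mu]_(x in `[a, b]) f (x + T) = \int[mu]_(x in `[a + T, b + T]) f x.
Proof.
move=> mf fi; congr fine; apply/esym.
pose phi : measurableTypeR R -> measurableTypeR R := fun x => x + T.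
have mphi : measurable_fun setT phi by exact: measurable_shift.
pose m := measure_function_pushforward__canonical__measure_function_Measure mu mphi.
rewrite (@eq_measure_integral _ _ _ _ m); last first.
  by move=> A mA _; rewrite /m /= /pushforward; exact: lebesgue_measure_shift.
rewrite integral_pushforward//=.
- by rewrite preimage_shift.
- exact/measurable_EFinP.
- by rewrite preimage_shift; exact: locint_shift.
Qed.

Lemma oint_shift f T x : measurable_fun setT f -> locint f ->
  oint (fun t => f (t + T)) x = oint f (x + T) - oint f T.
Proof.
move=> mf fi; have [x0|x0] := leP 0 x.
  by rewrite oint_sub ?lerDr// {1}/oint x0 Rintegral_shift// add0r.
rewrite -[RHS]opprB oint_sub ?gerDr ?(ltW x0)//.
by rewrite {1}/oint leNgt x0 /= Rintegral_shift// add0r.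
Qed.

End Translation.

(** * Linear systems with a periodic forcing *)

Section Volterra.
Context {R : realType} {n : nat}.
Implicit Types (x X B : R).

Lemma continuous_sum (f : 'I_n -> R -> R) : (forall j, continuous (f j)) ->
  continuous (fun s => \sum_j f j s).
Proof.
move=> cf; rewrite (_ : (fun s => _) = \sum_j f j); last first.
  by apply/funext => s; rewrite fct_sumE.
apply: (big_ind (fun g : R -> R => continuous g)) => //.
- by move=> s; exact: cvg_cst.
- by move=> g h cg ch s; apply: cvgD; [exact: cg|exact: ch].
Qed.

Lemma continuous_bounded (f : R -> R) X : continuous f ->
  exists B, forall x, `|x| <= X -> `|f x| <= B.
Proof.
move=> cf; have [X0|X0] := leP 0 X; last first.
  by exists 0 => x xX; have := normr_ge0 x; rewrite leNgt (le_lt_trans xX).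
have XX : - X <= X by lra.
have cg : {within `[- X, X], continuous (fun x => `|f x|)}.
  by apply: continuous_subspaceT => x; apply: cvg_norm; exact: cf.
have [c _ h] := EVT_max XX cg.
by exists `|f c| => x; rewrite ler_norml => xX; apply: h; rewrite in_itv.
Qed.

(* One step of the Picard iteration: iterating it produces the factors
   [`|x| ^+ m / m`!]. *)
Lemma prim_bound (H f : R -> R) (C X : R) m : (forall x, is_derive x 1 H (f x)) ->
  H 0 = 0 -> (forall x, `|x| <= X -> `|f x| <= C * `|x| ^+ m) ->
  forall x, `|x| <= X -> `|H x| <= C / m.+1%:R * `|x| ^+ m.+1.
Proof.
move=> + + + x; wlog x0 : H f x / 0 <= x => [hw|] dH H0 fX xX.
  case: (leP 0 x) => x0; first exact: (hw H f).
  have := hw (fun t => H (- t)) (fun t => - f (- t)) (- x).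
  rewrite normrN opprK; apply => //; first by rewrite oppr_ge0 ltW.
  - move=> y.
    apply: (is_derive_eq (der_comp (f := H) (der_opp (der_id y)) (dH (- y)))).
    by rewrite mulrN1.
  - by rewrite oppr0.
  - by move=> y yX; rewrite normrN -(normrN y) fX// normrN.
pose G y := C / m.+1%:R * y ^+ m.+1.
have dG (y : R) : is_derive y 1 G (C * y ^+ m).
  by rewrite /G; der; rewrite mul0r add0r mulr1 mulrA divfK ?pnatr_eq0.
have E : C / m.+1%:R * `|x| ^+ m.+1 = G x - G 0.
  by rewrite /G expr0n /= mulr0 subr0 ger0_norm.
have b y : 0 <= y <= x -> - (C * y ^+ m) <= f y <= C * y ^+ m.
  move=> /andP[y0 yx]; rewrite -ler_norml -{2}(ger0_norm y0); apply: fX.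
  by move: xX; rewrite !ger0_norm//; exact: le_trans.
rewrite E ler_norml; apply/andP; split.
- have h : G 0 + H 0 <= G x + H x.
    apply: (der_le (f := fun t => G t + H t) (df := fun t => C * t ^+ m + f t) x0)
      => z zx.
    by have := b z zx; lra.
  by move: h; rewrite H0; lra.
- have h : G 0 - H 0 <= G x - H x.
    apply: (der_le (f := fun t => G t - H t) (df := fun t => C * t ^+ m - f t) x0)
      => z zx.
    by have := b z zx; lra.
  by move: h; rewrite H0; lra.
Qed.

Variables (A : 'I_n -> 'I_n -> R -> R) (M : R).
Hypothesis cA : forall i j, continuous (A i j).
Hypothesis M0 : 0 <= M.
Hypothesis AM : forall i j x, `|A i j x| <= M.

Definition act (Y : 'I_n -> R -> R) i x := \sum_j A i j x * Y j x.

Lemma act_continuous Y i : (forall j, continuous (Y j)) -> continuous (act Y i).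
Proof.
by move=> cY; apply: continuous_sum => j x; apply: cvgM; [exact: cA|exact: cY].
Qed.

Lemma act_bound Y i x C : (forall j, `|Y j x| <= C) ->
  `|act Y i x| <= n%:R * M * C.
Proof.
move=> YC; apply: (le_trans (ler_norm_sum _ _ _)).
apply: (@le_trans _ _ (\sum_(j < n) M * C)).
  by apply: ler_sum => j _; rewrite normrM ler_pM.
by rewrite sumr_const card_ord -mulrA mulr_natl.
Qed.

Lemma der_oint_act Y i x : (forall j, continuous (Y j)) ->
  is_derive x 1 (oint (act Y i)) (act Y i x).
Proof.
move=> cY; have c := act_continuous (i := i) cY.
by apply: der_oint; [exact: continuous_locint|exact: c].
Qed.

Let N : R := n%:R * M.
Let N0 : 0 <= N. Proof. by rewrite mulr_ge0. Qed.

(** Each application of the matrix costs a factor [N], the sup bound of its entries times the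
    dimension, and each integration one more factor of the factorial. *)
Lemma volterra_iter_bound (W : nat -> 'I_n -> R -> R) X B :
  (forall m i, continuous (W m i)) ->
  (forall m i x, W m.+1 i x = oint (act (W m) i) x) ->
  (forall i x, `|x| <= X -> `|W 0%N i x| <= B) ->
  forall m i x, `|x| <= X -> `|W m i x| <= B * exp_coeff (N * `|x|) m.
Proof.
move=> cW WS W0 m; elim: m => [|m ih] i x xX.
  by rewrite /exp_coeff /= expr0 fact0 divr1 mulr1 W0.
rewrite WS /exp_coeff /= exprMn.
have h y : `|y| <= X -> `|act (W m) i y| <= N * (B * N ^+ m / m`!%:R) * `|y| ^+ m.
  move=> yX; apply: (le_trans (act_bound i (fun j => ih j y yX))).
  by rewrite /exp_coeff /= exprMn -/N le_eqVlt; apply/orP; left; apply/eqP; ring.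
have := prim_bound (fun y => der_oint_act i y (cW m)) (oint0 _) h xX.
suff -> : N * (B * N ^+ m / m`!%:R) / m.+1%:R * `|x| ^+ m.+1 =
   B * (N ^+ m.+1 * `|x| ^+ m.+1 / (m.+1)`!%:R) by [].
rewrite factS natrM invfM [N ^+ m.+1]exprS.
by move: (`|x| ^+ _) (N ^+ m) (m.+1%:R)^-1 => Z P V; ring.
Qed.

(** A fixed point is a constant sequence of iterates, so the bound holds for every [m] while its
    exponential coefficient tends to 0. *)
Lemma volterra_unique (Y : 'I_n -> R -> R) : (forall i, continuous (Y i)) ->
  (forall i x, Y i x = oint (act Y i) x) -> forall i x, Y i x = 0.
Proof.
move=> cY YE i x.
have [F FE] : exists F : 'I_n -> R, forall i y, `|y| <= `|x| -> `|Y i y| <= F i.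
  have F j : exists C, forall y, `|y| <= `|x| -> `|Y j y| <= C.
    exact: continuous_bounded.
  by exists (fun j => sval (cid (F j))) => j; exact: svalP (cid (F j)).
pose B := \sum_j `|F j|.
have YB j y : `|y| <= `|x| -> `|Y j y| <= B.
  move=> yx; apply: (le_trans (FE j y yx)); apply: (le_trans (ler_norm _)).
  by rewrite /B (bigD1 j)//= lerDl sumr_ge0.
have h := volterra_iter_bound (W := fun=> Y) (fun=> cY) (fun=> YE) YB.
apply/eqP; rewrite -normr_le0.
have c : (B * exp_coeff (N * `|x|) m) @[m --> \oo] --> (0 : R).
  by rewrite -(mulr0 B); apply: cvgM; [exact: cvg_cst|exact: cvg_exp_coeff].
by apply: (cvgr_to_ge c); near=> m; exact: h.
Unshelve. all: by end_near. Qed.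

Section Existence.
Variable c : 'I_n -> R -> R.
Hypothesis cc : forall i, continuous (c i).

Fixpoint picard m : 'I_n -> R -> R :=
  if m is k.+1 then fun i x => oint (act (picard k) i) x else c.

Let S m i x := series (fun k => picard k i x) m.
Let Y i x := limn (series (fun k => picard k i x)).

Let picard_continuous m i : continuous (picard m i).
Proof.
elim: m i => [|m ih] i; first exact: cc.
by apply: oint_continuous; apply: continuous_locint; exact: act_continuous.
Qed.

Let SS m i x : S m.+1 i x = S m i x + picard m i x.
Proof. by rewrite /S seriesSr. Qed.

Let S_continuous m i : continuous (S m i).
Proof.
elim: m => [|m ih] x.
  rewrite (_ : S 0%N i = fun=> 0); first exact: cvg_cst.
  by apply/funext => y; rewrite /S /series /= big_geq.
rewrite (_ : S m.+1 i = fun y => S m i y + picard m i y); last first.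
  by apply/funext => y; rewrite SS.
by apply: cvgD; [exact: ih|exact: picard_continuous].
Qed.

Let S_step m i x : S m.+1 i x = c i x + oint (act (S m) i) x.
Proof.
elim: m => [|m ih].
  rewrite SS /S /series /= big_geq// add0r (_ : act _ i = fun=> 0).
    by rewrite /oint !Rintegral_cst// !mul0r oppr0 if_same addr0.
  apply/funext => y; rewrite /act big1// => j _.
  by rewrite /S /series /= big_geq// mulr0.
rewrite SS ih -addrA; congr (_ + _).
have l k : locint (act (S k) i).
  by apply: continuous_locint; apply: act_continuous => j; exact: S_continuous.
have l' : locint (act (picard m) i).
  by apply: continuous_locint; exact: act_continuous.
rewrite -[LHS](_ : 1 * oint (act (S m) i) x + 1 * oint (act (picard m) i) x = _).
  rewrite -oint_linear//; congr oint; apply/funext => y.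
  rewrite !mul1r /act -big_split; apply: eq_bigr => j _ /=.
  by rewrite SS mulrDr.
by rewrite !mul1r.
Qed.

(** Weierstrass test with an explicit remainder: the Picard series thereby converges uniformly on
    bounded sets. *)
Lemma series_tail (w u : R^nat) : (forall k, `|w k| <= u k) -> cvgn (series u) ->
  cvgn (series w) /\
  forall m, `|limn (series w) - series w m| <= limn (series u) - series u m.
Proof.
move=> wu cu; have u0 k : 0 <= u k by apply: le_trans (wu k).
have cw : cvgn (series w).
  by apply: normed_cvg; apply: (series_le_cvg _ _ wu cu) => // k.
split=> // m.
have h : (`|series w k - series w m| @[k --> \oo]) --> `|limn (series w) - series w m|.
  by apply: cvg_norm; apply: cvgB => //; exact: cvg_cst.
apply: (cvgr_to_le h); near=> k.
have mk : (m <= k)%N by near: k; exact: nbhs_infty_ge.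
apply: (@le_trans _ _ (series u k - series u m)).
  rewrite !sub_series_geq//; apply: (le_trans (ler_norm_sum _ _ _)).
  exact: ler_sum.
rewrite lerB// nondecreasing_cvgn_le//.
by apply/nondecreasing_seqP => l; rewrite seriesSr lerDl.
Unshelve. all: by end_near. Qed.

(** Remainder of the exponential series that dominates the Picard series for all |x| <= X. *)
Let tail X B m := B * expR (N * X) - series (fun k => B * exp_coeff (N * X) k) m.

Let series_exp B X : series (fun k => B * exp_coeff (N * X) k) @ \oo --> B * expR (N * X).
Proof.
rewrite (_ : series _ = fun m => B * series (exp_coeff (N * X)) m).
  by apply: cvgM; [exact: cvg_cst|exact: is_cvg_series_exp_coeff].
by apply/funext => m; rewrite /series /= mulr_sumr.
Qed.

Let tail_cvg X B : tail X B @ \oo --> (0 : R).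
Proof.
rewrite -(subrr (B * expR (N * X))); apply: cvgB; first exact: cvg_cst.
exact: series_exp.
Qed.

Let Y_tail X B : 0 <= B -> (forall i x, `|x| <= X -> `|c i x| <= B) ->
  forall i x, `|x| <= X -> forall m, `|Y i x - S m i x| <= tail X B m.
Proof.
move=> B0 cB i x xX m.
have h k : `|picard k i x| <= B * exp_coeff (N * X) k.
  apply: (le_trans (volterra_iter_bound picard_continuous _ cB _ _ xX)) => //.
  rewrite ler_wpM2l// /exp_coeff /= ler_wpM2r// ?invr_ge0//.
  by rewrite lerXn2r ?nnegrE ?mulr_ge0 ?(le_trans _ xX)// ler_wpM2l.
have [] := series_tail h (cvgP _ (@series_exp B X)).
by rewrite (cvg_lim _ (@series_exp B X))// => _; exact.
Qed.

Let c_bound X : exists2 B : R, 0 <= B & forall i x, `|x| <= X -> `|c i x| <= B.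
Proof.
have F j : exists C, forall y, `|y| <= X -> `|c j y| <= C.
  exact: continuous_bounded.
exists (\sum_j `|sval (cid (F j))|); first exact: sumr_ge0.
move=> i x xX; apply: (le_trans (svalP (cid (F i)) x xX)).
by apply: (le_trans (ler_norm _)); rewrite (bigD1 i)//= lerDl sumr_ge0.
Qed.

Let Y_continuous i : continuous (Y i).
Proof.
move=> x; pose X := `|x| + 1.
have [B B0 cB] := c_bound X.
apply/cvgrPdist_le => e e0.
have e3 : 0 < e / 3 by rewrite divr_gt0.
have [m mE] : exists m, tail X B m <= e / 3.
  have /cvgrPdist_le/(_ _ e3)[m _ /(_ m (leqnn m))] := @tail_cvg X B.
  by rewrite /= sub0r normrN => h; exists m; exact: le_trans (ler_norm _) h.
have YS y : `|y| <= X -> `|Y i y - S m i y| <= e / 3.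
  by move=> yX; apply: le_trans mE; exact: Y_tail.
have /cvgrPdist_le/(_ _ e3) cS := @S_continuous m i x.
have /cvgrPdist_le/(_ _ ltr01) cx := @cvg_id R (nbhs x).
near=> y.
have h1 := YS x _; have h2 := YS y _.
have h3 : `|S m i x - S m i y| <= e / 3.
  by near: y; exact: cS.
have {}h1 : `|Y i x - S m i x| <= e / 3 by apply: h1; rewrite /X lerDl.
have {}h2 : `|Y i y - S m i y| <= e / 3.
  apply: h2; have -> : y = x - (x - y) by rewrite subKr.
  apply: (le_trans (ler_normB _ _)); rewrite lerD2l.
  by near: y; exact: cx.
have -> : Y i x - Y i y = (Y i x - S m i x) + (S m i x - S m i y)
  - (Y i y - S m i y) by ring.
apply: (le_trans (ler_normB _ _)); apply: (le_trans (lerD (ler_normD _ _) (lexx _))).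
by lra.
Unshelve. all: by end_near. Qed.

(** The solution is the sum of the Picard series. The last clause is Gronwall's bound; its linearity
    in the size of [c] is what later yields a resolvent estimate. *)
Lemma volterra_exists : exists Y : 'I_n -> R -> R,
  [/\ forall i, continuous (Y i),
      forall i x, Y i x = c i x + oint (act Y i) x &
      forall X B, 0 <= B -> (forall i x, `|x| <= X -> `|c i x| <= B) ->
        forall i x, `|x| <= X -> `|Y i x| <= B * expR (N * X)].
Proof.
exists Y; split => //.
- move=> i x; apply/eqP; rewrite -subr_eq0 -normr_le0.
  have [B B0 cB] := c_bound `|x|.
  pose t := tail `|x| B.
  (* [S m.+1] solves the equation with [S m] under the integral, so the residual of the limit is
     controlled by two consecutive remainders. *)
  have h m : `|Y i x - (c i x + oint (act Y i) x)| <= t m.+1 + N * t m / 1 * `|x| ^+ 1.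
    have -> : Y i x - (c i x + oint (act Y i) x) = (Y i x - S m.+1 i x)
       + (oint (act (S m) i) x - oint (act Y i) x) by rewrite S_step; ring.
    apply: (le_trans (ler_normD _ _)); apply: lerD; first exact: Y_tail.
    have cD j : continuous (fun y => S m j y - Y j y).
      by move=> y; apply: cvgB; [exact: S_continuous|exact: Y_continuous].
    have e : oint (act (S m) i) x - oint (act Y i) x =
        oint (act (fun j y => S m j y - Y j y) i) x.
      transitivity (1 * oint (act (S m) i) x + (-1) * oint (act Y i) x).
        by rewrite mul1r mulN1r.
      rewrite -oint_linear; first last.
      - by apply: continuous_locint; exact: act_continuous.
      - by apply: continuous_locint; apply: act_continuous => j; exact: S_continuous.
      congr oint; apply/funext => y; rewrite mul1r mulN1r /act -sumrB.
      by apply: eq_bigr => j _; rewrite mulrBr.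
    rewrite e; apply: (prim_bound (m := 0) (fun y => der_oint_act i y cD)
      (oint0 _) _ (lexx `|x|)) => y yx.
    by rewrite expr0 mulr1; apply: act_bound => j; rewrite distrC; exact: Y_tail.
  have lt : (t m.+1 + N * t m / 1 * `|x| ^+ 1) @[m --> \oo] --> (0 : R).
    have -> : (0 : R) = 0 + N * 0 / 1 * `|x| ^+ 1 by rewrite mulr0 !mul0r addr0.
    apply: cvgD; first by rewrite (cvg_shiftS t); exact: tail_cvg.
    by do 2![apply: cvgM; last exact: cvg_cst]; apply: cvgM; [exact: cvg_cst|exact: tail_cvg].
  by apply: (cvgr_to_ge lt); near=> m; exact: h.
- move=> X B B0 cB i x xX; have := Y_tail B0 cB i xX 0%N.
  by rewrite /S /tail /series /= !big_geq// !subr0.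
Unshelve. all: by end_near. Qed.

End Existence.

End Volterra.

(** * Variation of constants and the Fredholm alternative over one period *)

Section PeriodicSystem.
Context {R : realType} {n : nat}.
Notation mu := (@lebesgue_measure R).
Implicit Types (x : R) (Y Z G : 'I_n -> R -> R).
Variables (A : 'I_n -> 'I_n -> R -> R) (M T : R).
Hypothesis cA : forall i j, continuous (A i j).
Hypothesis M0 : 0 <= M.
Hypothesis AM : forall i j x, `|A i j x| <= M.
Hypothesis T0 : 0 < T.
Hypothesis AT : forall i j x, A i j (x + T) = A i j x.

Lemma oint_sum (h : 'I_n -> R -> R) x : (forall j, locint (h j)) ->
  oint (fun t => \sum_j h j t) x = \sum_j oint (h j) x.
Proof.
move=> hi; rewrite (_ : (fun t => _) = \sum_j h j); last first.
  by apply/funext => t; rewrite fct_sumE.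
suff [_ ->] : locint (\sum_j h j) /\ oint (\sum_j h j) x = \sum_j oint (h j) x by [].
apply: (big_ind2 (fun (f : R -> R) (v : R) => locint f /\ oint f x = v)) => //.
- split; first by apply: continuous_locint => t; exact: cvg_cst.
  by rewrite /oint !Rintegral_cst// !mul0r oppr0 if_same.
- move=> f v g w [fi <-] [gi <-].
  rewrite (_ : f + g = fun t => 1 * f t + 1 * g t); last first.
    by apply/funext => t; rewrite !mul1r.
  by rewrite oint_linear// !mul1r; split=> //; exact: locint_linear.
Qed.

Let act_locint Y i : (forall j, continuous (Y j)) -> locint (act A Y i).
Proof. by move=> cY; apply: continuous_locint; exact: act_continuous. Qed.

(** Variation of constants ansatz: [Z] is meant to be a particular solution starting at 0 and [P j]
    the fundamental solution starting at the j-th unit vector, so that [c] becomes the initial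
    value. *)
Definition comb (c : 'I_n -> R) (P : 'I_n -> 'I_n -> R -> R) Z i x :=
  Z i x + \sum_j c j * P j i x.

Lemma comb_continuous c P Z i : (forall j i, continuous (P j i)) ->
  (forall i, continuous (Z i)) -> continuous (comb c P Z i).
Proof.
move=> cP cZ x; apply: cvgD; first exact: cZ.
by apply: continuous_sum => j y; apply: cvgM; [exact: cvg_cst|exact: cP].
Qed.

Lemma oint_comb c P Z i x : (forall j i, continuous (P j i)) ->
  (forall i, continuous (Z i)) ->
  oint (act A (comb c P Z) i) x =
  oint (act A Z i) x + \sum_j c j * oint (act A (P j) i) x.
Proof.
move=> cP cZ.
have e : act A (comb c P Z) i = fun t => 1 * act A Z i t
    + 1 * \sum_j c j * act A (P j) i t.
  apply/funext => t; rewrite !mul1r /act /comb.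
  under eq_bigr do rewrite mulrDr.
  rewrite big_split /=; congr (_ + _).
  under eq_bigr do rewrite mulr_sumr.
  rewrite exchange_big /=; apply: eq_bigr => j _; rewrite mulr_sumr.
  by apply: eq_bigr => k _; rewrite mulrCA.
have l j : locint (fun t => c j * act A (P j) i t).
  apply: continuous_locint => t; apply: cvgM; first exact: cvg_cst.
  exact: act_continuous.
rewrite e oint_linear; [|exact: act_locint|]; last first.
  apply: continuous_locint; apply: continuous_sum => j t.
  by apply: cvgM; [exact: cvg_cst|exact: act_continuous].
rewrite !mul1r (oint_sum x l).
congr (_ + _); apply: eq_bigr => j _.
have z : locint (fun=> 0 : R) by apply: continuous_locint => t; exact: cvg_cst.
have := @oint_linear _ (c j) 0 (act A (P j) i) (fun=> 0) x (act_locint _ (cP j)) z.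
rewrite [X in _ = _ + X]mul0r addr0 => <-; congr oint; apply/funext => t.
by rewrite mul0r addr0.
Qed.

Definition forcing G := [/\ forall i, measurable_fun setT (G i),
  forall i, locint (G i) & forall i, {ae mu, forall x, G i (x + T) = G i x}].

Definition mild_solution G Y := (forall i, continuous (Y i)) /\
  forall i x, Y i x = Y i 0 + oint (act A Y i) x + oint (G i) x.

Lemma forcing_shift G i x : forcing G ->
  oint (G i) (x + T) = oint (G i) x + oint (G i) T.
Proof.
move=> [mG iG pG]; rewrite -(oint_eq x _ _ (pG i))//; last exact: locint_shift.
by rewrite oint_shift// subrK.
Qed.

(** The difference of [Y] and its translate solves the homogeneous system, since coefficients and
    forcing are periodic, and starts at 0. *)
Lemma mild_periodic G Y : forcing G -> mild_solution G Y ->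
  (forall i, Y i T = Y i 0) -> forall i x, Y i (x + T) = Y i x.
Proof.
move=> fG [cY YE] YT i x; apply/eqP; rewrite -subr_eq0; apply/eqP.
pose Z j t := Y j (t + T); pose D j t := Z j t - Y j t.
have cZ j : continuous (Z j).
  move=> t; apply: (@continuous_comp _ _ _ (fun t => t + T) (Y j)); last exact: cY.
  by apply: cvgD; [exact: cvg_id|exact: cvg_cst].
have cD j : continuous (D j) by move=> t; apply: cvgB; [exact: cZ|exact: cY].
have eZ j t : act A Z j t = act A Y j (t + T).
  by apply: eq_bigr => k _; rewrite -(AT j k).
change (D i x = 0); apply: (volterra_unique cA AM cD) => j t; rewrite /D.
have eD : act A D j = fun t => 1 * act A Z j t + (-1) * act A Y j t.
  apply/funext => s; rewrite mul1r mulN1r /act -sumrB.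
  by apply: eq_bigr => k _; rewrite mulrBr.
rewrite eD oint_linear; [|exact: act_locint|exact: act_locint].
rewrite mul1r mulN1r.
rewrite (_ : act A Z j = fun t => act A Y j (t + T)); last exact/funext.
have mA : measurable_fun setT (act A Y j).
  by apply: continuous_measurable_fun; exact: act_continuous.
rewrite oint_shift //; last exact: act_locint.
rewrite /Z YE (YE j t) (forcing_shift _ _ fG).
have := YT j; rewrite (YE j T) => /eqP; rewrite -addrA -subr_eq0 addrAC subrr add0r.
by rewrite addr_eq0 => /eqP ->; ring.
Qed.

Lemma mild_unique_diff G Y Z : mild_solution G Y -> mild_solution G Z ->
  forall i x, is_derive x 1 (fun t => Y i t - Z i t)
    (act A (fun j t => Y j t - Z j t) i x).
Proof.
move=> [cY YE] [cZ ZE] i x.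
pose D j t := Y j t - Z j t.
have cD j : continuous (D j) by move=> t; apply: cvgB; [exact: cY|exact: cZ].
have eD : act A D i = fun t => 1 * act A Y i t + (-1) * act A Z i t.
  apply/funext => s; rewrite mul1r mulN1r /act -sumrB.
  by apply: eq_bigr => k _; rewrite mulrBr.
rewrite (_ : (fun t => _) = fun t => (Y i 0 - Z i 0) + oint (act A D i) t).
  have h := der_oint_act cA i x cD.
  by der; rewrite add0r.
apply/funext => t; rewrite eD oint_linear; [|exact: act_locint|exact: act_locint].
rewrite mul1r mulN1r.
by rewrite (YE i t) (ZE i t); ring.
Qed.

Hypothesis no_periodic : forall Y, (forall i x, is_derive x 1 (Y i) (act A Y i x)) ->
  (forall i x, Y i (x + T) = Y i x) -> forall i x, Y i x = 0.

Lemma mild_unique G Y Z : mild_solution G Y -> mild_solution G Z ->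
  (forall i x, Y i (x + T) = Y i x) -> (forall i x, Z i (x + T) = Z i x) ->
  forall i x, Y i x = Z i x.
Proof.
move=> hY hZ pY pZ i x; apply/eqP; rewrite -subr_eq0; apply/eqP.
apply: (no_periodic (Y := fun i x => Y i x - Z i x)).
  exact: mild_unique_diff hY hZ.
by move=> j t; rewrite pY pZ.
Qed.

Theorem periodic_resolvent : exists2 C : R, 0 <= C & forall G, forcing G ->
  exists Y, [/\ mild_solution G Y, forall i x, Y i (x + T) = Y i x &
    forall i x, 0 <= x <= T ->
      `|Y i x| <= C * \sum_j \int[mu]_(t in `[0, T]) `|G j t| ].
Proof.
(* Gronwall factor over one period; it bounds the fundamental solutions. *)
pose L := expR (n%:R * M * T).
have L0 : 0 <= L by exact: expR_ge0.
have fundE j : exists P : 'I_n -> R -> R, [/\ forall i, continuous (P i),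
   forall i x, P i x = (i == j)%:R + oint (act A P i) x &
   forall i x, `|x| <= T -> `|P i x| <= L].
  have cc (i : 'I_n) : continuous (fun _ : R => (i == j)%:R : R).
    by move=> x; exact: cvg_cst.
  have [P [cP PE Pb]] := volterra_exists cA M0 AM cc.
  exists P; split => // i x xT; rewrite -[L]mul1r; apply: Pb xT => // k y _.
  by rewrite normr_nat lern1; case: (k == j).
pose P j := sval (cid (fundE j)).
have cP j i : continuous (P j i) by have [h _ _] := svalP (cid (fundE j)); exact: h.
have PE j i x : P j i x = (i == j)%:R + oint (act A (P j) i) x.
  by have [_ h _] := svalP (cid (fundE j)); exact: h.
have Pb j i x : `|x| <= T -> `|P j i x| <= L.
  by have [_ _] := svalP (cid (fundE j)); apply.
have combE c Z g i x : (forall i, continuous (Z i)) ->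
    (forall i x, Z i x = g i x + oint (act A Z i) x) ->
    comb c P Z i x = c i + oint (act A (comb c P Z) i) x + g i x.
  move=> cZ ZE; rewrite oint_comb// /comb ZE.
  under eq_bigr do rewrite PE mulrDr.
  rewrite big_split /= (bigD1 i)//= eqxx mulr1 big1 ?addr0; last first.
    by move=> k ki; rewrite eq_sym (negbTE ki) mulr0.
  ring.
have comb0 c Z g i : (forall i, continuous (Z i)) -> (forall i, g i 0 = 0) ->
    (forall i x, Z i x = g i x + oint (act A Z i) x) -> comb c P Z i 0 = c i.
  by move=> cZ g0 ZE; rewrite (combE c Z g)// oint0 g0 !addr0.
(* A row vector fixed by the monodromy matrix is the initial value of a periodic
   solution of the homogeneous system, hence zero. *)
pose Mon : 'M[R]_n := \matrix_(j, i) P j i T.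
have unitM : 1%:M - Mon \in unitmx.
  rewrite unitmxE unitfE; apply/negP => /det0P[v v0 vM].
  pose Z : 'I_n -> R -> R := fun _ _ => 0.
  have cZ i : continuous (Z i) by move=> x; exact: cvg_cst.
  have ZE i x : Z i x = Z i x + oint (act A Z i) x.
    rewrite /Z add0r (_ : act A _ i = fun=> 0).
      by rewrite /oint !Rintegral_cst// !mul0r oppr0 if_same.
    by apply/funext => t; rewrite /act big1// => j _; rewrite mulr0.
  pose Y := comb (v 0) P Z.
  have cY i : continuous (Y i) by exact: comb_continuous.
  have Y0 i : Y i 0 = v 0 i by exact: (comb0 _ _ Z).
  have YE i x : Y i x = v 0 i + oint (act A Y i) x.
    by rewrite [LHS](combE _ _ Z)// addr0.
  have G0 : forcing (fun _ _ => 0 : R).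
    split=> i; first exact: measurable_cst.
    - by apply: continuous_locint => x; exact: cvg_cst.
    - by apply: aeW.
  have mY : mild_solution (fun _ _ => 0 : R) Y.
    split=> // i x; rewrite Y0 -YE /oint !Rintegral_cst// !mul0r oppr0.
    by rewrite if_same addr0.
  have YT i : Y i T = Y i 0.
    rewrite Y0; have /rowP/(_ i) := vM; rewrite mulmxBr mulmx1 !mxE => /eqP.
    rewrite subr_eq0 => /eqP ->; rewrite /Y /comb /Z add0r.
    by apply: eq_bigr => j _; rewrite mxE.
  have pY := mild_periodic G0 mY YT.
  have Yz : forall i x, Y i x = 0.
    apply: no_periodic pY => i x.
    have h := der_oint_act cA i x cY.
    rewrite (_ : Y i = fun t => v 0 i + oint (act A Y i) t); last first.
      by apply/funext => t; rewrite -YE.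
    by der; rewrite add0r.
  by move/eqP: v0; apply; apply/rowP => i; rewrite mxE -Y0.
pose inv := invmx (1%:M - Mon).
pose kap := \sum_k \sum_j `|inv k j|.
have kap0 : 0 <= kap by apply: sumr_ge0 => k _; exact: sumr_ge0.
exists (2 * L * (1 + n%:R * kap * L)).
  by rewrite !mulr_ge0// addr_ge0// !mulr_ge0.
move=> G fG; have [mG iG pG] := fG.
pose g i := oint (G i).
(* The bound on [Z] asks for a bound of [g] on both sides of 0. For negative x, periodicity gives
   g(x) = g(x + T) - g(T), two integrals over [0, T], whence the factor 2. *)
pose B := 2 * \sum_j \int[mu]_(t in `[0, T]) `|G j t|.
have I0 j : 0 <= \int[mu]_(t in `[0, T]) `|G j t| by exact: Rintegral_ge0.
have gb0 i x : 0 <= x <= T -> `|g i x| <= \int[mu]_(t in `[0, T]) `|G i t|.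
  move=> /andP[x0 xT]; apply: (le_trans (oint_norm_le (iG i) x0)).
  have ai : mu.-integrable `[0, T] (EFin \o (fun t => `|G i t|)).
    by have := iG i 0 T => /integrable_norm.
  by rewrite (Rintegral_cat ai x0 xT) lerDl; exact: Rintegral_ge0.
have gb i x : `|x| <= T -> `|g i x| <= B.
  have s : \int[mu]_(t in `[0, T]) `|G i t| <= \sum_j \int[mu]_(t in `[0, T]) `|G j t|.
    by rewrite (bigD1 i)//= lerDl sumr_ge0.
  rewrite ler_norml => /andP[xT Tx]; have [x0|x0] := leP 0 x.
    apply: (le_trans (gb0 i x _)); first by rewrite x0.
    by apply: (le_trans s); rewrite /B mulr_natl mulr2n lerDl sumr_ge0.
  have -> : g i x = g i (x + T) - g i T by rewrite /g (forcing_shift _ _ fG) addrK.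
  apply: (le_trans (ler_normB _ _)).
  have h1 : `|g i (x + T)| <= \int[mu]_(t in `[0, T]) `|G i t| 
    by apply: gb0; rewrite -lerBlDr sub0r xT gerDr ltW.
  have h2 : `|g i T| <= \int[mu]_(t in `[0, T]) `|G i t| by apply: gb0; rewrite ltW/=.
  by apply: (le_trans (lerD h1 h2)); rewrite /B mulr_natl mulr2n lerD.
have B0 : 0 <= B by rewrite mulr_ge0// sumr_ge0.
have cg i : continuous (g i) by apply: oint_continuous; exact: iG.
have [Z [cZ ZE Zb]] := volterra_exists cA M0 AM cg.
have {}Zb i x : `|x| <= T -> `|Z i x| <= B * L.
  by move=> xT; apply: Zb xT => // j y; exact: gb.
(* The condition Y(T) = Y(0) for [comb] reads c (1 - Mon) = Z(T). *)
have [c cE] : exists c, c = (\row_i Z i T) *m inv by eexists.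
pose Y := comb (c 0) P Z.
have cY i : continuous (Y i) by exact: comb_continuous.
have g0 i : g i 0 = 0 by exact: oint0.
have Y0 i : Y i 0 = c 0 i by exact: (comb0 _ _ g).
have mY : mild_solution G Y.
  by split=> // i x; rewrite Y0 [LHS](combE _ _ g)//.
have YT i : Y i T = Y i 0.
  have e : c *m (1%:M - Mon) = \row_i Z i T by rewrite cE /inv mulmxKV.
  rewrite Y0; have /rowP/(_ i) := e; rewrite mulmxBr mulmx1 !mxE => /eqP.
  rewrite subr_eq => /eqP ->; rewrite /Y /comb; congr (_ + _).
  by apply: eq_bigr => j _; rewrite ?mxE.
exists Y; split => //; first exact: mild_periodic fG mY YT.
move=> i x /andP[x0 xT].
have xn : `|x| <= T by rewrite ger0_norm.
have cb j : `|c 0 j| <= B * L * kap.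
  rewrite cE mxE; apply: (le_trans (ler_norm_sum _ _ _)).
  rewrite /kap mulr_sumr; apply: ler_sum => k _; rewrite mxE normrM.
  apply: ler_pM => //; first by apply: Zb; rewrite ger0_norm// ltW.
  by rewrite (bigD1 j)//= lerDl sumr_ge0.
rewrite /Y /comb; apply: (le_trans (ler_normD _ _)).
apply: (@le_trans _ _ (B * L + n%:R * (B * L * kap * L))).
  apply: lerD; first exact: Zb.
  apply: (le_trans (ler_norm_sum _ _ _)).
  apply: (@le_trans _ _ (\sum_(j < n) B * L * kap * L)).
    by apply: ler_sum => j _; rewrite normrM ler_pM// Pb.
  by rewrite sumr_const card_ord mulr_natl.
by rewrite le_eqVlt; apply/orP; left; apply/eqP; rewrite /B; ring.
Qed.

End PeriodicSystem.

(** * Test functions and weak derivatives *)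

Section SmoothFunctions.
Context {R : realType}.
Implicit Types (f g : R -> R) (x : R) (n m : nat).

(** Carrying the successive derivatives as witnesses makes closure under sums, products and affine
    substitution a plain induction. *)
Fixpoint smooth n f : Prop := if n is m.+1 then
  exists f', (forall x, is_derive x 1 f (f' x)) /\ smooth m f' else True.

Lemma smoothW n f : smooth n.+1 f -> smooth n f.
Proof.
elim: n f => [//|n ih] f [f' [df sf]]; exists f'; split=> //; exact: ih.
Qed.

Lemma smooth_cst n (c : R) : smooth n (fun=> c).
Proof.
elim: n c => [//|n ih] c; exists (fun=> 0); split=> // x; exact: der_cst.
Qed.

Lemma smooth_add n f g : smooth n f -> smooth n g -> smooth n (fun x => f x + g x).
Proof.
elim: n f g => [//|n ih] f g [f' [df sf]] [g' [dg sg]].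
exists (fun x => f' x + g' x); split; last exact: ih.
by move=> x; exact: (der_add (df x) (dg x)).
Qed.

Lemma smooth_mul n f g : smooth n f -> smooth n g -> smooth n (fun x => f x * g x).
Proof.
elim: n f g => [//|n ih] f g sf sg; move: (sf) (sg) => [f' [df sf']] [g' [dg sg']].
exists (fun x => f' x * g x + f x * g' x); split.
  by move=> x; exact: (der_mul (df x) (dg x)).
by apply: smooth_add; apply: ih => //; exact: smoothW.
Qed.

Lemma smooth_affine n f (a b : R) : smooth n f -> smooth n (fun x => f (a * x + b)).
Proof.
elim: n f => [//|n ih] f [f' [df sf]].
exists (fun x => f' (a * x + b) * a); split.
  move=> x; have da : is_derive x 1 (fun t : R => a * t + b) a.
    by apply: (is_derive_eq (der_add (der_mul (der_cst a x) (der_id x))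
      (der_cst b x))); ring.
  exact: (der_comp (f := f) da (df _)).
by apply: smooth_mul; [exact: ih|exact: smooth_cst].
Qed.

Lemma smooth_prim n F f : (forall x, is_derive x 1 F (f x)) -> smooth n f ->
  smooth n F.
Proof. by case: n => [//|n] dF sf; exists f; split=> //; exact: smoothW. Qed.

Lemma smooth_derivable f : (forall n, smooth n f) ->
  forall n x, derivable (derive1n n f) x 1.
Proof.
move=> sf n x; have {sf} : smooth n.+1 f by [].
elim: n f => [|n ih] f [f' [df sf]]; first by case: (df x).
rewrite /derive1n iterSr; have -> : derive1 f = f'; last exact: ih.
by apply/funext => y; rewrite derive1E; case: (df y).
Qed.

(** Handles the junction point 0 of [expinv], where no differentiation rule applies. *)
Lemma der_sq f (C : R) : (forall x, `|f x| <= C * x ^+ 2) -> is_derive (0 : R) 1 f 0.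
Proof.
move=> fC; have f0 : f 0 = 0.
  by apply/eqP; rewrite -normr_le0 (le_trans (fC 0))// expr0n mulr0.
apply/is_derive1_caratheodory; exists (fun z => f z / z); split.
- move=> z; rewrite f0 !subr0; have [->|z0] := eqVneq z 0.
    by rewrite f0 mulr0.
  by rewrite divfK.
- have C0 : 0 <= C by have := fC 1; rewrite expr1n mulr1; apply: le_trans.
  apply/cvgrPdist_le => e e0; rewrite /= f0 mul0r.
  have eC : 0 < e / (C + 1) by rewrite divr_gt0// ltr_wpDl.
  have hn : \forall z \near (0 : R), `|z| <= e / (C + 1) by exact: nbhs0_le.
  near=> z; have [->|z0] := eqVneq z 0.
    by rewrite f0 mul0r subrr normr0 ltW.
  rewrite sub0r normrN normrM normfV ler_pdivrMr ?normr_gt0//.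
  apply: (le_trans (fC z)); rewrite -real_normK ?num_real// expr2 mulrA.
  rewrite ler_wpM2r//.
  have h : `|z| <= e / (C + 1) by near: z; exact: hn.
  apply: (le_trans (ler_wpM2l C0 h)); rewrite mulrCA ler_piMr ?(ltW e0)//.
  by rewrite ler_pdivrMr ?ltr_wpDl// mul1r lerDl.
- by rewrite f0 mul0r.
Unshelve. all: by end_near. Qed.

(* All derivatives of [expinv 0], the function [exp (- 1 / x)] extended by [0],
   are linear combinations of the [expinv m]. *)
Definition expinv m x : R := if 0 < x then x^-1 ^+ m * expR (- x^-1) else 0.

Lemma expinv_ge0 m x : 0 <= expinv m x.
Proof.
by rewrite /expinv; case: ifP => // x0; rewrite mulr_ge0 ?expR_ge0// exprn_ge0// invr_ge0 ltW.
Qed.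

Lemma expinv_le m x : expinv m x <= m`!%:R.
Proof.
rewrite /expinv; case: ifP => // x0; rewrite expRN ler_pdivrMr ?expR_gt0//.
have y0 : 0 <= x^-1 by rewrite invr_ge0 ltW.
case: m => [|m]; first by rewrite expr0 fact0 mul1r (le_trans _ (expR_ge1Dx _))// lerDl.
have := expR_ge1Dxn m y0; rewrite -lerBrDl => h.
have {h} h : x^-1 ^+ m.+1 / m.+1`!%:R <= expR x^-1.
  by apply: (le_trans h); rewrite gerBl.
by move: h; rewrite ler_pdivrMr ?ltr0n ?fact_gt0// mulrC.
Qed.

Lemma der_expinv m x :
  is_derive x 1 (expinv m) (expinv m.+2 x + - m%:R * expinv m.+1 x).
Proof.
have [x0|x0|->] := ltgtP x 0.
- apply: (@near_eq_is_derive _ _ _ (fun=> 0)).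
    by near=> y; rewrite /expinv ltNge ltW//; near: y; exact: lt_nbhsl.
  by rewrite /expinv ltNge ltW//= mulr0 addr0; exact: der_cst.
- apply: (@near_eq_is_derive _ _ _ (fun y : R => y^-1 ^+ m * expR (- y^-1))).
    by near=> y; rewrite /expinv ifT//; near: y; exact: lt_nbhsr.
  have xn : x != 0 by rewrite gt_eqF.
  have di := der_inv xn (der_id x).
  apply: (is_derive_eq (der_mul (der_exp m di)
    (der_comp (der_opp di) (is_derive_expR _)))).
  rewrite /expinv x0; case: m => [|m]; rewrite /= ?exprS ?expr0; ring.
- rewrite /expinv ltxx mulr0 addr0; apply: (@der_sq _ (m.+2)`!%:R) => y.
  rewrite -/(expinv m y); have -> : expinv m y = expinv m.+2 y * y ^+ 2.
    rewrite /expinv; case: ifP => [y0|]; last by rewrite mul0r.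
    rewrite mulrAC -[m.+2]addn2 exprD -[_ * _ * y ^+ 2]mulrA -exprMn.
    by rewrite mulVf ?gt_eqF// expr1n mulr1.
  rewrite normrM !ger0_norm ?sqr_ge0 ?expinv_ge0//.
  by rewrite ler_wpM2r ?sqr_ge0// expinv_le.
Unshelve. all: by end_near. Qed.

Lemma smooth_expinv n m : smooth n (expinv m).
Proof.
elim: n m => [//|n ih] m; exists (fun x => expinv m.+2 x + - m%:R * expinv m.+1 x).
split; first exact: der_expinv.
by apply: smooth_add => //; apply: smooth_mul => //; exact: smooth_cst.
Qed.

(** One factor vanishes left of -1, the other right of 1. The affine arguments have the shape
    required by [smooth_affine]. *)
Definition bump x : R := expinv 0 (1 * x + 1) * expinv 0 (-1 * x + 1).

Lemma smooth_bump n : smooth n bump.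
Proof. by apply: smooth_mul; apply: smooth_affine; exact: smooth_expinv. Qed.

Lemma bump_ge0 x : 0 <= bump x. Proof. by rewrite mulr_ge0 ?expinv_ge0. Qed.

Lemma bump_le1 x : bump x <= 1.
Proof. by rewrite -(mulr1 1) ler_pM ?expinv_ge0// expinv_le. Qed.

Lemma bump_gt0 x : -1 < x < 1 -> 0 < bump x.
Proof.
move=> xI; rewrite /bump /expinv !ifT; [|lra|lra].
by rewrite !expr0 !mul1r mulr_gt0// expR_gt0.
Qed.

Lemma bump_eq0 x : 1 <= `|x| -> bump x = 0.
Proof.
rewrite ler_normr /bump /expinv => /orP[x1|x1].
  by rewrite [X in _ * X]ifF ?mulr0//; apply/negbTE; rewrite -leNgt; lra.
by rewrite ifF ?mul0r//; apply/negbTE; rewrite -leNgt; lra.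
Qed.

Lemma smooth_continuous f : smooth 1 f -> continuous f.
Proof. by move=> [f' [df _]] x; exact: (der_continuous (df x)). Qed.

End SmoothFunctions.

(** * Mollifiers and their convergence at Lebesgue points *)

Section Mollification.
Context {R : realType}.
Notation mu := (@lebesgue_measure R).
Implicit Types (f g phi : R -> R) (a b x r : R).

Lemma Rintegral_support f (D : set R) : (forall x, ~ D x -> f x = 0) ->
  \int[mu]_x f x = \int[mu]_(x in D) f x.
Proof.
move=> f0; rewrite [RHS]Rintegral_mkcond; congr Rintegral; apply/funext => x.
by rewrite patchE; case: ifPn => // /negP xD; rewrite f0// => Dx; apply: xD; rewrite inE.
Qed.

Lemma locint_mul_bounded f g (C : R) : measurable_fun setT f -> locint f ->
  measurable_fun setT g -> (forall x, `|g x| <= C) -> locint (fun x => f x * g x).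
Proof.
move=> mf fi mg gC a b.
have h : mu.-integrable `[a, b] (fun x => C%:E * `|(f x)%:E|)%E.
  by apply: integrableZl => //; exact: (integrable_abse (fi a b)).
apply: (le_integrable _ _ _ h) => //.
  apply/measurable_EFinP; apply: measurable_funTS; exact: measurable_funM.
move=> x _ /=; rewrite lee_fin !normrM normr_id mulrC ler_wpM2r//.
by rewrite (le_trans (gC x))// ler_norm.
Qed.

Lemma integrable_ball f a r : locint f -> mu.-integrable (ball a r) (EFin \o f).
Proof.
move=> fi; apply: (integrableS _ _ _ (fi (a - r) (a + r))) => //.
  exact: measurable_ball.
by move=> x; rewrite /ball /= in_itv /= -ler_distlC; exact: ltW.
Qed.

Local Notation P := (oint (@bump R)).

Let cbump : continuous (@bump R).
Proof. by apply: smooth_continuous; exact: smooth_bump. Qed.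

Let dP x : is_derive x 1 P (bump x).
Proof. by apply: der_oint; [exact: continuous_locint|exact: cbump]. Qed.

Lemma oint_bump_cst x y : (1 <= x <= y) || (x <= y <= -1) -> oint (@bump R) x = oint bump y.
Proof.
move=> xy; have {}xy : x <= y /\ forall z, x <= z <= y -> 1 <= `|z|.
  case/orP: xy => /andP[h1 h2]; split => [|z /andP[xz zy]]; try lra.
  - by rewrite ler_normr (le_trans h1 xz).
  - by rewrite ler_normr orbC lerNr (le_trans zy).
case: xy => xy z1; apply/eqP; rewrite eq_le; apply/andP; split.
  by apply: (der_le (df := bump) xy) => z _; [exact: dP|exact: bump_ge0].
rewrite -lerN2; apply: (der_le (f := fun t => - P t) (df := fun t => - bump t) xy).
  by move=> z _; exact: (der_opp (dP z)).
by move=> z zI; rewrite bump_eq0 ?oppr0//; exact: z1.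
Qed.

(** Integral of [bump]. The bump is not normalized; this positive factor is carried along and
    cancelled at the end. *)
Definition bump_mass : R := P 1 - P (-1).

Lemma bump_mass_gt0 : 0 < bump_mass.
Proof.
rewrite /bump_mass subr_gt0.
have h1 : P (-1) <= P (- (1/2)).
  by apply: (der_le (df := bump)) => [|z _|z _]; [lra|exact: dP|exact: bump_ge0].
have h2 : P (1/2) <= P 1.
  by apply: (der_le (df := bump)) => [|z _|z _]; [lra|exact: dP|exact: bump_ge0].
suff h3 : P (- (1/2)) < P (1/2) by lra.
apply: (@gtr0_derive1_incr _ P (- (1/2)) (1/2)); rewrite ?lexx//; [| | |lra].
- by move=> x _; case: (dP x).
- move=> x; rewrite in_itv /= => xI; rewrite derive1E (@derive_val _ _ _ _ _ _ _ (dP x)).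
  by apply: bump_gt0; lra.
- by apply: continuous_subspaceT => x; exact: (der_continuous (dP x)).
Qed.

Definition mollifier a r x : R := r^-1 * bump (r^-1 * x + - (a / r)).

Lemma mollifier_support a r x : 0 < r -> ~ ball a r x -> mollifier a r x = 0.
Proof.
move=> r0 xD; rewrite /mollifier bump_eq0 ?mulr0//.
have -> : r^-1 * x - a / r = (x - a) / r by ring.
rewrite normrM normfV (gtr0_norm r0) ler_pdivlMr// mul1r distrC leNgt.
by apply/negP.
Qed.

Lemma mollifier_prim a r x : 0 < r ->
  is_derive x 1 (fun t => P (r^-1 * t + - (a / r))) (mollifier a r x).
Proof.
move=> r0; have da : is_derive x 1 (fun t : R => r^-1 * t + - (a / r)) r^-1.
  by apply: (is_derive_eq (der_add (der_mul (der_cst r^-1 x) (der_id x))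
    (der_cst (- (a / r)) x))); rewrite mul0r add0r mulr1 addr0.
apply: (is_derive_eq (der_comp (f := P) da (dP _))).
by rewrite mulrC.
Qed.

Lemma smooth_mollifier n a r : smooth n (mollifier a r).
Proof.
by apply: smooth_mul; [exact: smooth_cst|apply: smooth_affine; exact: smooth_bump].
Qed.

Lemma mollifier_ge0 a r x : 0 < r -> 0 <= mollifier a r x.
Proof. by move=> r0; rewrite mulr_ge0 ?bump_ge0// invr_ge0 ltW. Qed.

Lemma mollifier_le a r x : 0 < r -> mollifier a r x <= r^-1.
Proof. by move=> r0; rewrite ler_piMr ?bump_le1// invr_ge0 ltW. Qed.

Lemma mollifier_integral a r : 0 < r -> \int[mu]_x mollifier a r x = bump_mass.
Proof.
move=> r0; have cm : continuous (mollifier a r).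
  by apply: smooth_continuous; exact: smooth_mollifier.
rewrite (@Rintegral_support _ `[a - r, a + r]%classic); last first.
  move=> x xD; apply: mollifier_support => //; rewrite /ball /= => xr; apply: xD.
  by rewrite /= in_itv /= -ler_distlC ltW.
rewrite -oint_sub; [|exact: continuous_locint|by lra].
have E := continuous_prim (fun x => mollifier_prim a x r0) cm.
have -> : oint (mollifier a r) (a + r) - oint (mollifier a r) (a - r) =
  P (r^-1 * (a + r) - a / r) - P (r^-1 * (a - r) - a / r).
  by rewrite (E (a + r)) (E (a - r)); ring.
rewrite /bump_mass; congr (P _ - P _); field; by rewrite gt_eqF.
Qed.

(** As [bump] is at most 1, the error is at most 1 / r times the integral of |f - f(a)| over the
    ball of radius r. The ball has measure 2 r, so this is twice the mean deviation, which tends to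
    0 at a Lebesgue point. *)
Lemma mollify f a : measurable_fun setT f -> locint f -> lebesgue_pt f a ->
  (\int[mu]_x (f x * mollifier a r x)) @[r --> 0^'+] --> f a * bump_mass.
Proof.
move=> mf fi La.
pose D r : set R := ball a r.
have mD r : measurable (D r : set (measurableTypeR R)) by exact: measurable_ball.
pose d r := fine (davg f a r).
have dl : d r @[r --> 0^'+] --> (0 : R).
  by have /fine_cvgP[_ h] : davg f a x @[x --> 0^'+] --> (0 : R)%:E by exact: La.
apply/cvgrPdist_le => e e0.
have e2 : 0 < e / 2 by rewrite divr_gt0.
have /cvgrPdist_le/(_ _ e2) he := dl.
have r0' : \forall r \near 0^'+, 0 < (r : R) by exact: nbhs_right_gt.
near=> r.
have r0 : 0 < r by near: r.
have hr : `|0 - d r| <= e / 2 by near: r.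
have {}hr : 2 * d r <= e.
  by move: hr; rewrite sub0r normrN ler_norml => /andP[_]; rewrite ler_pdivlMr// mulrC.
apply: le_trans hr.
have cm : continuous (mollifier a r).
  by apply: smooth_continuous; exact: smooth_mollifier.
have mm : measurable_fun setT (mollifier a r) by exact: continuous_measurable_fun.
have mb x : `|mollifier a r x| <= r^-1.
  by rewrite ger0_norm ?mollifier_ge0// mollifier_le.
have fa : locint (fun x => f x - f a).
  have := @locint_linear _ 1 (- 1) f (fun=> f a) fi.
  move=> /(_ _)/(_ _) h; have {}h : locint (fun t => 1 * f t + -1 * f a).
    by apply: h; apply: continuous_locint => x; exact: cvg_cst.
  by move: h; under eq_fun do rewrite mul1r mulN1r.
have mfa : measurable_fun setT (fun x => f x - f a) by exact: measurable_funB.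
have i1 : mu.-integrable (D r) (EFin \o (fun x => f x * mollifier a r x)).
  by apply: integrable_ball; exact: (locint_mul_bounded mf fi mm mb).
have i2 : mu.-integrable (D r) (EFin \o mollifier a r).
  by apply: integrable_ball; exact: continuous_locint.
have i3 : mu.-integrable (D r) (EFin \o (fun x => (f x - f a) * mollifier a r x)).
  by apply: integrable_ball; exact: (locint_mul_bounded mfa fa mm mb).
have -> : f a * bump_mass - \int[mu]_x (f x * mollifier a r x) =
    - \int[mu]_(x in D r) ((f x - f a) * mollifier a r x).
  rewrite -(mollifier_integral a r0) (@Rintegral_support _ (D r)); last first.
    by move=> x; exact: mollifier_support.
  rewrite (@Rintegral_support (fun x => f x * _) (D r)); last first.
    by move=> x xD; rewrite mollifier_support// mulr0.
  rewrite -(RintegralZl (f a) (mD r) i2).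
  have i5 : mu.-integrable (D r) (EFin \o (fun x => f a * mollifier a r x)).
    exact: (integrableZl (mD r) (f a) i2).
  rewrite -opprB -(RintegralB (mD r) i1 i5).
  by congr (- _); apply: eq_Rintegral => x _; rewrite mulrBl.
rewrite normrN; apply: (le_trans (le_normr_Rintegral _ i3)) => //.
have i4 : mu.-integrable (D r) (EFin \o (fun x => `|f x - f a|)).
  by have := integrable_norm (integrable_ball a r fa).
have -> : 2 * d r = r^-1 * \int[mu]_(x in D r) `|f x - f a|.
  rewrite /d /davg /iavg /= lebesgue_measure_ball ?(ltW r0)//.
  rewrite inver mulrn_eq0 /= gt_eqF//.
  have -> : (\int[mu]_(y in ball a r) `|(center (f a) (f y))%:E| =
     (\int[mu]_(x in D r) `|f x - f a|)%:E)%E.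
    by rewrite /Rintegral fineK//; exact: (integrable_fin_num _ i4).
  rewrite -EFinM /= mulrA; congr (_ * _); rewrite -mulr_natl.
  by field; rewrite gt_eqF.
rewrite -RintegralZl//; apply: le_Rintegral => //.
- by have := integrable_norm i3.
- exact: (integrableZl (mD r) r^-1 i4).
- move=> x _; rewrite normrM mulrC ler_wpM2r//.
Unshelve. all: by end_near. Qed.

End Mollification.

(** * The du Bois-Reymond lemma and weak derivatives of primitives *)

Section WeakDerivatives.
Context {R : realType}.
Notation mu := (@lebesgue_measure R).
Local Notation P := (oint (@bump R)).
Implicit Types (f g phi : R -> R) (a b x r : R).

Lemma ae_exists (Q : R -> Prop) : {ae mu, forall x, Q x} -> exists x, Q x.
Proof.
move=> [N [mN N0 sN]]; apply: contrapT => nQ.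
have NT : N = setT by apply/seteqP; split=> // x _; apply: sN => Qx; apply: nQ; exists x.
have : (mu `[0%R, 1%R]%classic <= mu N)%E.
  by apply: le_measure; rewrite ?inE// NT.
by rewrite N0 lebesgue_measure_itv/= lte_fin ltr01 sube0 lee_fin ler10.
Qed.

Lemma lebesgue_pt_ae f : measurable_fun setT f -> locint f ->
  {ae mu, forall x, lebesgue_pt f x}.
Proof.
move=> mf fi; apply: lebesgue_differentiation; split=> //; first exact: openT.
move=> K _ cK; have [L [_ hL]] := compact_bounded cK.
have /integrableP[_] := fi (- (L + 1)) (L + 1); apply: le_lt_trans.
apply: ge0_subset_integral => //.
- exact: compact_measurable.
- by apply/measurable_EFinP; apply: measurableT_comp => //; exact: measurable_funTS.
- have L1 : L < L + 1 by rewrite ltrDl.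
  by move=> x /(hL _ L1) /=; rewrite in_itv /= ler_norml.
Qed.

Lemma test_der phi x : test_function phi -> is_derive x 1 phi (derive1 phi x).
Proof.
move=> [d _]; have h : derivable phi x 1 by exact: (d 0%N x).
by split => //; rewrite derive1E.
Qed.

Lemma derive1_support phi (M x : R) : (forall y, M < `|y| -> phi y = 0) ->
  M < `|x| -> derive1 phi x = 0.
Proof.
move=> hM xM; rewrite derive1E -[RHS](derive_cst (0 : R) x (1 : R)).
apply: near_eq_derive.
have c : {for x, continuous (fun y : R => `|y|)} by exact: norm_continuous.
have : \forall y \near x, M < `|y| by exact: (cvgr_gt _ c).
by apply: filterS => y /hM.
Qed.

Lemma test_derive phi : test_function phi -> test_function (derive1 phi).
Proof.
move=> tp; have [d [M hM]] := tp; split.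
  move=> n x; have := d n.+1 x; rewrite /derive1n iterSr; exact.
by exists M => x; exact: derive1_support.
Qed.

Lemma test_continuous phi : test_function phi -> continuous phi.
Proof. by move=> tp x; exact: (der_continuous (test_der x tp)). Qed.

Lemma test_bounded phi : test_function phi ->
  exists2 C : R, 0 <= C & forall x, `|phi x| <= C.
Proof.
move=> tp; have [_ [M hM]] := tp.
have [C hC] := continuous_bounded M (test_continuous tp).
exists `|C| => // x; have [xM|xM] := leP `|x| M.
  by rewrite (le_trans (hC x xM))// ler_norm.
by rewrite hM// normr0.
Qed.

Lemma mollifier_test a r : 0 < r -> test_function (mollifier a r).
Proof.
move=> r0; split; first by apply: smooth_derivable => n; exact: smooth_mollifier.
exists (`|a| + r) => x xM; apply: mollifier_support => //; rewrite /ball /= => xr.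
have : `|x| <= `|a| + `|a - x|.
  by rewrite -[X in `|X| <= _](subKr a) ler_normB.
by move=> h; have := lt_le_trans xM h; rewrite ltrD2l ltNge (ltW xr).
Qed.

(** Two smoothed steps, at [a] and at [b], share the same plateaus, so their difference has compact
    support; its derivative is the difference of the two mollifiers. *)
Lemma bump_step_test a b r : 0 < r -> test_function
  (fun x => P (r^-1 * x + - (a / r)) + - P (r^-1 * x + - (b / r))).
Proof.
move=> r0; split.
  apply: smooth_derivable => n.
  apply: (@smooth_prim _ n _ (fun x => mollifier a r x + - mollifier b r x)).
    by move=> x; exact: (der_add (mollifier_prim a x r0) (der_opp (mollifier_prim b x r0))).
  apply: smooth_add; first exact: smooth_mollifier.
  rewrite (_ : (fun x => _) = fun x => -1 * mollifier b r x); last first.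
    by apply/funext => x; rewrite mulN1r.
  by apply: smooth_mul; [exact: smooth_cst|exact: smooth_mollifier].
exists (`|a| + `|b| + r) => x.
have s c : r^-1 * x - c / r = (x - c) / r by ring.
have na := ler_norm a; have nb := ler_norm b.
have na' := lerNnormlW (lexx `|a|); have nb' := lerNnormlW (lexx `|b|).
have a0 := normr_ge0 a; have b0 := normr_ge0 b.
rewrite !s lter_normr => /orP[xM|xM]; apply/eqP; rewrite subr_eq0; apply/eqP.
- have xa : 1 <= (x - a) / r by rewrite ler_pdivlMr//; lra.
  have xb : 1 <= (x - b) / r by rewrite ler_pdivlMr//; lra.
  transitivity (P 1); [apply/esym|]; apply: oint_bump_cst; rewrite lexx /= ?xa ?xb//.
- have xa : (x - a) / r <= -1 by rewrite ler_pdivrMr//; lra.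
  have xb : (x - b) / r <= -1 by rewrite ler_pdivrMr//; lra.
  transitivity (P (-1)); [|apply/esym]; apply: oint_bump_cst;
    by rewrite lexx ?xa ?xb orbT.
Qed.

Lemma integrable_support h (M : R) : locint h -> (forall x, M < `|x| -> h x = 0) ->
  mu.-integrable setT (EFin \o h).
Proof.
move=> hi h0; have := hi (- M) M; rewrite integrable_mkcond//=.
congr (integrable _ _ _); apply/funext => x; rewrite patchE; case: ifPn => //.
rewrite notin_setE /= in_itv /= -ler_norml => /negP; rewrite -ltNge => /h0.
by move=> /= ->.
Qed.

Lemma integrable_test f phi : measurable_fun setT f -> locint f ->
  test_function phi -> mu.-integrable setT (EFin \o (fun x => f x * phi x)).
Proof.
move=> mf fi tp; have [_ [M hM]] := tp; have [C C0 hC] := test_bounded tp.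
apply: (@integrable_support _ M).
  apply: (locint_mul_bounded mf fi _ hC).
  by apply: continuous_measurable_fun; exact: test_continuous.
by move=> x /hM ->; rewrite mulr0.
Qed.

Lemma RintegralTB f g : mu.-integrable setT (EFin \o f) ->
  mu.-integrable setT (EFin \o g) ->
  \int[mu]_x (f x - g x) = \int[mu]_x f x - \int[mu]_x g x.
Proof. exact: RintegralB. Qed.

(** Testing against the difference of two smoothed steps shows that [f] has the same mollified value
    at [a] and [b] for every radius. Letting the radius tend to 0 gives f(a) = f(b) at any two
    Lebesgue points. *)
Lemma weak_constant f : measurable_fun setT f -> locint f ->
  (forall phi, test_function phi -> \int[mu]_x (f x * derive1 phi x) = 0) ->
  exists c, {ae mu, forall x, f x = c}.
Proof.
move=> mf fi f0; have La := lebesgue_pt_ae mf fi.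
have [a aL] := ae_exists La; exists (f a); apply: ae_imp La => b bL.
have m0 := @bump_mass_gt0 R.
apply: (mulIf (lt0r_neq0 m0)).
have ca := mollify mf fi aL; have cb := mollify mf fi bL.
suff ca' : (\int[mu]_x (f x * mollifier b r x)) @[r --> 0^'+] --> f a * bump_mass.
  by rewrite -(cvg_lim (@Rhausdorff R) cb) (cvg_lim (@Rhausdorff R) ca').
apply: cvg_trans ca; apply: near_eq_cvg; near=> r.
have r0 : 0 < r by near: r; exact: nbhs_right_gt.
have tp := bump_step_test a b r0.
have := f0 _ tp.
have -> : derive1 (fun x => P (r^-1 * x + - (a / r)) + - P (r^-1 * x + - (b / r))) =
   fun x => mollifier a r x - mollifier b r x.
  apply/funext => x; rewrite derive1E.
  have h := der_add (mollifier_prim a x r0) (der_opp (mollifier_prim b x r0)).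
  by rewrite (@derive_val _ _ _ _ _ _ _ h).
under eq_Rintegral do rewrite mulrBr.
rewrite RintegralTB; [|exact: integrable_test (mollifier_test _ _)
    |exact: integrable_test (mollifier_test _ _)].
by move=> /eqP; rewrite subr_eq0 => /eqP.
Unshelve. all: by end_near. Qed.

Lemma Rintegral_ae f g (D : set (measurableTypeR R)) : measurable D ->
  measurable_fun D f -> measurable_fun D g ->
  {ae mu, forall x, f x = g x} -> \int[mu]_(x in D) f x = \int[mu]_(x in D) g x.
Proof.
move=> mD mf mg fg; congr fine; apply: ae_eq_integral => //.
- exact/measurable_EFinP.
- exact/measurable_EFinP.
- by apply: ae_imp fg => x ->.
Qed.

(** Derivatives of test functions are test functions, so [f] is almost everywhere constant; one
    mollifier of nonzero mass then detects the constant. *)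
Lemma weak_zero f : measurable_fun setT f -> locint f ->
  (forall phi, test_function phi -> \int[mu]_x (f x * phi x) = 0) ->
  {ae mu, forall x, f x = 0}.
Proof.
move=> mf fi f0.
have [c fc] : exists c, {ae mu, forall x, f x = c}.
  by apply: weak_constant => // phi tp; apply: f0; exact: test_derive.
suff c0 : c = 0 by rewrite -c0.
have tm := mollifier_test 0 (@ltr01 R).
have mm : measurable_fun setT (mollifier 0 (1 : R)).
  by apply: continuous_measurable_fun; exact: test_continuous.
have := f0 _ tm.
rewrite (@Rintegral_ae _ (fun x => c * mollifier 0 1 x))//.
- rewrite RintegralZl//.
    rewrite mollifier_integral// => /eqP.
    by rewrite mulf_eq0 (gt_eqF bump_mass_gt0) orbF => /eqP.
  have [_ [M hM]] := tm; apply: (@integrable_support _ M) => //.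
  by apply: continuous_locint; exact: test_continuous.
- exact: measurable_funM.
- exact: measurable_funM.
- by apply: ae_imp fc => x ->.
Qed.

Lemma oint_weak_derivative_continuous g phi : continuous g -> test_function phi ->
  \int[mu]_x (oint g x * derive1 phi x) = - \int[mu]_x (g x * phi x).
Proof.
move=> cg tp; have gi := continuous_locint cg.
have cI := oint_continuous gi; have tp' := test_derive tp.
have mg : measurable_fun setT g by exact: continuous_measurable_fun.
have mI : measurable_fun setT (oint g) by exact: continuous_measurable_fun.
have Ii := continuous_locint cI.
apply/eqP; rewrite -addr_eq0; apply/eqP.
have [_ [M hM]] := tp; pose L := `|M| + 1.
have L0 : - L <= L by rewrite /L; have := normr_ge0 M; lra.
have ML x : L <= `|x| -> M < `|x|.
  by move=> h; apply: lt_le_trans h; rewrite /L; have := ler_norm M; lra.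
have i1 := integrable_test mI Ii tp'.
have i2 := integrable_test mg gi tp.
rewrite -RintegralD//.
pose F x := oint g x * phi x.
pose F' x := g x * phi x + oint g x * derive1 phi x.
have dF x : is_derive x 1 F (F' x).
  exact: (der_mul (der_oint gi (cg x)) (test_der x tp)).
have cF' : continuous F'.
  move=> x; apply: cvgD; apply: cvgM.
  - exact: cg.
  - exact: test_continuous.
  - exact: cI.
  - exact: test_continuous.
rewrite (@Rintegral_support _ _ `[- L, L]%classic); last first.
  move=> x xL; have h : M < `|x|.
    apply: ML; apply: ltW; rewrite ltNge; apply/negP => h; apply: xL.
    by rewrite /= in_itv /= -ler_norml.
  by rewrite hM// (derive1_support hM h) !mulr0 addr0.
have -> : \int[mu]_(x in `[- L, L]) (oint g x * derive1 phi x + g x * phi x)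
    = \int[mu]_(x in `[- L, L]) F' x.
  by apply: eq_Rintegral => x _; rewrite addrC.
rewrite -oint_sub//; last exact: continuous_locint.
have E := continuous_prim dF cF'.
have FL x : `|x| = L -> F x = 0 by move=> xL; rewrite /F hM ?mulr0// ML ?xL.
have L0' : 0 <= L by rewrite /L addr_ge0.
have e1 := E L; have e2 := E (- L).
rewrite FL in e1; last by rewrite ger0_norm.
rewrite FL in e2; last by rewrite normrN ger0_norm.
suff -> : oint F' L = oint F' (- L) by rewrite subrr.
by apply: (addrI (F 0)); rewrite -e1 -e2.
Qed.

(** Follows from the continuous case by L^1 density of continuous functions on an interval
    containing the support of [phi]. *)
Lemma oint_weak_derivative g phi : measurable_fun setT g -> locint g ->
  test_function phi ->
  \int[mu]_x (oint g x * derive1 phi x) = - \int[mu]_x (g x * phi x).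
Proof.
move=> mg gi tp; have cI := oint_continuous gi; have tp' := test_derive tp.
have [C C0 hC] := test_bounded tp; have [C' C'0 hC'] := test_bounded tp'.
have mI : measurable_fun setT (oint g) by exact: continuous_measurable_fun.
have Ii := continuous_locint cI.
have [_ [M hM]] := tp; pose L := `|M| + 1.
have L0 : 0 < L by rewrite /L ltr_wpDl.
have ML x : ~ `[- L, L]%classic x -> M < `|x|.
  rewrite /= in_itv /= -ler_norml => /negP; rewrite -ltNge; apply: lt_trans.
  by rewrite /L (le_lt_trans (ler_norm M))// ltrDl.
have supp (h : R -> R) : \int[mu]_x (h x * phi x) =
    \int[mu]_(x in `[- L, L]) (h x * phi x).
  by apply: Rintegral_support => x /ML /hM ->; rewrite mulr0.
have supp' (h : R -> R) : \int[mu]_x (h x * derive1 phi x) =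
    \int[mu]_(x in `[- L, L]) (h x * derive1 phi x).
  by apply: Rintegral_support => x /ML /(derive1_support hM) ->; rewrite mulr0.
have mE : measurable (`[- L, L]%classic : set (measurableTypeR R)) by [].
have muE : (mu `[(- L)%R, L]%classic < +oo)%E.
  by rewrite lebesgue_measure_itv /=; case: ifP; rewrite // -EFinB ltry.
have [|||g_ [cg_ ig_ lg_]] := @approximation_continuous_integrable R `[- L, L]%classic g.
- exact: mE.
- exact: muE.
- exact: gi.
pose d n := \int[mu]_(x in `[- L, L]) `|g x - g_ n x|.
have gn_i n : locint (g_ n) by exact: continuous_locint.
have mgn n : measurable_fun setT (g_ n) by exact: continuous_measurable_fun.
have di n : locint (fun x => g x - g_ n x).
  have := locint_linear 1 (-1) gi (gn_i n).
  by under eq_fun do rewrite mul1r mulN1r.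
have mdi n : measurable_fun setT (fun x => g x - g_ n x) by exact: measurable_funB.
have ndi n : mu.-integrable `[- L, L] (EFin \o (fun x => `|g x - g_ n x|)).
  by have := integrable_norm (di n (- L) L).
have dE n : (\int[mu]_(x in `[(- L)%R, L]) `|(g x - g_ n x)%:E| = (d n)%:E)%E.
  by rewrite /d /Rintegral fineK//; exact: (integrable_fin_num _ (ndi n)).
have d0 : d n @[n --> \oo] --> (0 : R).
  move: lg_; under eq_fun do rewrite dE.
  by move=> /fine_cvgP[_].
(* Replacing [g] by [g_ n] changes the second integral by at most [C * d n]. In the first, the
   primitive changes by at most [d n] at each point of an interval of length [2 * L]. *)
pose K := C + C' * (2 * L).
suff h n : `|\int[mu]_x (oint g x * derive1 phi x) + \int[mu]_x (g x * phi x)|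
    <= K * d n.
  apply/eqP; rewrite -addr_eq0 -normr_le0.
  have c0 : K * d n @[n --> \oo] --> K * 0 by apply: cvgM => //; exact: cvg_cst.
  by rewrite -[leRHS](mulr0 K); apply: (cvgr_to_ge c0); apply: nearW.
pose D x := g x - g_ n x.
have eI x : oint D x = oint g x - oint (g_ n) x.
  transitivity (1 * oint g x + -1 * oint (g_ n) x).
    by rewrite -oint_linear//; congr oint; apply/funext => y; rewrite mul1r mulN1r.
  by rewrite mul1r mulN1r.
have cD : continuous (oint D) by exact: (oint_continuous (di n)).
have iD : locint (oint D) by exact: continuous_locint.
have mID : measurable_fun setT (oint D) by exact: continuous_measurable_fun.
have cIn : continuous (oint (g_ n)) by exact: oint_continuous.
have -> : \int[mu]_x (oint g x * derive1 phi x) + \int[mu]_x (g x * phi x) =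
    \int[mu]_x (oint D x * derive1 phi x) + \int[mu]_x (D x * phi x).
  have e1 : \int[mu]_x (oint D x * derive1 phi x) =
      \int[mu]_x (oint g x * derive1 phi x) -
      \int[mu]_x (oint (g_ n) x * derive1 phi x).
    rewrite -RintegralTB; [|exact: integrable_test|].
      by apply: eq_Rintegral => x _; rewrite eI mulrBl.
    apply: integrable_test => //; first exact: continuous_measurable_fun.
    exact: continuous_locint.
  have e2 : \int[mu]_x (D x * phi x) =
      \int[mu]_x (g x * phi x) - \int[mu]_x (g_ n x * phi x).
    rewrite -RintegralTB; [|exact: integrable_test|exact: integrable_test].
    by apply: eq_Rintegral => x _; rewrite mulrBl.
  by rewrite e1 e2 (oint_weak_derivative_continuous (cg_ n) tp); ring.
have DL x : - L <= x <= L -> `|oint D x| <= d n.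
  move=> /andP[x1 x2]; have [x0|x0] := leP 0 x.
    apply: (le_trans (oint_norm_le (di n) x0)).
    have i0 : mu.-integrable `[- L, x] (EFin \o (fun x => `|g x - g_ n x|)).
      by have := integrable_norm (di n (- L) x).
    have L0' : - L <= 0 by lra.
    rewrite /d (Rintegral_cat (ndi n) x1 x2) (Rintegral_cat i0 L0' x0).
    by rewrite -addrA addrCA lerDl addr_ge0// Rintegral_ge0.
  rewrite /oint [0 <= x]leNgt x0 /= normrN.
  apply: (le_trans (le_normr_Rintegral _ (di n x 0))) => //.
  have i0 : mu.-integrable `[x, L] (EFin \o (fun x => `|g x - g_ n x|)).
    by have := integrable_norm (di n x L).
  rewrite /d (Rintegral_cat (ndi n) x1 x2) (Rintegral_cat i0 (ltW x0) (ltW L0)).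
  by rewrite addrCA lerDl addr_ge0// Rintegral_ge0.
have dn0 : 0 <= d n by exact: Rintegral_ge0.
have iC (c : R) : mu.-integrable `[- L, L] (EFin \o (fun=> c)).
  by apply: continuous_locint => x; exact: cvg_cst.
have b1 : `|\int[mu]_x (oint D x * derive1 phi x)| <= C' * (2 * L) * d n.
  rewrite supp'.
  have i1 : mu.-integrable `[- L, L] (EFin \o (fun x => oint D x * derive1 phi x)).
    apply: (locint_mul_bounded mID iD _ hC').
    by apply: continuous_measurable_fun; exact: test_continuous.
  apply: (le_trans (le_normr_Rintegral _ i1)) => //.
  apply: (@le_trans _ _ (\int[mu]_(x in `[- L, L]) (C' * d n))).
    apply: le_Rintegral => //; first by have := integrable_norm i1.
    by move=> x; rewrite /= in_itv /= => xL; rewrite normrM mulrC ler_pM// DL.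
  have muL : (mu `[(- L)%R, L]%classic = (2 * L)%:E)%E.
    rewrite lebesgue_measure_itv /= lte_fin ifT; last by lra.
    by rewrite -EFinB; congr EFin; ring.
  have -> : \int[mu]_(x in `[- L, L]) (C' * d n) = C' * d n * (2 * L).
    by rewrite Rintegral_cst//; congr (_ * _); exact: (congr1 fine muL).
  by rewrite mulrAC.
have b2 : `|\int[mu]_x (D x * phi x)| <= C * d n.
  rewrite supp.
  have i1 : mu.-integrable `[- L, L] (EFin \o (fun x => D x * phi x)).
    apply: (locint_mul_bounded (mdi n) (di n) _ hC).
    by apply: continuous_measurable_fun; exact: test_continuous.
  apply: (le_trans (le_normr_Rintegral _ i1)) => //.
  rewrite /d -RintegralZl//; apply: le_Rintegral => //.
  - by have := integrable_norm i1.
  - exact: (integrableZl mE C (ndi n)).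
  - by move=> x _; rewrite normrM mulrC ler_wpM2r.
by apply: (le_trans (ler_normD _ _)); rewrite /K mulrDl addrC lerD.
Qed.

End WeakDerivatives.

(** * Elliptic functions and integrals *)

Section JacobiFunctions.
Context {R : realType}.
Implicit Types (x y t : R).
Variable k : R.
Hypothesis k01 : 0 < k < 1.

Let w t : R := 1 - k ^+ 2 * sin t ^+ 2.
Let g t : R := (Num.sqrt (w t))^-1.

Let k2 : 0 < k ^+ 2 < 1.
Proof. by have /andP[k0 k1] := k01; rewrite exprn_gt0//= expr_lt1// ltW. Qed.

Let w_gt0 t : 0 < w t.
Proof.
have /andP[k0 k1] := k2; rewrite /w subr_gt0.
have h := sin2cos2 t; have c0 := sqr_ge0 (cos t).
have s1 : sin t ^+ 2 <= 1 by rewrite h gerBl.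
by rewrite (le_lt_trans _ k1)// ler_piMr// ltW.
Qed.

Let der_w t : is_derive t 1 w (- (k ^+ 2 * (2 * sin t * cos t))).
Proof.
have ds := is_derive_sin t; rewrite /w; der.
by rewrite expr1; ring.
Qed.

Let der_sqrtw t : is_derive t 1 (fun y => Num.sqrt (w y))
  ((2 * Num.sqrt (w t))^-1 * - (k ^+ 2 * (2 * sin t * cos t))).
Proof.
exact: (der_comp (f := Num.sqrt) (der_w t) (is_derive1_sqrt (w_gt0 t))).
Qed.

Let sqrtw_gt0 t : 0 < Num.sqrt (w t). Proof. by rewrite sqrtr_gt0. Qed.

Let g_ge1 t : 1 <= g t.
Proof.
by rewrite /g invf_ge1// -sqrtr1 ler_sqrt// /w gerBl mulr_ge0 ?sqr_ge0.
Qed.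

Let g_continuous : continuous g.
Proof.
move=> t; apply: (der_continuous (der_inv _ (der_sqrtw t))).
by rewrite gt_eqF.
Qed.

Local Notation F := (fun t => ellipF t k).

Let FE t : F t = oint g t. Proof. by []. Qed.

Lemma der_ellipF t : is_derive t 1 F (g t).
Proof.
have -> : F = oint g by [].
exact: (der_oint (continuous_locint g_continuous) (@g_continuous t)).
Qed.

Lemma ellipF0 : ellipF 0 k = 0. Proof. exact: oint0. Qed.

(** The integrand is at least 1, so [ellipF] minus the identity is nondecreasing; the same
    comparison gives surjectivity below. *)
Lemma ellipF_lt x y : x < y -> ellipF x k < ellipF y k.
Proof.
move=> xy; have h : ellipF x k - x <= ellipF y k - y.
  apply: (der_le (f := fun t => ellipF t k - t) (df := fun t => g t - 1) (ltW xy)).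
    by move=> z _; exact: (der_add (der_ellipF z) (der_opp (der_id z))).
  by move=> z _; rewrite subr_ge0 g_ge1.
lra.
Qed.

Lemma ellipF_inj : injective F.
Proof.
move=> x y /eqP e; apply/eqP; move: e; apply: contraLR; rewrite neq_lt.
by move=> /orP[] /ellipF_lt h; rewrite neq_lt h ?orbT.
Qed.

Lemma ellipF_ltP x y : (ellipF x k < ellipF y k) = (x < y).
Proof.
case: (ltgtP x y) => [/ellipF_lt ->//|/ellipF_lt h|->]; last by rewrite ltxx.
by apply/negbTE; rewrite -leNgt ltW.
Qed.

Lemma ellipF_surj x : exists t, ellipF t k = x.
Proof.
pose B := `|x|; have B0 : 0 <= B by exact: normr_ge0.
have up : B <= ellipF B k.
  have h : ellipF 0 k - 0 <= ellipF B k - B.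
    apply: (der_le (f := fun t => ellipF t k - t) (df := fun t => g t - 1) B0).
      by move=> z _; exact: (der_add (der_ellipF z) (der_opp (der_id z))).
    by move=> z _; rewrite subr_ge0 g_ge1.
  by move: h; rewrite ellipF0; lra.
have lo : ellipF (- B) k <= - B.
  have NB : - B <= 0 by rewrite oppr_le0.
  have h : ellipF (- B) k - - B <= ellipF 0 k - 0.
    apply: (der_le (f := fun t => ellipF t k - t) (df := fun t => g t - 1) NB).
      by move=> z _; exact: (der_add (der_ellipF z) (der_opp (der_id z))).
    by move=> z _; rewrite subr_ge0 g_ge1.
  by move: h; rewrite ellipF0; lra.
have BB : - B <= B by lra.
have cF : {within `[- B, B], continuous F}.
  by apply: continuous_subspaceT => t; exact: (der_continuous (der_ellipF t)).
have xI : Num.min (F (- B)) (F B) <= x <= Num.max (F (- B)) (F B).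
  have := ler_norm x; have := lerNnormlW (lexx `|x|); rewrite -/B => h1 h2.
  rewrite ge_min le_max; apply/andP; split; apply/orP; [left|right].
  - exact: le_trans lo h1.
  - exact: le_trans h2 up.
by have [t _ <-] := IVT BB cF xI; exists t.
Qed.

Local Notation am := (jacobi_am k).
Local Notation sn := (jacobi_sn k).
Local Notation cn := (jacobi_cn k).
Local Notation K := (ellipK k).

Lemma ellipF_am x : ellipF (am x) k = x.
Proof. exact: (xgetPex 0 (ellipF_surj x)). Qed.

Lemma am_ellipF t : am (ellipF t k) = t.
Proof. by apply: ellipF_inj; exact: ellipF_am. Qed.

(** The delta amplitude: the reciprocal of the elliptic integrand at [am x], hence the derivative of
    [am]. *)
Definition jacobi_dn x : R := Num.sqrt (w (am x)).
Local Notation dn := jacobi_dn.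

Lemma dn_gt0 x : 0 < dn x. Proof. exact: sqrtw_gt0. Qed.

Lemma dn_sq x : dn x ^+ 2 = 1 - k ^+ 2 * sn x ^+ 2.
Proof. by rewrite /dn sqr_sqrtr// ltW. Qed.

Lemma sn_sq x : sn x ^+ 2 = 1 - cn x ^+ 2. Proof. exact: sin2cos2. Qed.

Lemma der_am x : is_derive x 1 am (dn x).
Proof.
rewrite -{1}(ellipF_am x) /dn -[Num.sqrt _]invrK.
apply: (@is_derive_inverse _ F am (g (am x)) (am x)).
- by exists 1 => //= t _; exact: am_ellipF.
- by exists 1 => //= t _; exact: (der_continuous (der_ellipF t)).
- exact: der_ellipF.
- by rewrite gt_eqF// (lt_le_trans ltr01)// g_ge1.
Qed.

Lemma der_sn x : is_derive x 1 sn (cn x * dn x).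
Proof. exact: (der_comp (f := sin) (der_am x) (is_derive_sin _)). Qed.

Lemma der_cn x : is_derive x 1 cn (- sn x * dn x).
Proof. exact: (der_comp (f := cos) (der_am x) (is_derive_cos _)). Qed.

Lemma der_dn x : is_derive x 1 dn (- k ^+ 2 * sn x * cn x).
Proof.
apply: (is_derive_eq (der_comp (f := fun t => Num.sqrt (w t)) (der_am x) (der_sqrtw _))).
rewrite -/(dn x); have d0 : dn x != 0 by rewrite gt_eqF// dn_gt0.
by rewrite -/(sn x) -/(cn x); field.
Qed.

Lemma ellipFN t : ellipF (- t) k = - ellipF t k.
Proof.
have sN y : g (- y) = g y by rewrite /g /w sinN sqrrN.
have h := prim_unique (F := fun t => - ellipF (- t) k) (G := F) (f := g).
rewrite -[LHS]opprK; congr (- _); apply: h.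
- move=> y; apply: (is_derive_eq (der_opp (der_comp (f := F)
    (der_opp (der_id y)) (der_ellipF (- y))))).
  by rewrite sN mulrN1 opprK.
- exact: der_ellipF.
- by rewrite oppr0 ellipF0 oppr0.
Qed.

Lemma ellipF_reflect t : ellipF (pi - t) k = 2 * K - ellipF t k.
Proof.
have sP y : g (pi - y) = g y.
  by rewrite /g /w sinB sinpi cospi mul0r sub0r mulN1r opprK.
have h x : is_derive x 1 (fun t => ellipF (pi - t) k + ellipF t k) 0.
  have d1 : is_derive x 1 (fun t : R => pi - t) (-1).
    by apply: (is_derive_eq (der_add (der_cst pi x) (der_opp (der_id x)))); rewrite add0r.
  apply: (is_derive_eq (der_add (der_comp (f := F) d1 (der_ellipF _)) (der_ellipF x))).
  by rewrite sP mulrN1 addNr.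
have /= := is_derive_0_is_cst t (pi / 2) h.
have -> : pi - pi / 2 = pi / 2 :> R by move: (pi : R) => P; lra.
rewrite /ellipK; move: (ellipF (pi - t) k) (ellipF t k) (ellipF (pi / 2) k).
by move=> A B C ABC; lra.
Qed.

Lemma amN x : am (- x) = - am x.
Proof. by apply: ellipF_inj; rewrite ellipFN !ellipF_am. Qed.

Lemma am_reflect x : am (2 * K - x) = pi - am x.
Proof. by apply: ellipF_inj; rewrite ellipF_reflect !ellipF_am. Qed.

(** The reflections about 0 and about K compose to the translation by 2 K, which adds pi to the
    amplitude. *)
Lemma am_shift x : am (x + 4 * K) = am x + 2 * pi.
Proof.
have h y : am (y + 2 * K) = am y + pi.
  by have := am_reflect (- y); rewrite opprK amN opprK addrC => ->; rewrite addrC.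
have -> : x + 4 * K = (x + 2 * K) + 2 * K.
  by move: (ellipK k) => L; ring.
by rewrite !h; move: (am x) (pi : R) => A P; ring.
Qed.

Lemma cnN x : cn (- x) = cn x. Proof. by rewrite /jacobi_cn amN cosN. Qed.

Lemma cn_reflect x : cn (2 * K - x) = - cn x.
Proof. by rewrite /jacobi_cn am_reflect cosB sinpi cospi mul0r addr0 mulN1r. Qed.

Lemma sn_periodic x : sn (x + 4 * K) = sn x.
Proof. by rewrite /jacobi_sn am_shift mulr_natl sinD2pi. Qed.

Lemma cn_periodic x : cn (x + 4 * K) = cn x.
Proof. by rewrite /jacobi_cn am_shift mulr_natl cosD2pi. Qed.

Lemma ellipK_gt0 : 0 < K.
Proof. by rewrite -ellipF0; apply: ellipF_lt; rewrite divr_gt0// pi_gt0. Qed.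

Lemma am0 : am 0 = 0. Proof. by rewrite -[in LHS]ellipF0 am_ellipF. Qed.
Lemma amK : am K = pi / 2. Proof. exact: am_ellipF. Qed.

Lemma am_bounds x : 0 < x < K -> 0 < am x < pi / 2.
Proof.
by move=> xK; rewrite -(ellipF_ltP 0) -(ellipF_ltP _ (pi / 2)) ellipF_am ellipF0.
Qed.

Lemma sn_gt0 x : 0 < x < K -> 0 < sn x.
Proof.
by move=> /am_bounds /andP[a0 aK]; apply: sin_gt0_pi; rewrite a0 /=; have := pi_gt0 R; lra.
Qed.

Lemma cn_gt0 x : 0 < x < K -> 0 < cn x.
Proof.
by move=> /am_bounds /andP[a0 aK]; apply: cos_gt0_pihalf; rewrite aK andbT; have := pi_gt0 R; lra.
Qed.

Lemma sn0 : sn 0 = 0. Proof. by rewrite /jacobi_sn am0 sin0. Qed.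
Lemma cn0 : cn 0 = 1. Proof. by rewrite /jacobi_cn am0 cos0. Qed.
Lemma snK : sn K = 1. Proof. by rewrite /jacobi_sn amK sin_pihalf. Qed.
Lemma cnK : cn K = 0. Proof. by rewrite /jacobi_cn amK cos_pihalf. Qed.

End JacobiFunctions.

(** * Existence and uniqueness of the modulus with K = 2 E *)

Section CriticalModulus.
Context {R : realType}.
Implicit Types (k l t x y : R).

Let w k t : R := 1 - k ^+ 2 * sin t ^+ 2.
Let s k t : R := Num.sqrt (w k t).
Let h k t : R := (s k t)^-1 - 2 * s k t.
Let H k : R := ellipK k - 2 * ellipE k.

Let sin2_le1 t : sin t ^+ 2 <= 1.
Proof. by rewrite sin2cos2 gerBl sqr_ge0. Qed.

Let k2 k : 0 < k < 1 -> 0 < k ^+ 2 < 1.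
Proof. by move=> /andP[k0 k1]; rewrite exprn_gt0//= expr_lt1// ltW. Qed.

Let w_ge k t : 0 < k < 1 -> 1 - k ^+ 2 <= w k t.
Proof.
by move=> /k2/andP[k0 _]; rewrite /w lerD2l lerN2 ler_piMr// ltW.
Qed.

Let w_gt0 k t : 0 < k < 1 -> 0 < w k t.
Proof.
move=> k01; apply: lt_le_trans (w_ge t k01); rewrite subr_gt0.
by have /andP[] := k2 k01.
Qed.

Let s_gt0 k t : 0 < k < 1 -> 0 < s k t.
Proof. by move=> k01; rewrite sqrtr_gt0 w_gt0. Qed.

Let s_sq k t : 0 < k < 1 -> s k t ^+ 2 = w k t.
Proof. by move=> k01; rewrite sqr_sqrtr// ltW// w_gt0. Qed.

Let s_continuous k : 0 < k < 1 -> continuous (s k).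
Proof.
move=> k01 t; have ds := is_derive_sin t.
have dw : is_derive t 1 (w k) (- (k ^+ 2 * (2 * sin t * cos t))).
  by rewrite /w; der; rewrite expr1; ring.
exact: (der_continuous (der_comp (f := Num.sqrt) dw (is_derive1_sqrt (w_gt0 t k01)))).
Qed.

Let sV_continuous k : 0 < k < 1 -> continuous (fun t => (s k t)^-1).
Proof.
move=> k01 t; apply: cvgV; first by rewrite gt_eqF// s_gt0.
exact: s_continuous.
Qed.

Let h_continuous k : 0 < k < 1 -> continuous (h k).
Proof.
move=> k01 t; apply: cvgB; first exact: sV_continuous.
by apply: cvgM; [exact: cvg_cst|exact: s_continuous].
Qed.

Let der_h k t : 0 < k < 1 -> is_derive t 1 (oint (h k)) (h k t).
Proof.
move=> k01; have c := h_continuous k01.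
by apply: der_oint; [exact: continuous_locint|exact: c].
Qed.

Let pi2 : 0 < (pi : R) / 2. Proof. by rewrite divr_gt0// pi_gt0. Qed.

Let ellipE_oint k : ellipE k = oint (s k) (pi / 2).
Proof. by rewrite /ellipE /oint ltW. Qed.

Let ellipK_oint k : ellipK k = oint (fun t => (s k t)^-1) (pi / 2).
Proof. by []. Qed.

Let HE k : 0 < k < 1 -> H k = oint (h k) (pi / 2).
Proof.
move=> k01; have l1 := continuous_locint (s_continuous k01).
have l2 := continuous_locint (sV_continuous k01).
rewrite /H ellipK_oint ellipE_oint.
transitivity (1 * oint (fun t => (s k t)^-1) (pi / 2) + -2 * oint (s k) (pi / 2)).
  by rewrite mul1r mulNr.
rewrite -(oint_linear _ _ _ l2 l1); congr oint; apply/funext => t.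
by rewrite mul1r mulNr.
Qed.

Lemma oint_gt0 (f : R -> R) x : continuous f -> 0 < x ->
  (forall t, 0 < t < x -> 0 < f t) -> 0 < oint f x.
Proof.
move=> cf x0 f0; rewrite -(oint0 f).
have df t : is_derive t 1 (oint f) (f t).
  by apply: der_oint; [exact: continuous_locint|exact: cf].
apply: (@gtr0_derive1_incr _ (oint f) 0 x); rewrite ?lexx//.
- move=> t; rewrite in_itv /= => tx; rewrite derive1E (@derive_val _ _ _ _ _ _ _ (df t)).
  exact: f0.
- by apply: continuous_subspaceT => t; exact: (der_continuous (df t)).
Qed.

Let H_incr k l : 0 < k < 1 -> 0 < l < 1 -> k < l -> H k < H l.
Proof.
move=> k01 l01 kl; rewrite !HE// -subr_gt0.
have lk := continuous_locint (h_continuous k01).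
have ll := continuous_locint (h_continuous l01).
have -> : oint (h l) (pi / 2) - oint (h k) (pi / 2) =
    oint (fun t => 1 * h l t + -1 * h k t) (pi / 2).
  by rewrite oint_linear// mul1r mulN1r.
apply: oint_gt0 => // [t|t /andP[t0 tpi]].
  apply: cvgD; (apply: cvgM; [exact: cvg_cst|exact: h_continuous]).
rewrite mul1r mulN1r subr_gt0 /h.
have sk := s_gt0 t k01; have sl := s_gt0 t l01.
have slk : s l t < s k t.
  rewrite /s ltr_sqrt ?w_gt0// /w ltrD2l ltrN2 ltr_pM2r.
    by rewrite ltr_pXn2r// nnegrE ltW//; [case/andP: k01|case/andP: l01].
  by rewrite exprn_gt0// sin_gt0_pihalf// t0.
have h1 : (s k t)^-1 < (s l t)^-1 by rewrite ltf_pV2.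
by apply: ltrD => //; rewrite ltrN2 ltr_pM2l.
Qed.

Let sqrt_lip (m x y : R) : 0 < m -> m <= x -> m <= y ->
  `|x - y| <= `|x ^+ 2 - y ^+ 2| / (2 * m).
Proof.
move=> m0 mx my; rewrite subr_sqr normrM ler_pdivlMr; last by rewrite mulr_gt0.
by rewrite ler_wpM2l// (le_trans _ (ler_norm _))// mulr_natl mulr2n lerD.
Qed.

(** The integrand is Lipschitz in the modulus uniformly in the angle as long as the modulus stays
    below some [b < 1], because then [s] is bounded below by [m]. *)
Let H_continuous k : 0 < k < 1 -> {for k, continuous H}.
Proof.
move=> k01; have /andP[k0 k1] := k01.
pose b := (1 + k) / 2.
have kb : k < b by rewrite /b; lra.
have b1 : b < 1 by rewrite /b; lra.
have b0 : 0 < b by lra.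
have b01 : 0 < b < 1 by rewrite b0.
pose m := Num.sqrt (1 - b ^+ 2).
have m0 : 0 < m by rewrite sqrtr_gt0 subr_gt0; have /andP[] := k2 b01.
have sm l t : 0 < l < b -> m <= s l t.
  move=> /andP[l0 lb]; have l01 : 0 < l < 1 by rewrite l0 (lt_trans lb).
  rewrite ler_sqrt; last by rewrite ltW// w_gt0.
  apply: le_trans (w_ge t l01).
  by rewrite lerD2l lerN2 ler_pXn2r ?nnegrE ?ltW.
(* The second factor is a Lipschitz constant of [s] in the modulus; the first bounds 1 / (s s~) + 2,
   which appears when the difference of two values of 1 / s - 2 s is factored. *)
pose C := (1 / m ^+ 2 + 2) * (2 / (2 * m)).
have C0 : 0 < C.
  by rewrite mulr_gt0 ?divr_gt0 ?mulr_gt0// addr_gt0// divr_gt0// exprn_gt0.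
have lip : forall l t, 0 < l < b -> `|h k t - h l t| <= C * `|k - l|.
  move=> l t lb; have kb' : 0 < k < b by rewrite k0.
  have l01 : 0 < l < 1 by have /andP[l0 l1] := lb; rewrite l0 (lt_trans l1).
  have mk := sm k t kb'; have ml := sm l t lb.
  have sk := s_gt0 t k01; have sl := s_gt0 t l01.
  have d1 : `|s k t - s l t| <= 2 / (2 * m) * `|k - l|.
    apply: (le_trans (sqrt_lip m0 mk ml)).
    rewrite !s_sq// mulrAC ler_pM2r; last by rewrite invr_gt0 mulr_gt0.
    have -> : w k t - w l t = - ((k - l) * (k + l) * sin t ^+ 2) by rewrite /w; ring.
    rewrite normrN 2!normrM mulrC [`|k - l| * _]mulrC mulrA ler_wpM2r//.
    have /andP[l0 l1] := l01.
    have kl2 : `|k + l| <= 2 by rewrite gtr0_norm; lra.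
    rewrite -[leRHS]mul1r; apply: ler_pM => //.
    by rewrite ger0_norm ?sqr_ge0 ?sin2_le1.
  have -> : h k t - h l t = - ((s k t - s l t) * (1 / (s k t * s l t) + 2)).
    by rewrite /h; field; rewrite !gt_eqF.
  rewrite normrN normrM mulrC /C -mulrA; apply: ler_pM => //.
  rewrite ger0_norm; last by rewrite addr_ge0// divr_ge0// mulr_ge0// ltW.
  rewrite lerD2r !div1r lef_pV2 ?posrE ?mulr_gt0 ?exprn_gt0//.
  by rewrite expr2 ler_pM// ltW.
have Hlip l : 0 < l < b -> `|H k - H l| <= C * (pi / 2) * `|k - l|.
  move=> lb; have l01 : 0 < l < 1 by have /andP[l0 l1] := lb; rewrite l0 (lt_trans l1).
  have d t : is_derive t 1 (fun y => oint (h k) y - oint (h l) y) (h k t - h l t).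
    exact: (der_add (der_h t k01) (der_opp (der_h t l01))).
  have z : oint (h k) 0 - oint (h l) 0 = 0 by rewrite !oint0 subrr.
  have bd t : `|t| <= pi / 2 -> `|h k t - h l t| <= C * `|k - l| * `|t| ^+ 0.
    by move=> _; rewrite expr0 mulr1 lip.
  have pp : `|pi / 2 : R| <= pi / 2 by rewrite gtr0_norm.
  have := prim_bound d z bd pp.
  by rewrite -!HE// expr1 divr1 (gtr0_norm pi2) mulrAC.
apply/cvgrPdist_le => e e0.
have Cp : 0 < C * (pi / 2) by rewrite mulr_gt0.
have ec : 0 < e / (C * (pi / 2)) by rewrite divr_gt0.
have /cvgrPdist_le/(_ _ ec) n1 := @cvg_id R (nbhs k).
near=> l.
have lb : 0 < l < b.
  by apply/andP; split; near: l; [exact: lt_nbhsr|exact: lt_nbhsl].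
apply: (le_trans (Hlip l lb)); rewrite mulrC -ler_pdivlMr//.
Unshelve. all: by end_near. Qed.

Let sin_le x : 0 <= x -> sin x <= x.
Proof.
move=> x0; rewrite -subr_ge0 -[leLHS](_ : 0 - sin 0 = 0); last by rewrite sin0 subrr.
apply: (der_le (f := fun t => t - sin t) (df := fun t => 1 - cos t) x0) => t _.
by rewrite subr_ge0 cos_le1.
Qed.

(** For k = 1/2 one has s^2 >= 3/4 > 1/2, so 1 / s - 2 s is negative everywhere. *)
Let H_half : H (1 / 2) < 0.
Proof.
have k01 : 0 < (1 / 2 : R) < 1 by lra.
rewrite HE// -oppr_gt0 -mulN1r.
have lk := continuous_locint (h_continuous k01).
have -> : -1 * oint (h (1 / 2)) (pi / 2) =
    oint (fun t => -1 * h (1 / 2) t + 0 * h (1 / 2) t) (pi / 2).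
  by rewrite oint_linear// mul0r addr0.
apply: oint_gt0 => // [t|t _].
  apply: cvgD; (apply: cvgM; [exact: cvg_cst|exact: h_continuous]).
rewrite mul0r addr0 mulN1r oppr_gt0 /h subr_lt0.
have s0 := s_gt0 t k01; have sq := s_sq t k01.
rewrite -[ltLHS]mul1r ltr_pdivrMr// -mulrA -expr2 sq.
by have := w_ge t k01; move: (w (1 / 2) t) => W; lra.
Qed.

(** With complementary modulus c, s^2 = cos^2 + c^2 sin^2 <= (pi / 2 - t + c)^2, so K is at least ln
    (pi / 2 + c) - ln c. The choice of c makes - ln c = pi + 1, which exceeds pi >= 2 E. *)
Let H_pos : exists2 k, 0 < k < 1 & 0 < H k.
Proof.
pose c : R := expR (- (pi + 1)).
have c0 : 0 < c by exact: expR_gt0.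
have pg : 0 < (pi : R) by exact: pi_gt0.
have c1 : c < 1 by rewrite expR_lt1; lra.
have c21 : 0 < 1 - c ^+ 2 < 1.
  by rewrite subr_gt0 expr_lt1 ?(ltW c0)// c1 gtrBl exprn_gt0.
pose k := Num.sqrt (1 - c ^+ 2).
have kk : k ^+ 2 = 1 - c ^+ 2 by rewrite sqr_sqrtr// ltW; case/andP: c21.
have k01 : 0 < k < 1.
  rewrite sqrtr_gt0; case/andP: c21 => -> h1 /=.
  by rewrite -sqrtr1 ltr_sqrt.
exists k => //.
have E2 : ellipE k <= pi / 2.
  rewrite ellipE_oint -subr_ge0 -[leLHS](_ : 0 - oint (s k) 0 = 0); last first.
    by rewrite oint0 subrr.
  have ci := continuous_locint (s_continuous k01).
  apply: (der_le (f := fun t => t - oint (s k) t) (df := fun t => 1 - s k t) (ltW pi2)) => t _.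
    have cs := s_continuous k01 (x := t).
    exact: (der_add (der_id t) (der_opp (der_oint ci cs))).
  rewrite subr_ge0 -sqrtr1 ler_sqrt// /w gerBl.
  by rewrite mulr_ge0 ?sqr_ge0.
have K2 : pi + 1 <= ellipK k.
  have ci := continuous_locint (sV_continuous k01).
  (* Difference of the elliptic integral and the primitive of 1 / (pi / 2 - t + c); comparing the
     integrands amounts to [D] being nondecreasing. *)
  pose D t : R := oint (fun t => (s k t)^-1) t + ln (pi / 2 - t + c).
  have dD t : 0 <= t <= pi / 2 ->
      is_derive t 1 D ((s k t)^-1 + (pi / 2 - t + c)^-1 * -1).
    move=> /andP[t0 tp].
    have d1 : is_derive t 1 (fun y : R => pi / 2 - y + c) (-1).
      by apply: (is_derive_eq (der_add (der_add (der_cst (pi / 2) t)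
        (der_opp (der_id t))) (der_cst c t))); rewrite add0r addr0.
    have p1 : 0 < pi / 2 - t + c by lra.
    have cs := sV_continuous k01 (x := t).
    exact: (der_add (der_oint ci cs) (der_comp (f := @ln R) d1 (is_derive1_ln p1))).
  have D0 : D 0 <= D (pi / 2).
    apply: (der_le (ltW pi2) dD) => t /andP[t0 tp].
    have p1 : 0 < pi / 2 - t + c by lra.
    rewrite mulrN1 subr_ge0 lef_pV2 ?posrE ?s_gt0//.
    rewrite -(ler_pXn2r (n := 2)) ?nnegrE ?(ltW p1) ?(ltW (s_gt0 _ _))//.
    rewrite s_sq// /w kk.
    have -> : 1 - (1 - c ^+ 2) * sin t ^+ 2 = cos t ^+ 2 + c ^+ 2 * sin t ^+ 2.
      by rewrite cos2sin2; ring.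
    have cg : 0 <= cos t by apply: cos_ge0_pihalf; rewrite tp andbT; lra.
    have cl : cos t <= pi / 2 - t.
      have -> : cos t = sin (pi / 2 - t).
        by rewrite sinB sin_pihalf cos_pihalf mul1r mul0r subr0.
      by apply: sin_le; rewrite subr_ge0.
    have a1 : cos t ^+ 2 <= (pi / 2 - t) ^+ 2 by rewrite ler_pXn2r ?nnegrE// subr_ge0.
    have a2 : c ^+ 2 * sin t ^+ 2 <= c ^+ 2 by rewrite ler_piMr ?sqr_ge0.
    have a3 : 0 <= (pi / 2 - t) * c by rewrite mulr_ge0 ?subr_ge0// ltW.
    rewrite sqrrD; move: a1 a2 a3.
    move: (cos t ^+ 2) ((pi / 2 - t) ^+ 2) (c ^+ 2 * sin t ^+ 2) (c ^+ 2).
    by move=> A B C D' a1 a2 a3; rewrite mulr2n; lra.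
  move: D0; rewrite /D oint0 add0r subr0 subrr add0r /c expRK -ellipK_oint => D0.
  have l0 : 0 <= ln (pi / 2 + expR (- (pi + 1)) : R).
    apply: ln_ge0; have := pihalf_ge1 R; have := c0; rewrite /c; lra.
  by move: D0 l0; move: (ln _) (ellipK k) => A B; lra.
by move: E2 K2; rewrite /H; move: (ellipK k) (ellipE k) => A B; lra.
Qed.

Theorem critical_modulus : exists kc : R,
  unique (fun k => 0 < k < 1 /\ ellipK k = 2 * ellipE k) kc.
Proof.
have [b b01 Hb] := H_pos.
have a01 : 0 < (1 / 2 : R) < 1 by lra.
have ab : 1 / 2 <= b.
  rewrite leNgt; apply/negP => /(H_incr b01 a01) hb.
  by have := lt_trans (lt_trans Hb hb) H_half; rewrite ltxx.
have inI k : 1 / 2 <= k <= b -> 0 < k < 1.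
  by move=> /andP[k1 k2']; have /andP[_ b1] := b01; rewrite (lt_le_trans _ k1)//= (le_lt_trans k2').
have cH : {within `[1 / 2, b], continuous H}.
  apply: continuous_in_subspaceT => k; rewrite inE /= in_itv /= => kI.
  exact: H_continuous (inI _ kI).
have v : Num.min (H (1 / 2)) (H b) <= 0 <= Num.max (H (1 / 2)) (H b).
  by rewrite ge_min le_max (ltW H_half) (ltW Hb) orbT.
have [kc kcI Hkc] := IVT ab cH v.
have kc01 : 0 < kc < 1 by apply: inI; move: kcI; rewrite in_itv.
exists kc; split; first by split=> //; apply/eqP; rewrite -subr_eq0 -/(H kc) Hkc.
move=> l [l01 lE]; have Hl : H l = 0 by rewrite /H lE subrr.
apply/eqP; case: ltgtP => // [kl|lk].
- by have := H_incr kc01 l01 kl; rewrite Hkc Hl ltxx.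
- by have := H_incr l01 kc01 lk; rewrite Hkc Hl ltxx.
Qed.

End CriticalModulus.

(** * The eigenvalue problem *)

Section EigenSystem.
Context {R : realType}.
Implicit Types (x : R) (Y : 'I_8 -> R -> R).
Variables (a b mu nu : R) (q : R -> R).
Hypothesis cq : continuous q.
Hypothesis q_le1 : forall x, `|q x| <= 1.

Local Notation o8 n := (@Ordinal 8 n isT).

(* The components are ordered as u1, u2, v1, v2, u1', u2', v1', v2', where u1 and
   u2 are the real and imaginary parts of u. *)
Definition eigen_cst (i j : 'I_8) : R := nth 0 (nth [::]
  [:: [:: 0; 0; 0; 0; 1; 0; 0; 0]; [:: 0; 0; 0; 0; 0; 1; 0; 0];
      [:: 0; 0; 0; 0; 0; 0; 1; 0]; [:: 0; 0; 0; 0; 0; 0; 0; 1];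
      [:: - a; 0; mu; - nu; 0; 0; 0; 0]; [:: 0; - a; nu; mu; 0; 0; 0; 0];
      [:: - mu; nu; - a; 0; 0; 0; 0; 0]; [:: - nu; - mu; 0; - a; 0; 0; 0; 0]] i) j.

Definition eigen_quad (i j : 'I_8) : R := nth 0 (nth [::]
  [:: [::]; [::]; [::]; [::]; [:: - (3 * b)]; [:: 0; - (3 * b)];
      [:: 0; 0; - b]; [:: 0; 0; 0; - b]] i) j.

(** Only q^2 enters, so a reflection that merely changes the sign of [q] preserves the
    coefficients. *)
Definition eigen_mx i j x : R := eigen_cst i j + eigen_quad i j * q x ^+ 2.

Lemma eigen_mx_continuous i j : continuous (eigen_mx i j).
Proof.
move=> x; apply: cvgD; first exact: cvg_cst.
apply: cvgM; first exact: cvg_cst.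
by rewrite expr2; apply: cvgM; exact: cq.
Qed.

Definition eigen_bound : R := \sum_i \sum_j (`|eigen_cst i j| + `|eigen_quad i j|).

Lemma eigen_bound_ge0 : 0 <= eigen_bound.
Proof. by apply: sumr_ge0 => i _; apply: sumr_ge0 => j _; rewrite addr_ge0. Qed.

Lemma eigen_mx_bound i j x : `|eigen_mx i j x| <= eigen_bound.
Proof.
apply: (@le_trans _ _ (`|eigen_cst i j| + `|eigen_quad i j|)).
  apply: (le_trans (ler_normD _ _)); rewrite lerD2l normrM ler_piMr//.
  by rewrite normrX exprn_ile1.
rewrite /eigen_bound (bigD1 i)//= (bigD1 j)//= -addrA lerDl.
by rewrite addr_ge0//; do ?(apply: sumr_ge0 => ? _); rewrite ?addr_ge0.
Qed.

Lemma eigen_act Y x :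
  [/\ [/\ act eigen_mx Y (o8 0) x = Y (o8 4) x, act eigen_mx Y (o8 1) x = Y (o8 5) x,
          act eigen_mx Y (o8 2) x = Y (o8 6) x & act eigen_mx Y (o8 3) x = Y (o8 7) x],
      act eigen_mx Y (o8 4) x =
        - (a + 3 * b * q x ^+ 2) * Y (o8 0) x + (mu * Y (o8 2) x - nu * Y (o8 3) x),
      act eigen_mx Y (o8 5) x =
        - (a + 3 * b * q x ^+ 2) * Y (o8 1) x + (nu * Y (o8 2) x + mu * Y (o8 3) x),
      act eigen_mx Y (o8 6) x =
        - (a + b * q x ^+ 2) * Y (o8 2) x - (mu * Y (o8 0) x - nu * Y (o8 1) x) &
      act eigen_mx Y (o8 7) x =
        - (a + b * q x ^+ 2) * Y (o8 3) x - (nu * Y (o8 0) x + mu * Y (o8 1) x)].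
Proof.
have E i : act eigen_mx Y i x =
    \sum_(j <- [:: o8 0; o8 1; o8 2; o8 3; o8 4; o8 5; o8 6; o8 7])
      eigen_mx i j x * Y j x.
  rewrite /act; apply: perm_big.
  by rewrite uniq_perm ?index_enum_uniq// => -[[|[|[|[|[|[|[|[|]]]]]]]] //= ?];
    rewrite mem_index_enum !inE.
rewrite !E !big_cons !big_nil /eigen_mx /eigen_cst /eigen_quad /=.
by do !split; ring.
Qed.

Definition eigen_solution Y := forall i x, is_derive x 1 (Y i) (act eigen_mx Y i x).

Lemma eigen_unique Y (x0 : R) : eigen_solution Y -> (forall i, Y i x0 = 0) ->
  forall i x, Y i x = 0.
Proof.
move=> sY Y0.
pose Z i t := Y i (t + x0); pose B i j t := eigen_mx i j (t + x0).
have sh : continuous (fun t : R => t + x0).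
  by move=> t; apply: cvgD; [exact: cvg_id|exact: cvg_cst].
have cB i j : continuous (B i j).
  by move=> t; apply: (continuous_comp (sh t)); exact: eigen_mx_continuous.
have cZ i : continuous (Z i).
  by move=> t; apply: (continuous_comp (sh t)); exact: (der_continuous (sY i _)).
have dZ i (t : R) : is_derive t 1 (Z i) (act B Z i t).
  have ds : is_derive t 1 (fun t : R => t + x0) 1.
    by apply: (is_derive_eq (der_add (der_id t) (der_cst x0 t))); rewrite addr0.
  by apply: (is_derive_eq (der_comp (f := Y i) ds (sY i _))); rewrite mulr1.
suff h : forall i t, Z i t = 0.
  by move=> i x; rewrite -(h i (x - x0)) /Z subrK.
apply: (volterra_unique cB (fun i j t => eigen_mx_bound i j _) cZ) => i t.
have cA := act_continuous (i := i) cB cZ.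
by rewrite (continuous_prim (dZ i) cA t) /Z add0r Y0 add0r.
Qed.

Section Reflection.
Variable c : R.
Hypothesis qc : forall x, q (c - x) ^+ 2 = q x ^+ 2.

(** A reflection of the variable reverses the sign of first derivatives, the components from 4
    on. *)
Definition esign (i : 'I_8) : R := if (i < 4)%N then 1 else -1.

Definition symmetrize (sg : R) Y i x := Y i x + sg * esign i * Y i (c - x).

Lemma symmetrize_solution sg Y : eigen_solution Y -> eigen_solution (symmetrize sg Y).
Proof.
move=> sY i x.
have ds : is_derive x 1 (fun t : R => c - t) (-1).
  by apply: (is_derive_eq (der_add (der_cst c x) (der_opp (der_id x)))); rewrite add0r.
have dc := der_comp (f := Y i) ds (sY i _).
apply: (is_derive_eq (der_add (sY i x) (der_mul (der_cst (sg * esign i) x) dc))).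
(* The matrix maps functions to derivatives and derivatives to functions, so it anticommutes with
   the diagonal sign matrix; this sign cancels the one from differentiating [c - x]. *)
have E j : eigen_mx i j x * esign j = - esign i * eigen_mx i j x.
  case: i {ds dc} => [[|[|[|[|[|[|[|[|]]]]]]]] //= ?];
  case: j => [[|[|[|[|[|[|[|[|]]]]]]]] //= ?];
  by rewrite /eigen_mx /eigen_cst /eigen_quad /esign /=; ring.
rewrite mul0r add0r mulrN1 /act -sumrN mulr_sumr -big_split /=.
apply: eq_bigr => j _; rewrite /symmetrize.
have -> : eigen_mx i j (c - x) = eigen_mx i j x by rewrite /eigen_mx qc.
rewrite mulrDr; congr (_ + _); move: (E j) (Y j (c - x)) => Ej w.
have {}Ej : eigen_mx i j x * sg * esign j * w = - sg * esign i * eigen_mx i j x * w.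
  by transitivity (sg * w * (eigen_mx i j x * esign j)); [ring|rewrite Ej; ring].
by rewrite !mulrA Ej; ring.
Qed.

Lemma symmetrize_split Y : (forall i x, symmetrize 1 Y i x = 0) ->
  (forall i x, symmetrize (-1) Y i x = 0) -> forall i x, Y i x = 0.
Proof.
move=> h1 h2 i x; have := h1 i x; have := h2 i x; rewrite /symmetrize.
rewrite mul1r mulN1r mulNr; move: (esign i * _) (Y i x) => A B; lra.
Qed.

End Reflection.

End EigenSystem.

(** * Absence of periodic solutions off the imaginary axis *)

Section NoPeriodic.
Context {R : realType}.
Implicit Types (x : R) (Y : 'I_8 -> R -> R).
Local Notation o8 n := (@Ordinal 8 n isT).

(** [F] divided by [m] is nondecreasing and periodic, hence constant on a window of length [T]
    around [x]. *)
Lemma periodic_der_zero (F S : R -> R) (m T : R) : m != 0 -> 0 < T ->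
  (forall x, is_derive x 1 F (m * S x)) -> (forall x, 0 <= S x) ->
  (forall x, F (x + T) = F x) -> forall x, S x = 0.
Proof.
move=> m0 T0 dF S0 FT x.
pose G (y : R) := m^-1 * F y.
have dG (y : R) : is_derive y 1 G (S y).
  by apply: (is_derive_eq (der_mul (der_cst _ _) (dF y))); rewrite mul0r add0r mulKf.
have mono y z : y <= z -> G y <= G z.
  move=> yz; apply: (der_le (df := S) yz) => // w _.
have dH : is_derive x 1 (fun y : R => G y - G (x - T / 2)) (S x).
  by apply: (is_derive_eq (der_add (dG x) (der_opp (der_cst _ _)))); rewrite subr0.
apply: (@der_zero _ _ (x - T / 2) (x + T / 2) x _ _ _ dH); last by apply/andP; split; lra.
move=> y /andP[y1 y2]; apply/eqP; rewrite subr_eq0 eq_le; apply/andP; split; last exact/mono/ltW.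
have -> : G (x - T / 2) = G (x + T / 2).
  by rewrite /G -[in LHS]FT; congr (_ * F _); lra.
exact/mono/ltW.
Qed.

Section Eigen.
Variables (a b mu nu : R) (q p : R -> R) (Y : 'I_8 -> R -> R).
Hypothesis mu0 : mu != 0.
Hypothesis Hq : forall x, is_derive x 1 q (p x).
Hypothesis Hp : forall x, is_derive x 1 p (- a * q x - b * q x ^+ 3).
Hypothesis q_le1 : forall x, `|q x| <= 1.
Hypothesis sY : eigen_solution a b mu nu q Y.

Let cq : continuous q.
Proof. by move=> x; exact: der_continuous (Hq x). Qed.

Lemma eigen_der : 
  [/\ [/\ forall x, is_derive x 1 (Y (o8 0)) (Y (o8 4) x),
          forall x, is_derive x 1 (Y (o8 1)) (Y (o8 5) x),
          forall x, is_derive x 1 (Y (o8 2)) (Y (o8 6) x) &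
          forall x, is_derive x 1 (Y (o8 3)) (Y (o8 7) x)],
      forall x, is_derive x 1 (Y (o8 4))
        (- (a + 3 * b * q x ^+ 2) * Y (o8 0) x + (mu * Y (o8 2) x - nu * Y (o8 3) x)),
      forall x, is_derive x 1 (Y (o8 5))
        (- (a + 3 * b * q x ^+ 2) * Y (o8 1) x + (nu * Y (o8 2) x + mu * Y (o8 3) x)),
      forall x, is_derive x 1 (Y (o8 6))
        (- (a + b * q x ^+ 2) * Y (o8 2) x - (mu * Y (o8 0) x - nu * Y (o8 1) x)) &
      forall x, is_derive x 1 (Y (o8 7))
        (- (a + b * q x ^+ 2) * Y (o8 3) x - (nu * Y (o8 0) x + mu * Y (o8 1) x))].
Proof.
by split; first split; move=> x; apply: (is_derive_eq (sY _ x));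
  have [[? ? ? ?] ? ? ? ?] := eigen_act a b mu nu q Y x.
Qed.

Let mn0 : mu ^+ 2 + nu ^+ 2 != 0.
Proof. by apply/eqP => /sqrD_eq0[e0 _]; move: mu0; rewrite e0 eqxx. Qed.

(* Once u and v vanish on an interval so do u' and v', and Cauchy uniqueness
   applies at any of its points. *)
Lemma eigen_vanish (A B : R) : A < B ->
  (forall x, A < x < B -> [/\ Y (o8 0) x = 0, Y (o8 1) x = 0, Y (o8 2) x = 0 & Y (o8 3) x = 0]) ->
  forall i x, Y i x = 0.
Proof.
move=> AB h.
have xI : A < (A + B) / 2 < B by apply/andP; split; lra.
apply: (eigen_unique cq q_le1 (x0 := (A + B) / 2) sY).
have [[d0 d1 d2 d3] _ _ _ _] := eigen_der; have [h0 h1 h2 h3] := h _ xI.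
have e4 := der_zero (f := Y (o8 0)) _ xI (d0 _).
have e5 := der_zero (f := Y (o8 1)) _ xI (d1 _).
have e6 := der_zero (f := Y (o8 2)) _ xI (d2 _).
have e7 := der_zero (f := Y (o8 3)) _ xI (d3 _).
case=> -[|[|[|[|[|[|[|[|]]]]]]]] //= lt8;
  rewrite (bool_irrelevance lt8 isT) //; [apply: e4|apply: e5|apply: e6|apply: e7];
  by move=> y /h[].
Qed.

Lemma eigen_vanish_v : (forall x, Y (o8 0) x = 0 /\ Y (o8 1) x = 0) -> forall i x, Y i x = 0.
Proof.
move=> u0; apply: (@eigen_vanish 0 1) => // x _.
have [[d0 d1 d2 d3] d4 d5 d6 d7] := eigen_der.
have I (y : R) : y - 1 < y < y + 1 by apply/andP; split; lra.
have e4 (y : R) : Y (o8 4) y = 0.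
  by apply: (der_zero (f := Y (o8 0)) _ (I y) (d0 _)) => z _; case: (u0 z).
have e5 (y : R) : Y (o8 5) y = 0.
  by apply: (der_zero (f := Y (o8 1)) _ (I y) (d1 _)) => z _; case: (u0 z).
have [u1 u2] := u0 x.
have := der_zero (f := Y (o8 4)) (fun z _ => e4 z) (I x) (d4 _).
have := der_zero (f := Y (o8 5)) (fun z _ => e5 z) (I x) (d5 _).
rewrite u1 u2 !mulr0 !add0r => f5 f4.
by have [-> ->] := cmul_eq0 f4 f5 mn0.
Qed.

Lemma defocusing_no_periodic (be T : R) : 0 < T -> 0 <= be < 1 -> b = - 2 * be ^+ 2 ->
  (forall x, p x ^+ 2 = 1 - a * q x ^+ 2 - b / 2 * q x ^+ 4) ->
  (forall x, q (x + T) = q x) -> (forall x, p (x + T) = p x) ->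
  (forall i x, Y i (x + T) = Y i x) -> forall i x, Y i x = 0.
Proof.
move=> T0 /andP[be0 be1] Hb Hpp qT pT YT.
have [[d0 d1 d2 d3] d4 d5 d6 d7] := eigen_der.
have q2 x : 0 <= be * q x ^+ 2 < 1.
  rewrite mulr_ge0 ?sqr_ge0//=; apply: le_lt_trans be1.
  by rewrite ler_piMr// -real_normK ?num_real// exprn_ile1.
have P x : 1 + be * q x ^+ 2 != 0 by have /andP[? ?] := q2 x; apply/eqP; lra.
have N x : 1 - be * q x ^+ 2 != 0 by have /andP[? ?] := q2 x; apply/eqP; lra.
have key (c : R) : b = - 2 * c ^+ 2 -> (forall x, 1 + c * q x ^+ 2 != 0) ->
    (forall x, 1 - c * q x ^+ 2 != 0) -> forall x,
    - (mu * Y (o8 0) x - nu * Y (o8 1) x) + 2 * c * p x / (1 - c * q x ^+ 2) *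
      (q x * Y (o8 6) x - p x * Y (o8 2) x) = 0 /\
    - (nu * Y (o8 0) x + mu * Y (o8 1) x) + 2 * c * p x / (1 - c * q x ^+ 2) *
      (q x * Y (o8 7) x - p x * Y (o8 3) x) = 0.
  move=> hc P' N'.
  have D x := defocusing_fluxP Hq Hp d0 d1 d2 d3 d4 d5 d6 d7 Hpp hc (P' x) (N' x).
  have h := periodic_der_zero mu0 T0 D.
  have S0 (c1 c2 c3 c4 : R) : 0 <= c1 ^+ 2 + c2 ^+ 2 + c3 ^+ 2 + c4 ^+ 2.
    by rewrite !addr_ge0 ?sqr_ge0.
  have per y : defocusing_flux a b mu nu q p (Y (o8 0)) (Y (o8 1)) (Y (o8 2)) (Y (o8 3))
      (Y (o8 4)) (Y (o8 5)) (Y (o8 6)) (Y (o8 7)) c (y + T) =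
    defocusing_flux a b mu nu q p (Y (o8 0)) (Y (o8 1)) (Y (o8 2)) (Y (o8 3))
      (Y (o8 4)) (Y (o8 5)) (Y (o8 6)) (Y (o8 7)) c y.
    by rewrite /defocusing_flux !qT !pT !YT.
  move=> x; have /eqP := h (fun y => S0 _ _ _ _) per x.
  rewrite paddr_eq0 ?addr_ge0 ?sqr_ge0// => /andP[+ /eqP h4].
  rewrite paddr_eq0 ?addr_ge0 ?sqr_ge0// => /andP[_ /eqP h3].
  by split; apply/eqP; rewrite -sqrf_eq0; apply/eqP.
have Hb' : b = - 2 * (- be) ^+ 2 by rewrite sqrrN.
have k1 := key _ Hb P N.
have P' x : 1 + - be * q x ^+ 2 != 0 by rewrite mulNr.
have N' x : 1 - - be * q x ^+ 2 != 0 by rewrite mulNr opprK.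
have k2 := key (- be) Hb' P' N'.
apply: eigen_vanish_v => x.
have [+ +] := k1 x; have [+ +] := k2 x.
rewrite !mulNr !opprK.

(* Weighting the relations for [- be] and [be] by their denominators cancels the terms in z; the
   weights add up to 2, leaving lambda u = 0. *)
have comb (l z : R) : - l + 2 * - be * p x / (1 + be * q x ^+ 2) * z = 0 ->
    - l + 2 * be * p x / (1 - be * q x ^+ 2) * z = 0 -> l = 0.
  have Px := P x; have Nx := N x.
  move=> h1 h2; apply/eqP; rewrite -oppr_eq0; apply/eqP.
  transitivity (((1 + be * q x ^+ 2) * (- l + 2 * - be * p x / (1 + be * q x ^+ 2) * z) +
    (1 - be * q x ^+ 2) * (- l + 2 * be * p x / (1 - be * q x ^+ 2) * z)) / 2).
    by field; rewrite Nx Px.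
  by rewrite h1 h2 !mulr0 addr0 mul0r.
move=> a1 a2 b1 b2.
have e1 := comb _ _ a1 b1; have e2 := comb _ _ a2 b2.
exact: cmul_eq0 e1 e2 mn0.
Qed.

End Eigen.

Section Focusing.
Variables (a b h ka mu nu K : R) (q p s s' : R -> R).
Hypothesis mu0 : mu != 0.
Hypothesis Hq : forall x, is_derive x 1 q (p x).
Hypothesis Hp : forall x, is_derive x 1 p (- a * q x - b * q x ^+ 3).
Hypothesis q_le1 : forall x, `|q x| <= 1.
Hypothesis Hpp : forall x, p x ^+ 2 = h - a * q x ^+ 2 - b / 2 * q x ^+ 4.
Hypothesis Hs : forall x, is_derive x 1 s (s' x).
Hypothesis Hs' : forall x, is_derive x 1 s' (- (a + b * q x ^+ 2 + ka) * s x).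
Hypothesis K0 : 0 < K.
Hypothesis q_neq0 : forall x, 0 < x < K -> q x != 0.
Hypothesis p_neq0 : forall x, 0 < x < K -> p x != 0.
Hypothesis p00 : p 0 = 0.
Hypothesis r0 : - a * q 0 - b * q 0 ^+ 3 != 0.
Hypothesis qK : q K = 0.
Hypothesis pK : p K != 0.
Hypothesis abh : a ^+ 2 + 2 * b * h = 1.
Hypothesis bh0 : 0 <= b * h.
Hypothesis ka0 : 0 < ka.
Hypothesis s_neq0 : forall x, 0 < x < K -> s x != 0.
Hypothesis s00 : s 0 = 0.
Hypothesis s'0 : s' 0 != 0.
Hypothesis sK : s K != 0.
Hypothesis s'K : s' K = 0.
Hypothesis qN : forall x, q (- x) = q x.
Hypothesis q_reflect : forall x, q (2 * K - x) = - q x.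

Let qN2 x : q (0 - x) ^+ 2 = q x ^+ 2. Proof. by rewrite sub0r qN. Qed.
Let q_reflect2 x : q (2 * K - x) ^+ 2 = q x ^+ 2. Proof. by rewrite q_reflect sqrrN. Qed.

(** [si] and [ta] select the symmetry about 0 and about [K]; [true] means odd, so functions vanish
    there, and [false] means even, so derivatives vanish. The four classes add up to a multiple of
    [Y]. *)
Lemma focusing_no_periodic Y : eigen_solution a b mu nu q Y ->
  (forall i x, Y i (x + 4 * K) = Y i x) -> forall i x, Y i x = 0.
Proof.
move=> sY YT.
pose W (si ta : bool) := symmetrize (2 * K) ((-1) ^+ ta) (symmetrize 0 ((-1) ^+ si) Y).
have sW si ta : eigen_solution a b mu nu q (W si ta).
  exact: (symmetrize_solution q_reflect2 _ (symmetrize_solution qN2 _ sY)).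
(* Periodicity is used here: it makes the symmetry about 0 survive the second symmetrization. *)
have YN i : Y i (- (2 * K)) = Y i (2 * K) by rewrite -YT; congr (Y i); ring.
have W0 (si ta : bool) (i : 'I_8) : si = (i < 4)%N -> W si ta i 0 = 0.
  rewrite /W /symmetrize !subr0 !sub0r YN /esign => ->.
  by case: (i < 4)%N; rewrite ?expr1 ?expr0; ring.
have WK (si ta : bool) (i : 'I_8) : ta = (i < 4)%N -> W si ta i K = 0.
  rewrite /W /symmetrize !sub0r /esign (_ : 2 * K - K = K) => [->|]; last by ring.
  by case: (i < 4)%N; rewrite ?expr1 ?expr0; ring.
have Wz si ta : forall i x, W si ta i x = 0.
  apply: (eigen_vanish Hq q_le1 (sW si ta) K0).
  have [[d0 d1 d2 d3] d4 d5 d6 d7] := eigen_der (sW si ta).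
  case: si d0 d1 d2 d3 d4 d5 d6 d7 => d0 d1 d2 d3 d4 d5 d6 d7 x xI.
    apply: (odd_vanish Hq Hp d0 d1 d2 d3 d4 d5 d6 d7 Hpp Hs Hs' mu0 p_neq0 p00 r0
      qK pK ka0 s_neq0 s00 s'0 sK s'K _ _ xI); first by split; exact: W0.
    by case: (ta) => {d0 d1 d2 d3 d4 d5 d6 d7}; [left|right]; split; exact: WK.
  case: ta d0 d1 d2 d3 d4 d5 d6 d7 => d0 d1 d2 d3 d4 d5 d6 d7.
    by apply: (even_odd_vanish Hq Hp d0 d1 d2 d3 d4 d5 d6 d7 Hpp mu0 q_neq0 p00 r0
      qK pK bh0 _ _ xI); split; [exact: W0..|exact: WK|exact: WK|exact: WK|exact: WK].
  by apply: (even_even_vanish Hq Hp d0 d1 d2 d3 d4 d5 d6 d7 Hpp mu0 q_neq0 p_neq0 p00 r0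
    qK pK abh _ _ xI); split; [exact: W0..|exact: WK|exact: WK|exact: WK|exact: WK].
apply: (symmetrize_split (c := 0)); apply: (symmetrize_split (c := 2 * K)).
- exact: (Wz false false).
- exact: (Wz false true).
- exact: (Wz true false).
- exact: (Wz true true).
Qed.

End Focusing.
End NoPeriodic.

Section JacobiNoPeriodic.
Context {R : realType}.
Variables (k mu nu : R) (Y : 'I_8 -> R -> R).
Hypothesis k01 : 0 < k < 1.
Hypothesis mu0 : mu != 0.
Hypothesis YT : forall i x, Y i (x + 4 * ellipK k) = Y i x.

Local Notation sn := (jacobi_sn k).
Local Notation cn := (jacobi_cn k).
Local Notation dn := (jacobi_dn k).

Lemma dn_periodic x : dn (x + 4 * ellipK k) = dn x.
Proof.
apply: (@pexpIrn _ 2); rewrite ?nnegrE ?ltW ?dn_gt0//.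
by rewrite !dn_sq// sn_periodic.
Qed.

Lemma sn_le1 x : `|sn x| <= 1. Proof. by rewrite ler_norml sin_geN1 sin_le1. Qed.
Lemma cn_le1 x : `|cn x| <= 1. Proof. by rewrite ler_norml cos_geN1 cos_le1. Qed.

Lemma sn_no_periodic : eigen_solution (1 + k ^+ 2) (- (2 * k ^+ 2)) mu nu sn Y ->
  forall i x, Y i x = 0.
Proof.
move=> sY; have /andP[k0 k1] := k01.
have dsn := der_sn k01; have dcn := der_cn k01; have ddn := der_dn k01.
have c2 x : cn x ^+ 2 = 1 - sn x ^+ 2 by rewrite sn_sq; ring.
have d2 x := dn_sq k01 x.
have Hp (x : R) : is_derive x 1 (fun t => cn t * dn t)
    (- (1 + k ^+ 2) * sn x - (- (2 * k ^+ 2)) * sn x ^+ 3).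
  by der; ring: (c2 x) (d2 x).
apply: (defocusing_no_periodic mu0 dsn Hp sn_le1 sY (be := k) (T := 4 * ellipK k)) => //.
- by rewrite mulr_gt0// ellipK_gt0.
- by rewrite (ltW k0).
- by ring.
- by move=> x; rewrite exprMn c2 d2; field.
- by move=> x; rewrite sn_periodic.
- by move=> x; rewrite cn_periodic// dn_periodic.
Qed.

Lemma cn_no_periodic : eigen_solution (1 - 2 * k ^+ 2) (2 * k ^+ 2) mu nu cn Y ->
  forall i x, Y i x = 0.
Proof.
move=> sY; have /andP[k0 k1] := k01; have k2 : 0 < k ^+ 2 by rewrite exprn_gt0.
have k21 : k ^+ 2 < 1 by rewrite exprn_ilt1// ltW.
have dsn := der_sn k01; have dcn := der_cn k01; have ddn := der_dn k01.
have s2 x : sn x ^+ 2 = 1 - cn x ^+ 2 by exact: sn_sq.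
have d2 x : dn x ^+ 2 = 1 - k ^+ 2 + k ^+ 2 * cn x ^+ 2 by rewrite dn_sq// sn_sq; ring.
have Hp (x : R) : is_derive x 1 (fun t => - sn t * dn t)
    (- (1 - 2 * k ^+ 2) * cn x - 2 * k ^+ 2 * cn x ^+ 3).
  by der; ring: (s2 x) (d2 x).
have Hs' (x : R) : is_derive x 1 (fun t => cn t * dn t)
    (- (1 - 2 * k ^+ 2 + 2 * k ^+ 2 * cn x ^+ 2 + k ^+ 2) * sn x).
  by der; ring: (s2 x) (d2 x).
have dn0 x : dn x != 0 by rewrite gt_eqF// dn_gt0.
(* [h] is the constant in the energy relation of cn, and [sn] is an eigenfunction of [L-] with
   eigenvalue [k ^+ 2], positive between 0 and K. *)
apply: (focusing_no_periodic (h := 1 - k ^+ 2) (ka := k ^+ 2) (K := ellipK k)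
  mu0 dcn Hp cn_le1 _ dsn Hs') => //.
- by move=> x; rewrite exprMn sqrrN s2 d2; field.
- exact: ellipK_gt0.
- by move=> x /cn_gt0 h; rewrite gt_eqF// h.
- by move=> x /sn_gt0 h; rewrite mulf_neq0// oppr_eq0 gt_eqF// h.
- by rewrite sn0// oppr0 mul0r.
- by rewrite cn0// expr1n !mulr1 opprB addrAC subrr add0r oppr_eq0 oner_eq0.
- exact: cnK.
- by rewrite mulf_neq0// snK// oppr_eq0 oner_eq0.
- by ring.
- by rewrite !mulr_ge0// ?subr_ge0 ltW.
- by move=> x /sn_gt0 h; rewrite gt_eqF// h.
- exact: sn0.
- by rewrite mulf_neq0// cn0// oner_eq0.
- by rewrite snK// oner_eq0.
- by rewrite cnK// mul0r.
- by move=> x; rewrite cnN.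
- by move=> x; rewrite cn_reflect.
Qed.

End JacobiNoPeriodic.

(** * Weak derivatives and regularity of locally integrable real functions *)

Section RealWeakDerivatives.
Context {R : realType}.
Notation mu := (@lebesgue_measure R).
Implicit Types (f g h phi : R -> R) (c T x : R).

Definition loc1 f := measurable_fun setT f /\ locint f.
Definition loc2 f := measurable_fun setT f /\ locint (fun x => f x ^+ 2).

Definition weakly f g := forall phi, test_function phi ->
  \int[mu]_x (f x * derive1 phi x) = - \int[mu]_x (g x * phi x).

Lemma loc1_linear (al be : R) f g : loc1 f -> loc1 g ->
  loc1 (fun x => al * f x + be * g x).
Proof.
move=> [mf fi] [mg gi]; split; last exact: locint_linear.
by apply: measurable_funD; apply: measurable_funM.
Qed.

Lemma continuous_loc1 f : continuous f -> loc1 f.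
Proof.
by move=> cf; split; [exact: continuous_measurable_fun|exact: continuous_locint].
Qed.

Lemma continuous_loc2 f : continuous f -> loc2 f.
Proof.
move=> cf; split; [exact: continuous_measurable_fun|apply: continuous_locint].
by move=> x; apply: cvgM; exact: cf.
Qed.

Lemma locint_dominated f h : measurable_fun setT f -> locint h ->
  (forall x, `|f x| <= h x) -> locint f.
Proof.
move=> mf hi fh a b; apply: le_integrable (hi a b) => //.
  by apply/measurable_EFinP; exact: measurable_funTS.
by move=> x _ /=; rewrite lee_fin (le_trans (fh x))// ler_norm.
Qed.

Lemma loc2_loc1 f : loc2 f -> loc1 f.
Proof.
move=> [mf fi]; split => //.
have i1 : locint (fun=> 1 : R) by apply: continuous_locint => t; exact: cvg_cst.
apply: (locint_dominated mf (locint_linear 1 1 i1 fi)) => x.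
have [n0|n0] := leP `|f x| 1; first by rewrite !mul1r (le_trans n0)// lerDl sqr_ge0.
by rewrite !mul1r -real_normK ?num_real// ler_wpDl// expr2 ler_peMl// ltW.
Qed.

Lemma loc2_linear (al be : R) f g : loc2 f -> loc2 g ->
  loc2 (fun x => al * f x + be * g x).
Proof.
move=> [mf fi] [mg gi].
have m : measurable_fun setT (fun x => al * f x + be * g x).
  by apply: measurable_funD; apply: measurable_funM.
split => //; apply: (locint_dominated _ (locint_linear (2 * al ^+ 2) (2 * be ^+ 2) fi gi)).
  exact: measurable_funX.
move=> x; rewrite ger0_norm ?sqr_ge0//; move: (f x) (g x) => y z.
rewrite -subr_ge0; have -> : 2 * al ^+ 2 * y ^+ 2 + 2 * be ^+ 2 * z ^+ 2
  - (al * y + be * z) ^+ 2 = (al * y - be * z) ^+ 2 by ring.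
exact: sqr_ge0.
Qed.

Lemma loc2_mul f g c : loc2 f -> continuous g -> (forall x, `|g x| <= c) ->
  loc2 (fun x => g x * f x).
Proof.
move=> [mf fi] cg gc.
have m : measurable_fun setT (fun x => g x * f x).
  by apply: measurable_funM => //; exact: continuous_measurable_fun.
split => //; apply: (locint_dominated _ (locint_linear (c ^+ 2) 0 fi fi)).
  exact: measurable_funX.
move=> x; rewrite ger0_norm ?sqr_ge0// mul0r addr0 exprMn.
by rewrite ler_wpM2r ?sqr_ge0// -(real_normK (num_real (g x))) lerXn2r ?nnegrE//
  (le_trans _ (gc x)).
Qed.

Lemma weakly_linear (al be : R) f g f' g' : loc1 f -> loc1 g -> loc1 f' -> loc1 g' ->
  weakly f f' -> weakly g g' ->
  weakly (fun x => al * f x + be * g x) (fun x => al * f' x + be * g' x).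
Proof.
move=> [mf fi] [mg gi] [mf' fi'] [mg' gi'] wf wg phi tp.
have E u v psi : measurable_fun setT u -> locint u -> measurable_fun setT v -> locint v ->
    test_function psi -> \int[mu]_x ((al * u x + be * v x) * psi x) =
    al * \int[mu]_x (u x * psi x) + be * \int[mu]_x (v x * psi x).
  move=> mu_ iu mv iv tpsi.
  have hu := integrable_test mu_ iu tpsi; have hv := integrable_test mv iv tpsi.
  rewrite -!RintegralZl// -RintegralD//; [|exact: (integrableZl _ _ hu)
    |exact: (integrableZl _ _ hv)].
  by apply: eq_Rintegral => x _; ring.
by rewrite !E ?wf ?wg//; [ring|exact: test_derive].
Qed.

Lemma weakly_eq f f' g g' : loc1 f -> loc1 f' -> loc1 g -> loc1 g' ->
  {ae mu, forall x, f x = f' x} -> {ae mu, forall x, g x = g' x} ->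
  weakly f g -> weakly f' g'.
Proof.
move=> [mf _] [mf' _] [mg _] [mg' _] ff' gg' w phi tp.
have mphi : measurable_fun setT phi.
  by apply: continuous_measurable_fun; exact: test_continuous.
have mphi' : measurable_fun setT (derive1 phi).
  by apply: continuous_measurable_fun; apply: test_continuous; exact: test_derive.
transitivity (\int[mu]_x (f x * derive1 phi x)).
  apply: Rintegral_ae => //; [exact: measurable_funM|exact: measurable_funM|].
  by apply: ae_imp ff' => x ->.
rewrite (w phi tp); congr (- _); apply: Rintegral_ae => //.
- exact: measurable_funM.
- exact: measurable_funM.
- by apply: ae_imp gg' => x ->.
Qed.

Lemma weakly_unique f g g' : loc1 g -> loc1 g' -> weakly f g -> weakly f g' ->
  {ae mu, forall x, g x = g' x}.
Proof.
move=> lg lg' w w'; have [mg gi] := lg; have [mg' gi'] := lg'.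
have [md di] := loc1_linear 1 (-1) lg lg'.
suff : {ae mu, forall x, 1 * g x + -1 * g' x = 0}.
  by apply: ae_imp => x /eqP; rewrite mul1r mulN1r subr_eq0 => /eqP.
apply: weak_zero => // phi tp.
have hg := integrable_test mg gi tp; have hg' := integrable_test mg' gi' tp.
transitivity (\int[mu]_x (g x * phi x - g' x * phi x)).
  by apply: eq_Rintegral => x _; ring.
rewrite RintegralTB//; apply/eqP; rewrite subr_eq0 -eqr_opp; apply/eqP.
by rewrite -(w _ tp) -(w' _ tp).
Qed.

Lemma weakly_cst c : weakly (fun=> c) (fun=> 0).
Proof.
move=> phi tp; under [in RHS]eq_Rintegral do rewrite mul0r.
rewrite Rintegral_cst// mul0r oppr0.
have tp' := test_derive tp; have [_ [M hM]] := tp.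
pose L := `|M| + 1.
have L0 : 0 < L by rewrite ltr_wpDl.
have LM : M < L by rewrite (le_lt_trans (ler_norm M))// ltrDl.
rewrite (@Rintegral_support _ _ `[- L, L]%classic); last first.
  move=> x /= xL; rewrite (derive1_support hM) ?mulr0//.
  by apply: (lt_trans LM); rewrite ltNge ler_norml; apply/negP => xI; apply: xL; rewrite /= in_itv.
have cphi' := test_continuous tp'.
have i' := continuous_locint cphi'.
rewrite RintegralZl//.
rewrite -oint_sub//; last by rewrite ge0_cp// ltW.
have E := continuous_prim (fun x => test_der x tp) cphi'.
have := E L; have := E (- L).
rewrite (hM L) ?(gtr0_norm L0)// (hM (- L)) ?normrN ?(gtr0_norm L0)//.
move: (oint _ _) (oint _ _) (phi 0) => A B C h1 h2.
by rewrite (_ : A = B) ?subrr ?mulr0//; lra.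
Qed.

Lemma loc1_oint g c : loc1 g -> loc1 (fun x => c + oint g x).
Proof.
move=> [_ gi]; apply: continuous_loc1 => x; apply: cvgD; first exact: cvg_cst.
exact: oint_continuous.
Qed.

Lemma primitive_weakly g c : loc1 g -> weakly (fun x => c + oint g x) g.
Proof.
move=> lg; have [mg gi] := lg.
have lc d : loc1 (fun=> d) by apply: continuous_loc1 => t; exact: cvg_cst.
have lo : loc1 (oint g) by apply: continuous_loc1; exact: oint_continuous.
have := weakly_linear 1 1 (lc c) lo (lc 0) lg (weakly_cst c)
  (fun phi tp => oint_weak_derivative mg gi tp).
congr weakly; apply/funext => x; rewrite !mul1r ?add0r//.
Qed.

(** [f] minus the primitive of [g] has weak derivative 0, so [weak_constant] applies. *)
Lemma weakly_primitive f g : loc1 f -> loc1 g -> weakly f g ->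
  exists c, {ae mu, forall x, f x = c + oint g x}.
Proof.
move=> lf lg w.
have lo := loc1_oint 0 lg.
have [md di] := loc1_linear 1 (-1) lf lo.
have wd := weakly_linear 1 (-1) lf lo lg lg w (primitive_weakly 0 lg).
have [|c hc] := weak_constant md di.
  move=> phi tp; rewrite wd//.
  under eq_Rintegral do rewrite mul1r mulN1r subrr mul0r.
  by rewrite Rintegral_cst// mul0r oppr0.
by exists c; apply: ae_imp hc => x; rewrite add0r; lra.
Qed.

(** A point of disagreement would come with a whole interval of them, which is not null. *)
Lemma continuous_ae_eq f g : continuous f -> continuous g ->
  {ae mu, forall x, f x = g x} -> forall x, f x = g x.
Proof.
move=> cf cg fg x; apply/eqP; rewrite -subr_eq0; apply/negPn/negP => n0.
have cd : {for x, continuous (fun y => f y - g y)} by apply: cvgB; [exact: cf|exact: cg].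
have [e /= e0 he] : \forall y \near x, f y - g y != 0.
  exact: cvgr_neq0 cd n0.
case: fg => N [mN N0 sN].
have : (mu `[(x - e / 2)%R, (x + e / 2)%R]%classic <= mu N)%E.
  apply: le_measure; rewrite ?inE// => y /=; rewrite in_itv /= => yI.
  apply: sN => /= /eqP; rewrite -subr_eq0; apply/negP; apply: he.
  by rewrite /ball /= ltr_distlC; apply/andP; lra.
rewrite N0 lebesgue_measure_itv/= lte_fin ifT; last lra.
by rewrite -EFinB lee_fin => h; lra.
Qed.

Lemma weakly_regular f d e : loc1 f -> loc1 d -> loc1 e -> weakly f d -> weakly d e ->
  exists Y Z, [/\ {ae mu, forall x, f x = Y x},
    forall x, Y x = Y 0 + oint Z x, forall x, Z x = Z 0 + oint e x,
    continuous Y & continuous Z].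
Proof.
move=> lf ld le wf wd.
have [c' hc'] := weakly_primitive ld le wd.
pose Z x := c' + oint e x.
have cZ : continuous Z.
  by move=> x; apply: cvgD; [exact: cvg_cst|exact: (oint_continuous le.2)].
have lZ := continuous_loc1 cZ.
have wZ : weakly f Z.
  by apply: (weakly_eq lf lf ld lZ _ hc' wf); apply: aeW.
have [c hc] := weakly_primitive lf lZ wZ.
exists (fun x => c + oint Z x), Z; split => //.
- by move=> x; rewrite oint0 addr0.
- by move=> x; rewrite {1 2}/Z oint0 addr0.
- by move=> x; apply: cvgD; [exact: cvg_cst|exact: (oint_continuous lZ.2)].
Qed.

(** [g] and its translate are both weak derivatives of [F], and weak derivatives are almost
    everywhere unique. *)
Lemma primitive_periodic F g T : loc1 g -> (forall x, F x = F 0 + oint g x) ->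
  (forall x, F (x + T) = F x) -> {ae mu, forall x, g (x + T) = g x}.
Proof.
move=> lg Fg FT; have [mg gi] := lg.
have lgT : loc1 (fun x => g (x + T)).
  by split; [exact: (measurableT_comp mg (measurable_shift T))|exact: locint_shift].
have FE c h : (forall x, F x = c + oint h x) -> F = (fun x => c + oint h x).
  by move=> hF; apply/funext.
apply: (weakly_unique (f := F)) => //; last by rewrite (FE _ _ Fg); exact: primitive_weakly.
rewrite (FE (F 0) (fun x => g (x + T))); first exact: primitive_weakly.
move=> x; rewrite oint_shift//.
have -> : F x = F 0 + oint g (x + T) by rewrite -Fg FT.
suff -> : oint g T = 0 by rewrite subr0.
by apply: (addrI (F 0)); rewrite addr0 -Fg -[in LHS](add0r T) FT.
Qed.

Lemma primitive_continuous_periodic F g T : continuous g ->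
  (forall x, F x = F 0 + oint g x) ->
  (forall x, F (x + T) = F x) -> forall x, g (x + T) = g x.
Proof.
move=> cg Fg FT; apply: continuous_ae_eq => //; last first.
  exact: primitive_periodic (continuous_loc1 cg) Fg FT.
move=> x; apply: (@continuous_comp _ _ _ (fun t => t + T) g); last exact: cg.
by apply: cvgD; [exact: cvg_id|exact: cvg_cst].
Qed.

Lemma ae_periodic f Y T : {ae mu, forall x, f x = Y x} -> continuous Y ->
  {ae mu, forall x, f (x + T) = f x} -> forall x, Y (x + T) = Y x.
Proof.
move=> fY cY fT; apply: continuous_ae_eq => //.
  move=> x; apply: (@continuous_comp _ _ _ (fun t => t + T) Y); last exact: cY.
  by apply: cvgD; [exact: cvg_id|exact: cvg_cst].
have fYT := ae_shift T fY.
have F := ae_filter_ringOfSetsType mu.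
apply: filterS3 fY fYT fT => x e1 e2 e3.
by rewrite -e1 -e2.
Qed.

End RealWeakDerivatives.

(** * Reduction of the complex spaces to real and imaginary parts *)

Section ComplexSpaces.
Context {R : realType}.
Notation mu := (@lebesgue_measure R).
Implicit Types (f g : R -> R[i]) (T x : R).

Local Notation rp f := (fun x => complex.Re (f x)).
Local Notation ip f := (fun x => complex.Im (f x)).

Lemma Re_norm_sq (z : R[i]) : complex.Re `|z| ^+ 2 = complex.Re z ^+ 2 + complex.Im z ^+ 2.
Proof. by case: z => u v /=; rewrite sqr_sqrtr// addr_ge0 ?sqr_ge0. Qed.

Lemma ae_eqCP f g : ae_eqC f g <->
  {ae mu, forall x, complex.Re (f x) = complex.Re (g x)} /\
  {ae mu, forall x, complex.Im (f x) = complex.Im (g x)}.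
Proof.
split=> [h|[h1 h2]]; first by split; apply: ae_imp h => x ->.
have F := ae_filter_ringOfSetsType mu; apply: filterS2 h1 h2 => x.
by case: (f x) (g x) => ? ? [? ?] /= -> ->.
Qed.

Lemma L2locP f : L2loc f <-> loc2 (rp f) /\ loc2 (ip f).
Proof.
split=> [[[m1 m2] h]|[[m1 i1] [m2 i2]]].
  have i12 : locint (fun x => complex.Re (f x) ^+ 2 + complex.Im (f x) ^+ 2).
    move=> a b; apply/integrableP; split.
      apply/measurable_EFinP; apply: measurable_funTS.
      by apply: measurable_funD; exact: measurable_funX.
    have := h a b; congr (_ < _)%E.
    by apply: eq_integral => x _ /=; rewrite ger0_norm ?addr_ge0 ?sqr_ge0// Re_norm_sq.
  split; split => //; apply: (locint_dominated _ i12); try exact: measurable_funX.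
    by move=> x; rewrite ger0_norm ?sqr_ge0// lerDl sqr_ge0.
  by move=> x; rewrite ger0_norm ?sqr_ge0// lerDr sqr_ge0.
split=> // a b; have /integrableP[_] := locint_linear 1 1 i1 i2 a b.
congr (_ < _)%E; apply: eq_integral => x _ /=.
by rewrite !mul1r ger0_norm ?addr_ge0 ?sqr_ge0// Re_norm_sq.
Qed.

Lemma weak_derivativeP f g : is_weak_derivative f g <->
  [/\ L2loc g, weakly (rp f) (rp g) & weakly (ip f) (ip g)].
Proof.
have E (h : R -> R[i]) (psi : R -> R) : cintegral setT (fun x => h x * (psi x)%:C%C) =
    Complex (\int[mu]_x (complex.Re (h x) * psi x)) (\int[mu]_x (complex.Im (h x) * psi x)).
  by rewrite /cintegral; congr Complex; apply: eq_Rintegral => x _; case: (h x) => u v /=;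
    rewrite mulr0 ?subr0 ?add0r.
split=> [[Lg w]|[Lg w1 w2]].
  by split => // phi tp; have := w phi tp; rewrite !E /= => -[? ?].
by split=> // phi tp; rewrite !E w1// w2.
Qed.

Lemma PTP T f : PT T f <-> [/\ loc2 (rp f), loc2 (ip f),
  {ae mu, forall x, complex.Re (f (x + T)) = complex.Re (f x)} &
  {ae mu, forall x, complex.Im (f (x + T)) = complex.Im (f x)}].
Proof.
rewrite /PT; split=> [[/L2locP[h1 h2] /ae_eqCP[h3 h4]]|[h1 h2 h3 h4]] //.
by split; [apply/L2locP|apply/ae_eqCP].
Qed.

Lemma Re_inner T f : complex.Re (inner T f f) =
  \int[mu]_(x in `[0, T]) (complex.Re (f x) ^+ 2 + complex.Im (f x) ^+ 2).
Proof.
rewrite /inner /cintegral /=; apply: eq_Rintegral => x _.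
by case: (f x) => u v /=; rewrite mulrN opprK !expr2.
Qed.

Lemma H2locP f : H2loc f -> exists d e, [/\ L2loc f, is_weak_derivative f d,
  is_weak_derivative d e & d = weak_derive f /\ e = weak_derive (weak_derive f)].
Proof.
move=> [Lf wf ww]; exists (weak_derive f), (weak_derive (weak_derive f)).
split => //; first exact: (xgetPex 0 wf).
exact: (xgetPex 0 ww).
Qed.

Lemma weak_derivative_eq f f' g g' : L2loc f -> L2loc f' -> L2loc g' ->
  ae_eqC f f' -> ae_eqC g g' -> is_weak_derivative f g -> is_weak_derivative f' g'.
Proof.
move=> /L2locP[/loc2_loc1 f1 /loc2_loc1 f2] /L2locP[/loc2_loc1 f1' /loc2_loc1 f2'] Lg'.
have /L2locP[/loc2_loc1 g1' /loc2_loc1 g2'] := Lg'.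
move=> /ae_eqCP[ef1 ef2] /ae_eqCP[eg1 eg2] /weak_derivativeP[Lg w1 w2].
have /L2locP[/loc2_loc1 g1 /loc2_loc1 g2] := Lg.
apply/weak_derivativeP; split => //.
  exact: weakly_eq f1 f1' g1 g1' ef1 eg1 w1.
exact: weakly_eq f2 f2' g2 g2' ef2 eg2 w2.
Qed.

Lemma weak_derive_ae f g : is_weak_derivative f g ->
  is_weak_derivative f (weak_derive f) /\ ae_eqC (weak_derive f) g.
Proof.
move=> w; have w' : is_weak_derivative f (weak_derive f).
  by apply: (xgetPex 0); exists g.
split=> //; move: w w' => /weak_derivativeP[/L2locP[g1 g2] w1 w2].
move=> /weak_derivativeP[/L2locP[g1' g2'] w1' w2'].
apply/ae_eqCP; split.
  exact: weakly_unique (loc2_loc1 g1') (loc2_loc1 g1) w1' w1.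
exact: weakly_unique (loc2_loc1 g2') (loc2_loc1 g2) w2' w2.
Qed.

(** [weak_derive f] is a chosen representative that may differ from [d] on a null set; changing [d]
    there does not affect its weak derivative. *)
Lemma H2loc_weak f d e : L2loc f -> is_weak_derivative f d -> is_weak_derivative d e ->
  H2loc f /\ ae_eqC (weak_derive (weak_derive f)) e.
Proof.
move=> Lf wd we; have [wd' dd] := weak_derive_ae wd.
have we' : is_weak_derivative (weak_derive f) e.
  have ee : ae_eqC e e by apply: aeW.
  by apply: (weak_derivative_eq _ _ _ _ ee we) => //;
    [exact: wd.1|exact: wd'.1|exact: we.1|apply: ae_imp dd => x ->].
have [_ ee] := weak_derive_ae we'.
by split => //; split => //; [exists d|exists e].
Qed.

End ComplexSpaces.

(** * The resolvent *)

Section PeriodicRegularity.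
Context {R : realType}.
Local Notation lam := (@lebesgue_measure R).
Implicit Types (f d e : R -> R) (x T : R).

Lemma ae_and (P Q : R -> Prop) : {ae lam, forall x, P x} -> {ae lam, forall x, Q x} ->
  {ae lam, forall x, P x /\ Q x}.
Proof.
by have F := ae_filter_ringOfSetsType lam; move=> hP hQ; apply: filterS2 hP hQ.
Qed.

(** Periodicity is assumed of [f] only, as in the domain of the operator; passing it on to [e] is
    what shows that the image of the operator is periodic. *)
Lemma weakly_regular_periodic f d e T : loc2 f -> loc2 d -> loc2 e ->
  weakly f d -> weakly d e -> {ae lam, forall x, f (x + T) = f x} ->
  exists Y Z, [/\ {ae lam, forall x, f x = Y x},
    (forall x, Y x = Y 0 + oint Z x) /\ (forall x, Z x = Z 0 + oint e x),
    continuous Y /\ continuous Z,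
    (forall x, Y (x + T) = Y x) /\ (forall x, Z (x + T) = Z x) &
    {ae lam, forall x, e (x + T) = e x}].
Proof.
move=> /loc2_loc1 lf /loc2_loc1 ld /loc2_loc1 le wf wd fT.
have [Y [Z [fY YE ZE cY cZ]]] := weakly_regular lf ld le wf wd.
have YT := ae_periodic fY cY fT.
have ZT := primitive_continuous_periodic cZ YE YT.
by exists Y, Z; split=> //; exact: primitive_periodic le ZE ZT.
Qed.

Lemma loc2_potential (c0 c1 : R) (q f : R -> R) : continuous q -> (forall x, `|q x| <= 1) ->
  loc2 f -> loc2 (fun x => (c0 + c1 * q x ^+ 2) * f x).
Proof.
move=> cq q1 lf; apply: (loc2_mul (c := `|c0| + `|c1|) lf).
  move=> x; apply: cvgD; first exact: cvg_cst.
  apply: cvgM; first exact: cvg_cst.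
  by rewrite expr2; apply: cvgM; exact: cq.
move=> x; apply: (le_trans (ler_normD _ _)); rewrite lerD2l normrM ler_piMr//.
by rewrite normrX exprn_ile1.
Qed.

End PeriodicRegularity.

Section Resolvent.
Context {R : realType}.
Local Notation lam := (@lebesgue_measure R).
Local Notation V := (R -> R[i]).
Local Notation o8 n := (@Ordinal 8 n isT).
Implicit Types (F g : V * V) (Y : 'I_8 -> R -> R) (x : R).
Variables (a b mu nu T : R) (q : R -> R).
Hypothesis cq : continuous q.
Hypothesis q_le1 : forall x, `|q x| <= 1.
Hypothesis T0 : 0 < T.
Hypothesis qT : forall x, q (x + T) = q x.
Hypothesis no_periodic : forall Y, eigen_solution a b mu nu q Y ->
  (forall i x, Y i (x + T) = Y i x) -> forall i x, Y i x = 0.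

Local Notation A := (eigen_mx a b mu nu q).
Local Notation lambda := (Complex mu nu).

(** The second component of [(JL - lambda) (u, v) = g] prescribes u'' with source [g.2], the first
    prescribes v'' with source [- g.1]; hence the exchange and the sign. *)
Definition forcing_of g (i : 'I_8) x : R := nth 0
  [:: 0; 0; 0; 0; complex.Re (g.2 x); complex.Im (g.2 x);
      - complex.Re (g.1 x); - complex.Im (g.1 x)] i.

Definition eigen_fun Y : V * V :=
  (fun x => Complex (Y (o8 0) x) (Y (o8 1) x), fun x => Complex (Y (o8 2) x) (Y (o8 3) x)).

Local Notation D f := (weak_derive (weak_derive f)).

Lemma JL_shiftE F x (g := JL a b q F - lambda *: F) :
  [/\ complex.Re (g.2 x) = complex.Re (D F.1 x) + (a + 3 * b * q x ^+ 2) * complex.Re (F.1 x)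
        - (mu * complex.Re (F.2 x) - nu * complex.Im (F.2 x)),
      complex.Im (g.2 x) = complex.Im (D F.1 x) + (a + 3 * b * q x ^+ 2) * complex.Im (F.1 x)
        - (nu * complex.Re (F.2 x) + mu * complex.Im (F.2 x)),
      - complex.Re (g.1 x) = complex.Re (D F.2 x) + (a + b * q x ^+ 2) * complex.Re (F.2 x)
        + (mu * complex.Re (F.1 x) - nu * complex.Im (F.1 x)) &
      - complex.Im (g.1 x) = complex.Im (D F.2 x) + (a + b * q x ^+ 2) * complex.Im (F.2 x)
        + (nu * complex.Re (F.1 x) + mu * complex.Im (F.1 x))].
Proof.
have E1 : g.1 x = Lminus a b q F.2 x - lambda * F.1 x by [].
have E2 : g.2 x = - Lplus a b q F.1 x - lambda * F.2 x by [].
rewrite E1 E2 /Lplus /Lminus.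
case: (weak_derive _ x) (weak_derive _ x) (F.1 x) (F.2 x) => [u u'] [v v'] [w w'] [z z'] /=.
by split; ring.
Qed.

Lemma PT2P g : PT2 T g <-> forall i : 'I_8, loc2 (forcing_of g i) /\
  {ae lam, forall x, forcing_of g i (x + T) = forcing_of g i x}.
Proof.
have l2N (f : R -> R) : loc2 f -> loc2 (fun x => - f x).
  move=> lf; have := loc2_linear (-1) 0 lf lf.
  by congr loc2; apply/funext => x; rewrite mul0r addr0 mulN1r.
have aeN (f : R -> R) : {ae lam, forall x, f (x + T) = f x} ->
    {ae lam, forall x, - f (x + T) = - f x}.
  by apply: ae_imp => x ->.
have N2 (f : R -> R) : (fun x => - - f x) = f by apply/funext => x; rewrite opprK.
split=> [[/PTP[l1 l2 p1 p2] /PTP[l3 l4 p3 p4]] [[|[|[|[|[|[|[|[|]]]]]]]] //= ?]|h].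
- by split; [apply: continuous_loc2 => x; exact: cvg_cst|exact: aeW].
- by split; [apply: continuous_loc2 => x; exact: cvg_cst|exact: aeW].
- by split; [apply: continuous_loc2 => x; exact: cvg_cst|exact: aeW].
- by split; [apply: continuous_loc2 => x; exact: cvg_cst|exact: aeW].
- by split; [exact: l2N|exact: aeN].
- by split; [exact: l2N|exact: aeN].
have [l4 p4] := h (o8 4); have [l5 p5] := h (o8 5).
have [l6 p6] := h (o8 6); have [l7 p7] := h (o8 7).
split; apply/PTP; split => //.
- by rewrite -[X in loc2 X]N2; exact: l2N.
- by rewrite -[X in loc2 X]N2; exact: l2N.
- by apply: ae_imp p6 => x /oppr_inj.
- by apply: ae_imp p7 => x /oppr_inj.
Qed.

Lemma forcing_ofP g : PT2 T g -> forcing T (forcing_of g).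
Proof. by move=> /PT2P h; split => i; have [[? ?] ?] := h i; [|exact: (loc2_loc1 _).2|]. Qed.

Lemma oint_cst0 x : oint (fun=> 0 : R) x = 0.
Proof. by rewrite /oint !Rintegral_cst// !mul0r oppr0 if_same. Qed.

Let cA := eigen_mx_continuous (a := a) (b := b) (mu := mu) (nu := nu) cq.

Lemma domJL_mild F (g := JL a b q F - lambda *: F) : domJL T F -> PT2 T g /\
  exists Y, [/\ mild_solution A (forcing_of g) Y, forall i x, Y i (x + T) = Y i x &
    ae_eqC2 F (eigen_fun Y)].
Proof.
have gE := JL_shiftE F; cbv zeta in gE; rewrite -/g in gE.
move=> [[H1 P1] [H2 P2]].
have [d1 [e1 [_ wd1 we1 [ed1 ee1]]]] := H2locP H1.
have [d2 [e2 [_ wd2 we2 [ed2 ee2]]]] := H2locP H2.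
move: gE; rewrite -ee1 -ee2 => {ee1 ed1 ee2 ed2} gE.
move/PTP: (P1) => [f1 f1' p1 p1']; move/PTP: (P2) => [f2 f2' p2 p2'].
move/weak_derivativeP: wd1 => [/L2locP[ld1 ld1'] wd1 wd1'].
move/weak_derivativeP: we1 => [/L2locP[le1 le1'] we1 we1'].
move/weak_derivativeP: wd2 => [/L2locP[ld2 ld2'] wd2 wd2'].
move/weak_derivativeP: we2 => [/L2locP[le2 le2'] we2 we2'].
have [Y0 [Y4 [a0 [I0 I4] [c0 c4] [T0' T4] b0]]] := weakly_regular_periodic f1 ld1 le1 wd1 we1 p1.
have [Y1 [Y5 [a1 [I1 I5] [c1 c5] [T1 T5] b1]]] :=
  weakly_regular_periodic f1' ld1' le1' wd1' we1' p1'.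
have [Y2 [Y6 [a2 [I2 I6] [c2 c6] [T2 T6] b2]]] := weakly_regular_periodic f2 ld2 le2 wd2 we2 p2.
have [Y3 [Y7 [a3 [I3 I7] [c3 c7] [T3 T7] b3]]] :=
  weakly_regular_periodic f2' ld2' le2' wd2' we2' p2'.
pose Y (i : 'I_8) := nth (fun=> 0) [:: Y0; Y1; Y2; Y3; Y4; Y5; Y6; Y7] i.
have cY i : continuous (Y i).
  by case: i => [[|[|[|[|[|[|[|[|]]]]]]]] //= ?].
have YT i x : Y i (x + T) = Y i x.
  by case: i => [[|[|[|[|[|[|[|[|]]]]]]]] //= ?].
have pg : PT2 T g.
  apply/PT2P.
  have pot := fun c0 c1 f => @loc2_potential _ c0 c1 q f cq q_le1.
  have comb4 (e f h h' : R -> R) (k1 k2 k3 k4 : R) : loc2 e -> loc2 f -> loc2 h -> loc2 h' ->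
      loc2 (fun x => e x + (k1 + k2 * q x ^+ 2) * f x + (k3 * h x + k4 * h' x)).
    move=> le lf lh lh'.
    have := loc2_linear 1 1 (loc2_linear 1 1 le (pot k1 k2 f lf)) (loc2_linear k3 k4 lh lh').
    by congr loc2; apply/funext => x; rewrite !mul1r.
  have per := ae_and (ae_and (ae_and p1 p1') (ae_and p2 p2'))
    (ae_and (ae_and b0 b1) (ae_and b2 b3)).
  case=> [[|[|[|[|[|[|[|[|]]]]]]]] //= ?];
    try by split; [apply: continuous_loc2 => x; exact: cvg_cst|exact: aeW].
  - split.
      have := comb4 _ _ _ _ a (3 * b) (- mu) nu le1 f1 f2 f2'; congr loc2; apply/funext => x.
      by rewrite /forcing_of /=; have [-> _ _ _] := gE x; ring.
    apply: ae_imp per => x [[[q1 q1'] [q2 q2']] [[r0 r1] [r2 r3]]].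
    rewrite /forcing_of /=; have [-> _ _ _] := gE x; have [-> _ _ _] := gE (x + T).
    by rewrite qT ?q1 ?q1' ?q2 ?q2' r0.
  - split.
      have := comb4 _ _ _ _ a (3 * b) (- nu) (- mu) le1' f1' f2 f2'; congr loc2; apply/funext => x.
      by rewrite /forcing_of /=; have [_ -> _ _] := gE x; ring.
    apply: ae_imp per => x [[[q1 q1'] [q2 q2']] [[r0 r1] [r2 r3]]].
    rewrite /forcing_of /=; have [_ -> _ _] := gE x; have [_ -> _ _] := gE (x + T).
    by rewrite qT ?q1 ?q1' ?q2 ?q2' r1.
  - split.
      have := comb4 _ _ _ _ a b mu (- nu) le2 f2 f1 f1'; congr loc2; apply/funext => x.
      by rewrite /forcing_of /=; have [_ _ -> _] := gE x; ring.
    apply: ae_imp per => x [[[q1 q1'] [q2 q2']] [[r0 r1] [r2 r3]]].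
    rewrite /forcing_of /=; have [_ _ -> _] := gE x; have [_ _ -> _] := gE (x + T).
    by rewrite qT ?q1 ?q1' ?q2 ?q2' r2.
  - split.
      have := comb4 _ _ _ _ a b nu mu le2' f2' f1 f1'; congr loc2; apply/funext => x.
      by rewrite /forcing_of /=; have [_ _ _ ->] := gE x; ring.
    apply: ae_imp per => x [[[q1 q1'] [q2 q2']] [[r0 r1] [r2 r3]]].
    rewrite /forcing_of /=; have [_ _ _ ->] := gE x; have [_ _ _ ->] := gE (x + T).
    by rewrite qT ?q1 ?q1' ?q2 ?q2' r3.
split => //; exists Y; split => //; last first.
  by split; apply/ae_eqCP.
split => // i x; have [_ iG _] := forcing_ofP pg.
have ae4 := ae_and (ae_and a0 a1) (ae_and a2 a3).
have iA j : locint (act A Y j).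
  by apply: continuous_locint; exact: act_continuous.
have low (j : 'I_8) Z : forcing_of g j = (fun=> 0) -> (forall t, act A Y j t = Z t) ->
    (forall t, Y j t = Y j 0 + oint Z t) ->
    Y j x = Y j 0 + oint (act A Y j) x + oint (forcing_of g j) x.
  by move=> -> /funext -> <-; rewrite oint_cst0 addr0.
(* The equation for second derivatives holds only almost everywhere, which suffices once it stands
   under an integral. *)
have high (j : 'I_8) e : loc2 e -> (forall t, Y j t = Y j 0 + oint e t) ->
    {ae lam, forall t, e t = 1 * act A Y j t + 1 * forcing_of g j t} ->
    Y j x = Y j 0 + oint (act A Y j) x + oint (forcing_of g j) x.
  move=> le YE eE.
  rewrite YE (oint_eq x (loc2_loc1 le).2 (locint_linear 1 1 (iA j) (iG j)) eE).
  by rewrite oint_linear// !mul1r addrA.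
have actE := eigen_act a b mu nu q Y.
case: i => [[|[|[|[|[|[|[|[|]]]]]]]] // lt8]; rewrite (bool_irrelevance lt8 isT).
- by apply: (low _ Y4) => // t; have [[-> _ _ _] _ _ _ _] := actE t.
- by apply: (low _ Y5) => // t; have [[_ -> _ _] _ _ _ _] := actE t.
- by apply: (low _ Y6) => // t; have [[_ _ -> _] _ _ _ _] := actE t.
- by apply: (low _ Y7) => // t; have [[_ _ _ ->] _ _ _ _] := actE t.
- apply: (high _ _ le1) => //; apply: ae_imp ae4 => t [[h0 h1] [h2 h3]].
  have [_ -> _ _ _] := actE t; rewrite /forcing_of /=.
  by have [-> _ _ _] := gE t; rewrite h0 h2 h3 /Y /=; ring.
- apply: (high _ _ le1') => //; apply: ae_imp ae4 => t [[h0 h1] [h2 h3]].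
  have [_ _ -> _ _] := actE t; rewrite /forcing_of /=.
  by have [_ -> _ _] := gE t; rewrite h1 h2 h3 /Y /=; ring.
- apply: (high _ _ le2) => //; apply: ae_imp ae4 => t [[h0 h1] [h2 h3]].
  have [_ _ _ -> _] := actE t; rewrite /forcing_of /=.
  by have [_ _ -> _] := gE t; rewrite h0 h1 h2 /Y /=; ring.
- apply: (high _ _ le2') => //; apply: ae_imp ae4 => t [[h0 h1] [h2 h3]].
  have [_ _ _ _ ->] := actE t; rewrite /forcing_of /=.
  by have [_ _ _ ->] := gE t; rewrite h0 h1 h3 /Y /=; ring.
Qed.

Lemma weakly_of_primitive (F f : R -> R) (c : R) : loc1 f ->
  (forall x, F x = c + oint f x) -> weakly F f.
Proof. by move=> lf /funext ->; exact: primitive_weakly. Qed.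

Lemma mild_domJL g Y (F := eigen_fun Y) : PT2 T g -> mild_solution A (forcing_of g) Y ->
  (forall i x, Y i (x + T) = Y i x) ->
  domJL T F /\ ae_eqC2 (JL a b q F - lambda *: F) g.
Proof.
move=> pg [cY YE] YT; have gl i : loc2 (forcing_of g i) by have [] := (PT2P g).1 pg i.
(* Integrand of the mild formulation, hence the weak derivative of [Y i]. *)
pose e i x := 1 * act A Y i x + 1 * forcing_of g i x.
have le i : loc2 (e i).
  by apply: loc2_linear => //; apply: continuous_loc2; exact: act_continuous.
have actE := eigen_act a b mu nu q Y.
have low (i j : 'I_8) : forcing_of g i = (fun=> 0) -> (forall t, act A Y i t = Y j t) ->
    weakly (Y i) (Y j).
  move=> g0 /funext Ej; apply: (weakly_of_primitive (c := Y i 0)).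
    exact: continuous_loc1.
  by move=> x; rewrite YE g0 oint_cst0 addr0 Ej.
have w0 : weakly (Y (o8 0)) (Y (o8 4)).
  by apply: low => // t; have [[-> _ _ _] _ _ _ _] := actE t.
have w1 : weakly (Y (o8 1)) (Y (o8 5)).
  by apply: low => // t; have [[_ -> _ _] _ _ _ _] := actE t.
have w2 : weakly (Y (o8 2)) (Y (o8 6)).
  by apply: low => // t; have [[_ _ -> _] _ _ _ _] := actE t.
have w3 : weakly (Y (o8 3)) (Y (o8 7)).
  by apply: low => // t; have [[_ _ _ ->] _ _ _ _] := actE t.
have we i : weakly (Y i) (e i).
  apply: (weakly_of_primitive (c := Y i 0)); first exact: loc2_loc1.
  move=> x; rewrite YE /e oint_linear ?mul1r ?addrA//; last exact: (loc2_loc1 (gl i)).2.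
  by apply: continuous_locint; exact: act_continuous.
have L (i j : 'I_8) : L2loc (fun x => Complex (Y i x) (Y j x)).
  by apply/L2locP; split; exact: (continuous_loc2 (@cY _)).
have Le (i j : 'I_8) : L2loc (fun x => Complex (e i x) (e j x)).
  by apply/L2locP; split; exact: le.
have W (i j i' j' : 'I_8) : weakly (Y i) (Y i') -> weakly (Y j) (Y j') ->
    is_weak_derivative (fun x => Complex (Y i x) (Y j x)) (fun x => Complex (Y i' x) (Y j' x)).
  by move=> wi wj; apply/weak_derivativeP; split; [exact: L|exact: wi|exact: wj].
have We (i j : 'I_8) :
    is_weak_derivative (fun x => Complex (Y i x) (Y j x)) (fun x => Complex (e i x) (e j x)).
  by apply/weak_derivativeP; split; [exact: Le|exact: we|exact: we].
have [H1 D1] := H2loc_weak (L _ _) (W _ _ _ _ w0 w1) (We _ _).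
have [H2 D2] := H2loc_weak (L _ _) (W _ _ _ _ w2 w3) (We _ _).
have P (i j : 'I_8) : PT T (fun x => Complex (Y i x) (Y j x)).
  by split; [exact: L|apply: aeW => x; rewrite !YT].
split; first exact: (conj (conj H1 (P _ _)) (conj H2 (P _ _))).
move: D1 D2 => /ae_eqCP[D0 D1] /ae_eqCP[D2 D3].
have JE := JL_shiftE F.
split; apply/ae_eqCP; split.
- apply: ae_imp D2 => x h; apply: oppr_inj; have [_ _ -> _] := JE x; rewrite h /e /=.
  have [_ _ _ -> _] := actE x; rewrite /forcing_of /=; ring.
- apply: ae_imp D3 => x h; apply: oppr_inj; have [_ _ _ ->] := JE x; rewrite h /e /=.
  have [_ _ _ _ ->] := actE x; rewrite /forcing_of /=; ring.
- apply: ae_imp D0 => x h; have [-> _ _ _] := JE x; rewrite h /e /=.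
  have [_ -> _ _ _] := actE x; rewrite /forcing_of /=; ring.
- apply: ae_imp D1 => x h; have [_ -> _ _] := JE x; rewrite h /e /=.
  have [_ _ -> _ _] := actE x; rewrite /forcing_of /=; ring.
Qed.

End Resolvent.

(** * L^2 estimates for the resolvent and spectral stability *)

Section ResolventBound.
Context {R : realType}.
Local Notation lam := (@lebesgue_measure R).
Local Notation V := (R -> R[i]).
Local Notation o8 n := (@Ordinal 8 n isT).
Implicit Types (F g : V * V) (Y : 'I_8 -> R -> R) (x : R) (f h : R -> R).

Lemma oint_le f h x : 0 <= x -> locint f -> locint h ->
  (forall t, 0 <= t <= x -> f t <= h t) -> oint f x <= oint h x.
Proof.
by move=> x0 fi hi fh; rewrite /oint x0; apply: le_Rintegral.
Qed.

Lemma oint_cst (c x : R) : 0 <= x -> oint (fun=> c) x = c * x.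
Proof.
move=> x0; rewrite /oint x0 Rintegral_cst//; congr (_ * _).
suff e : fine (lam `[0, x]%classic) = x by exact: e.
by rewrite lebesgue_measure_itv /= lte_fin; case: ltgtP x0 => [_ _|//|<- _] /=; rewrite ?subr0.
Qed.

Lemma locint_cst (c : R) : locint (fun=> c).
Proof. by apply: continuous_locint => t; exact: cvg_cst. Qed.

Lemma oint_ge0 f x : 0 <= x -> locint f -> (forall t, 0 <= f t) -> 0 <= oint f x.
Proof.
by move=> x0 fi f0; rewrite -[X in X <= _](mul0r x) -(oint_cst 0 x0);
  apply: oint_le => //; exact: locint_cst.
Qed.

Lemma sqr_oint_norm f (T : R) : 0 < T -> loc2 f ->
  (oint (fun t => `|f t|) T) ^+ 2 <= T * oint (fun t => f t ^+ 2) T.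
Proof.
move=> T0 l2; have [mf fi] := loc2_loc1 l2; have [_ f2] := l2.
have fn : locint (fun t => `|f t|).
  by move=> a b; have := integrable_norm (fi a b).
set I := oint _ T; set J := oint _ T; pose m := I / T.
have i1 := locint_linear (-2 * m) (m ^+ 2) fn (locint_cst 1).
have : 0 <= oint (fun t => 1 * f t ^+ 2 + 1 * (-2 * m * `|f t| + m ^+ 2 * 1)) T.
  (* Cauchy-Schwarz, as the nonnegativity of the variance of [|f|]. *)
  apply: oint_ge0; [exact: ltW|exact: locint_linear|].
  move=> t; rewrite -(real_normK (num_real (f t))).
  by have -> : 1 * `|f t| ^+ 2 + 1 * (-2 * m * `|f t| + m ^+ 2 * 1) = (`|f t| - m) ^+ 2;
    [ring|exact: sqr_ge0].
rewrite oint_linear// oint_linear//; last exact: locint_cst.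
rewrite oint_cst ?(ltW T0)// -/I -/J /m => h.
have Tn : T != 0 by rewrite gt_eqF.
rewrite -subr_ge0; have -> : T * J - I ^+ 2 =
    T * (1 * J + 1 * (-2 * (I / T) * I + (I / T) ^+ 2 * (1 * T))) by field.
by rewrite mulr_ge0// ltW.
Qed.

Lemma normPT2_sqr F (T : R) : 0 < T -> PT2 T F -> normPT2 T F ^+ 2 =
  oint (fun x => complex.Re (F.1 x) ^+ 2) T + oint (fun x => complex.Im (F.1 x) ^+ 2) T +
  (oint (fun x => complex.Re (F.2 x) ^+ 2) T + oint (fun x => complex.Im (F.2 x) ^+ 2) T).
Proof.
move=> T0 [/PTP[l1 l1' _ _] /PTP[l2 l2' _ _]].
have ReD (z w : R[i]) : complex.Re (z + w) = complex.Re z + complex.Re w by case: z w => ? ? [].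
have E (G : V) : loc2 (fun x => complex.Re (G x)) -> loc2 (fun x => complex.Im (G x)) ->
    complex.Re (inner T G G) =
    oint (fun x => complex.Re (G x) ^+ 2) T + oint (fun x => complex.Im (G x) ^+ 2) T.
  move=> [_ i1] [_ i2]; rewrite Re_inner.
  have := oint_linear 1 1 T i1 i2; rewrite {1}/oint (ltW T0) !mul1r => <-.
  by apply: eq_Rintegral => x _; rewrite !mul1r.
have p (G : R -> R) : loc2 G -> 0 <= oint (fun x => G x ^+ 2) T.
  by move=> [_ iG]; apply: oint_ge0 => [|//|t]; [exact: ltW|exact: sqr_ge0].
by rewrite /normPT2 ReD !E// sqr_sqrtr// !addr_ge0// p.
Qed.

Lemma forcing_sqr_le g (T : R) i : 0 < T -> PT2 T g ->
  oint (fun x => forcing_of g i x ^+ 2) T <= normPT2 T g ^+ 2.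
Proof.
move=> T0 pg; rewrite normPT2_sqr//.
have [/PTP[l1 l1' _ _] /PTP[l2 l2' _ _]] := pg.
have p (G : R -> R) : loc2 G -> 0 <= oint (fun x => G x ^+ 2) T.
  by move=> [_ iG]; apply: oint_ge0 => [|//|t]; [exact: ltW|exact: sqr_ge0].
have [] := (p _ l1, p _ l1'); have [] := (p _ l2, p _ l2').
move=> p1 p2 p3 p4.
have z : oint (fun=> (0 : R) ^+ 2) T = 0 by rewrite expr0n /= oint_cst ?mul0r// ltW.
have sN (f : R -> R) : (fun x => (- f x) ^+ 2) = (fun x => f x ^+ 2).
  by apply/funext => x; rewrite sqrrN.
move: p1 p2 p3 p4; case: i => [[|[|[|[|[|[|[|[|]]]]]]]] //= ?]; rewrite /forcing_of /= ?z ?sN;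
  move: (oint _ _) (oint _ _) (oint _ _) (oint _ _) => A B C D; lra.
Qed.

(** Each of the four real components contributes at most B^2 T to the squared norm. *)
Lemma eigen_fun_norm_le Y F (T B : R) : 0 < T -> 0 <= B -> PT2 T F ->
  (forall i, continuous (Y i)) -> ae_eqC2 F (eigen_fun Y) ->
  (forall i x, 0 <= x <= T -> `|Y i x| <= B) ->
  normPT2 T F <= 2 * Num.sqrt T * B.
Proof.
move=> T0 B0 pF cY [/ae_eqCP[e0 e1] /ae_eqCP[e2 e3]] YB.
have [/PTP[l0 l1 _ _] /PTP[l2 l3 _ _]] := pF.
have bnd f i : loc2 f -> {ae lam, forall x, f x = Y i x} ->
    oint (fun x => f x ^+ 2) T <= B ^+ 2 * T.
  move=> lf fY; rewrite -oint_cst ?(ltW T0)//.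
  rewrite (oint_eq (g := fun x => Y i x ^+ 2) T lf.2 (continuous_loc2 (@cY i)).2); last first.
    by apply: ae_imp fY => x ->.
  apply: oint_le => //; [exact: ltW|exact: (continuous_loc2 (@cY i)).2|exact: locint_cst|].
  move=> t tT; rewrite -(real_normK (num_real (Y i t))).
  by rewrite lerXn2r ?nnegrE//; exact: YB.
have S0 : 0 <= Num.sqrt T by exact: sqrtr_ge0.
rewrite -(@ler_pXn2r _ 2) ?nnegrE//; [|exact: sqrtr_ge0|by rewrite !mulr_ge0].
rewrite normPT2_sqr// !exprMn sqr_sqrtr ?(ltW T0)//.
have := bnd _ _ l0 e0; have := bnd _ _ l1 e1.
have := bnd _ _ l2 e2; have := bnd _ _ l3 e3.
move: (oint _ _) (oint _ _) (oint _ _) (oint _ _) => c1 c2 c3 c4.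
rewrite [2 ^+ 2 * T * B ^+ 2](_ : _ = 4 * (B ^+ 2 * T)); last by ring.
move: (B ^+ 2 * T) => P; lra.
Qed.

Section Stability.
Variables (a b T : R) (q : R -> R).
Hypothesis cq : continuous q.
Hypothesis q_le1 : forall x, `|q x| <= 1.
Hypothesis T0 : 0 < T.
Hypothesis qT : forall x, q (x + T) = q x.
Hypothesis no_periodic : forall (mu nu : R) Y, mu != 0 -> eigen_solution a b mu nu q Y ->
  (forall i x, Y i (x + T) = Y i x) -> forall i x, Y i x = 0.

Lemma stability : spectrally_stable T a b q.
Proof.
move=> [mu nu] /=; apply: contra_notP => /eqP mu0.
pose A := eigen_mx a b mu nu q.
have cA i j : continuous (A i j) by exact: eigen_mx_continuous.
have AT i j x : A i j (x + T) = A i j x by rewrite /A /eigen_mx qT.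
have M0 := eigen_bound_ge0 a b mu nu.
have AM := eigen_mx_bound a b mu nu q_le1.
have np Y : (forall i x, is_derive x 1 (Y i) (act A Y i x)) ->
    (forall i x, Y i (x + T) = Y i x) -> forall i x, Y i x = 0.
  exact: no_periodic.
have [C C0 res] := periodic_resolvent cA M0 AM T0 AT np.
have uniq := mild_unique cA np.
have DM := @domJL_mild _ a b mu nu T q cq q_le1 qT.
split.
- move=> g pg; have [Y [mY YT _]] := res _ (forcing_ofP pg).
  by have [dF eF] := mild_domJL cq pg mY YT; exists (eigen_fun Y).
- move=> F1 F2 d1 d2 [/ae_eqCP[e1 e1'] /ae_eqCP[e2 e2']].
  have [p1 [Y1 [m1 YT1 E1]]] := DM _ d1.
  have [p2 [Y2 [m2 YT2 E2]]] := DM _ d2.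
  set g1 := JL a b q F1 - _ in p1 m1 e1 e1' e2 e2'.
  set g2 := JL a b q F2 - _ in p2 m2 e1 e1' e2 e2'.
  have [[_ i1 _] [_ i2 _]] := (forcing_ofP p1, forcing_ofP p2).
  (* Forcings that agree almost everywhere have the same primitives, so both representatives are
     mild solutions for one forcing and uniqueness identifies them. *)
  have gg i : {ae lam, forall x, forcing_of g2 i x = forcing_of g1 i x}.
    case: i => [[|[|[|[|[|[|[|[|]]]]]]]] //= ?]; try by apply: aeW.
    + by apply: ae_imp e2 => x; rewrite /forcing_of /= => ->.
    + by apply: ae_imp e2' => x; rewrite /forcing_of /= => ->.
    + by apply: ae_imp e1 => x; rewrite /forcing_of /= => ->.
    + by apply: ae_imp e1' => x; rewrite /forcing_of /= => ->.
  have m2' : mild_solution A (forcing_of g1) Y2.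
    have [c2 Y2E] := m2; split => // i x.
    by rewrite Y2E (oint_eq x (i2 i) (i1 i) (gg i)).
  have E : eigen_fun Y1 = eigen_fun Y2.
    have e := uniq _ _ _ m1 m2' YT1 YT2.
    by rewrite /eigen_fun; congr pair; apply/funext => x; rewrite !e.
  move: E1 E2; rewrite E => -[h1 h2] [h3 h4].
  have F := ae_filter_ringOfSetsType lam.
  by split; [apply: filterS2 h1 h3|apply: filterS2 h2 h4] => x -> ->.
(* Eight forcing components, each with L^1 norm at most sqrt T times the norm of g by
   Cauchy-Schwarz; [C] passes to the sup norm of the solution and [2 * Num.sqrt T] back to L^2. *)
- exists (2 * Num.sqrt T * (C * (8 * Num.sqrt T))) => F dF.
  have [pg [Y [mY YT E]]] := DM _ dF.
  have [Z [mZ ZT ZB]] := res _ (forcing_ofP pg).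
  have YZ := uniq _ _ _ mY mZ YT ZT.
  have [[_ p1] [_ p2]] := dF.
  set g := JL a b q F - _ in pg mZ ZB *.
  have N0 : 0 <= normPT2 T g by exact: sqrtr_ge0.
  have S0 : 0 <= Num.sqrt T by exact: sqrtr_ge0.
  suff : normPT2 T F <= 2 * Num.sqrt T * (C * (8 * Num.sqrt T * normPT2 T g)).
    by rewrite !mulrA.
  apply: (eigen_fun_norm_le T0 _ _ mY.1 E) => //; first by rewrite !mulr_ge0.
  move=> i x xT; rewrite YZ; apply: le_trans (ZB i x xT) _.
  rewrite ler_wpM2l//.
  have le j : \int[lam]_(t in `[0, T]) `|forcing_of g j t| <= Num.sqrt T * normPT2 T g.
    rewrite -[X in X <= _](_ : oint (fun t => `|forcing_of g j t|) T = _); last first.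
      by rewrite /oint (ltW T0).
    have l2 := ((PT2P T g).1 pg j).1.
    have n0 : 0 <= oint (fun t => `|forcing_of g j t|) T.
      by rewrite /oint (ltW T0); exact: Rintegral_ge0.
    rewrite -(@ler_pXn2r _ 2) ?nnegrE ?mulr_ge0//.
    rewrite exprMn sqr_sqrtr ?(ltW T0)//; apply: le_trans (sqr_oint_norm T0 l2) _.
    by rewrite ler_wpM2l ?(ltW T0)//; exact: forcing_sqr_le.
  apply: le_trans (ler_sum _ (fun j _ => le j)) _.
  by rewrite sumr_const card_ord -[leLHS]mulr_natl mulrA.
Qed.

End Stability.
End ResolventBound.

Theorem theorem1p2 (R : realType) :
  exists kc : R,
    unique (fun k : R => 0 < k < 1 /\ ellipK k = 2 * ellipE k) kc /\
    (forall k : R, 0 < k < 1 ->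
       spectrally_stable (4 * ellipK k) (1 + k ^+ 2) (- (2 * k ^+ 2))
         (jacobi_sn k)) /\
    (forall k : R, 0 < k < kc ->
       spectrally_stable (4 * ellipK k) (1 - 2 * k ^+ 2) (2 * k ^+ 2)
         (jacobi_cn k)).
Proof.
have [kc kcP] := @critical_modulus R; exists kc; split => //.
have [[/andP[_ kc1] _] _] := kcP.
split=> k kI.
  apply: stability => [x|||x|mu nu Y mu0 sY YT]; last exact: sn_no_periodic kI mu0 YT sY.
  - exact: der_continuous (der_sn kI x).
  - exact: sn_le1.
  - by rewrite mulr_gt0// ellipK_gt0.
  - exact: sn_periodic.
have {}kI : 0 < k < 1 by case/andP: kI => -> /lt_trans ->.
apply: stability => [x|||x|mu nu Y mu0 sY YT]; last exact: cn_no_periodic kI mu0 YT sY.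
- exact: der_continuous (der_cn kI x).
- exact: cn_le1.
- by rewrite mulr_gt0// ellipK_gt0.
- exact: cn_periodic.
Qed.
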